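(* Let $\mu$ be a finite positive Borel measure on $(-1,1)$ that is regular. Let $p>0$. Let $I$ be a closed subinterval of $(-1,1)$ in which $\mu$ is absolutely continuous, and $w$ is bounded above and below by positive constants. Then if $I'$ is a closed subinterval of the interior $I^0$ of $I$, uniformly for $a,b$ in compact subsets of the complex plane, $$\lim_{n\to\infty}\int_{I'}\left|\frac{K_n\left(x+\frac{a}{\widetilde K_n(x,x)},\,x+\frac{b}{\widetilde K_n(x,x)}\right)}{K_n(x,x)}-\frac{\sin\pi(a-b)}{\pi(a-b)}\right|^p dx=0.$$
   Context: For a finite positive Borel measure $\mu$ on $(-1,1)$ with infinite support, the orthonormal polynomials are $p_n(x)=\gamma_n x^n+\cdots$, $\gamma_n>0$, $n\ge 0$, with $\int_{-1}^1 p_np_m\,d\mu=\delta_{mn}$. The measure $\mu$ is called regular (on $[-1,1]$) if $\lim_{n\to\infty}\gamma_n^{1/n}=2$. The function $w=d\mu/dx$ denotes (a fixed version of) the density of the absolutely continuous part of $\mu$. The reproducing kernel is $K_n(x,y)=\sum_{k=0}^{n-1}p_k(x)p_k(y)$ (a polynomial in $x,y$, so defined for complex arguments), and $\widetilde K_n(x,x)=w(x)K_n(x,x)$ for real $x\in(-1,1)$. When $a=b$, $\frac{\sin\pi(a-b)}{\pi(a-b)}$ is interpreted as $1$. *)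

(* Defs.v *)
From HB Require Import structures.
From mathcomp Require Import all_boot all_order all_algebra.
From mathcomp Require Import all_classical all_reals all_analysis.
From mathcomp Require Import complex.

Set Implicit Arguments.
Unset Strict Implicit.
Unset Printing Implicit Defensive.

Import Order.TTheory GRing.Theory Num.Theory.
Import numFieldTopology.Exports numFieldNormedType.Exports.

Local Open Scope classical_set_scope.
Local Open Scope ring_scope.

(* A Borel measure on (-1,1) is represented by a Borel measure on R giving no
   mass to the complement of (-1,1). *)
Definition carried_by_open_unit (R : realType)
    (mu : {measure set (measurableTypeR R) -> \bar R}) : Prop :=
  mu (~` `]-1, 1[) = 0%E.

Definition measure_support (R : realType)
    (mu : {measure set (measurableTypeR R) -> \bar R}) : set R :=
  [set x : R | forall U : set R, open U -> U x -> (0 < mu U)%E].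

Definition orthonormal_polys (R : realType)
    (mu : {measure set (measurableTypeR R) -> \bar R})
    (p : nat -> {poly R}) : Prop :=
  [/\ forall n, size (p n) = n.+1,
      forall n, 0 < lead_coef (p n) &
      forall n m,
        (\int[mu]_(x in `](-1)%R, 1%R[) ((p n).[x] * (p m).[x])%:E
         = ((n == m)%:R)%:E)%E].

(* Orthonormal polynomials are unique, and exist when the support of mu is
   infinite, so the quantification over p only names the sequence. *)
Definition regular_measure (R : realType)
    (mu : {measure set (measurableTypeR R) -> \bar R}) : Prop :=
  forall p : nat -> {poly R}, orthonormal_polys mu p ->
    (fun n : nat => lead_coef (p n) `^ (n%:R^-1)) @ \oo --> (2 : R).

(* w is a version of the density in the Lebesgue decomposition
   d mu = w dx + d nu, with nu singular. *)
Definition ac_density (R : realType)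
    (mu : {measure set (measurableTypeR R) -> \bar R}) (w : R -> R) : Prop :=
  [/\ measurable_fun [set: measurableTypeR R] (w : measurableTypeR R -> R),
      forall x, 0 <= w x &
      exists nu : {measure set (measurableTypeR R) -> \bar R},
        (exists N : set (measurableTypeR R),
          [/\ measurable N, lebesgue_measure N = 0%E & nu (~` N) = 0%E]) /\
        (forall A : set (measurableTypeR R), measurable A ->
          mu A = (\int[lebesgue_measure]_(x in A) (w x)%:E + nu A)%E)].

Definition abs_continuous_on (R : realType)
    (mu : {measure set (measurableTypeR R) -> \bar R}) (I : set R) : Prop :=
  forall A : set (measurableTypeR R), measurable A -> A `<=` I ->
    lebesgue_measure A = 0%E -> mu A = 0%E.

(* K_n(x, y), over an arbitrary coefficient ring so that it serves for both
   real and complex arguments. *)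
Definition repr_kernel (F : nzRingType) (p : nat -> {poly F}) (n : nat)
    (x y : F) : F :=
  \sum_(k < n) (p k).[x] * (p k).[y].

Definition repr_kernelC (R : realType) (p : nat -> {poly R}) (n : nat)
    (x y : R[i]) : R[i] :=
  repr_kernel (fun k => map_poly (real_complex R) (p k)) n x y.

Definition repr_kernel_tilde (R : realType) (w : R -> R)
    (p : nat -> {poly R}) (n : nat) (x : R) : R :=
  w x * repr_kernel p n x x.

Definition cexp (R : realType) (z : R[i]) : R[i] :=
  Complex (expR (complex.Re z) * cos (complex.Im z))
          (expR (complex.Re z) * sin (complex.Im z)).

Definition csin (R : realType) (z : R[i]) : R[i] :=
  let i : R[i] := Complex 0 1 in
  (cexp (i * z) - cexp (- (i * z))) / (2 * i).

Definition sinc_pi (R : realType) (z : R[i]) : R[i] :=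
  let piz : R[i] := real_complex R pi * z in
  if z == 0 then 1 else csin piz / piz.

(* Main.v *)
Require Import Defs.
From HB Require Import structures.
From mathcomp Require Import all_boot all_order all_algebra.
From mathcomp Require Import all_classical all_reals all_analysis.
From mathcomp Require Import measurable_realfun complex.
From mathcomp Require Import ring lra zify.
Set Implicit Arguments.
Unset Strict Implicit.
Unset Printing Implicit Defensive.
Import Order.TTheory GRing.Theory Num.Theory.
Import numFieldTopology.Exports numFieldNormedType.Exports.
Local Open Scope classical_set_scope.
Local Open Scope ring_scope.

(** Let [omega(x) = 1 / (pi sqrt (1 - x^2))]. Regularity is used only through the weak
    convergence of [K_n(x,x) dmu / n] to [omega dx]. Testing it against a Chebyshev polynomial
    [T_j] amounts to bounding [int T_j K_n dmu], the trace of a Gram matrix of [p_0, ..., p_(n-1)].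
    By Jensen's inequality in an eigenbasis that trace is at most the log-determinant of the
    Gram matrix for the weight [(1 - 2 rho T_j + rho^2)^(-N)], [N ~ sigma n]. Hadamard's inequality
    bounds the determinant, after triangular changes of basis, by the masses of explicit
    polynomials of Bernstein-Szego type, and by regularity the leading coefficients contribute
    only [o(n^2)].

    Let [R_n] be the kernel of the Chebyshev measure and [G] a polynomial close to [omega / w] in
    [L^1(I)], bounded above and below. Expanding the square, the weak convergence above gives
    [int_I' int (K_n(x,t) - G(x) R_n(x,t))^2 dmu(t) dx <= eps n]. As a function of [x], each
    coefficient of this difference in the basis [p_i] is a polynomial of degree [O(n)], so Bernstein's
    inequality in [L^2] controls its derivatives. Hence
    [sum_(i<n) p_i^(j)(x) p_i^(k)(x) / n^(j+k+1)] has in [L^1(I')] the same limit as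
    [omega / w] times its Chebyshev analogue,
    [(pi omega)^(j+k) cos ((j - k) pi / 2) / (j + k + 1)].

    After rescaling these are the Taylor coefficients, in [(a, b)], of [sin pi(a-b) / (pi(a-b))].
    They are dominated by [C E^(j+k)] uniformly in [n] and [x], so the Taylor series may be
    truncated, and boundedness upgrades [L^1] convergence to [L^p]. *)

(** * Chebyshev polynomials and their kernel *)

(** Regularity only says that the [n]-th roots of the leading coefficients tend to 2, so the sum
    over [k < n] of [ln (gamma_k / 2^k)] is only known to be at most [o(n^2)]. A fixed test function
    would be invisible at that scale. Raising the weight to a power [N] proportional to [n] lifts
    the trace to order [n^2], and dividing by [N] brings the error back to an arbitrarily small
    multiple of [n]. What remains is [2 rho int T_j K_n dmu <= (rho^2 + eps) n]; dividing by a small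
    [rho] of either sign kills the moment.

    The second obstacle is that [w] is merely bounded and measurable on [I], so limits are taken in
    [L^1] and [omega / w] is replaced by a polynomial [G]: differences of kernels then stay
    polynomial in [x] and Bernstein's inequality applies to them. In the expanded square [K_n(x,x)]
    has a positive sign, so the upper half of the weak convergence is enough; the square being
    nonnegative supplies the other half. In this comparison the part of [mu] outside [I] is seen
    only through the off-diagonal decay [|x - t| |R_n(x,t)| <= 2]. *)

Section PolyBasis.
Variable F : fieldType.

Lemma poly_basis_expansion (B : nat -> {poly F}) (hB : forall k, size (B k) = k.+1)
  (n : nat) (P : {poly F}) : (size P <= n)%N ->
  exists c : nat -> F, P = \sum_(k < n) c k *: B k.
Proof.
elim: n P => [|n IH] P sP.
  exists (fun=> 0); rewrite big_ord0; apply/eqP.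
  by rewrite -size_poly_leq0.
have lB : lead_coef (B n) != 0 by rewrite lead_coef_eq0 -size_poly_eq0 hB.
pose a := P`_n / lead_coef (B n).
have sQ : (size (P - a *: B n)%R <= n)%N.
  apply/leq_sizeP => j; rewrite leq_eqVlt => /orP[/eqP <-|nj].
    rewrite coefB coefZ /a -[X in _ * X](_ : lead_coef (B n) = _).
      by rewrite divfK// subrr.
    by rewrite lead_coefE hB.
  rewrite coefB coefZ [P`_j]nth_default ?(leq_trans sP)//.
  by rewrite [(B n)`_j]nth_default ?hB// mulr0 subrr.
have [c hc] := IH _ sQ.
exists (fun k => if k == n then a else c k).
rewrite big_ord_recr/= eqxx -[LHS](subrK (a *: B n)) hc; congr (_ + _).
by apply: eq_bigr => i _; rewrite ltn_eqF.
Qed.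

End PolyBasis.

Lemma sum_mul_CS (R : realFieldType) (I : finType) (a b : I -> R) :
  (\sum_i a i * b i) ^+ 2 <= (\sum_i a i ^+ 2) * (\sum_i b i ^+ 2).
Proof.
set A := \sum_i a i ^+ 2; set B := \sum_i b i ^+ 2; set S := \sum_i a i * b i.
have A0 : 0 <= A by apply: sumr_ge0 => i _; exact: sqr_ge0.
have [Az|An] := eqVneq A 0.
  have a0 i : a i = 0.
    apply/eqP; rewrite -sqrf_eq0; move/eqP: Az.
    by rewrite psumr_eq0 => [/allP/(_ i (mem_index_enum _))//|j _]; exact: sqr_ge0.
  by rewrite /S big1 ?expr0n ?Az ?mul0r// => i _; rewrite a0 mul0r.
have Ap : 0 < A by rewrite lt_def An.
have : 0 <= \sum_i (S * a i - A * b i) ^+ 2.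
  by apply: sumr_ge0 => i _; exact: sqr_ge0.
have -> : \sum_i (S * a i - A * b i) ^+ 2 = A * (A * B - S ^+ 2).
  transitivity (\sum_i (S ^+ 2 * a i ^+ 2 - (2 * S * A) * (a i * b i) + A ^+ 2 * b i ^+ 2)).
    by apply: eq_bigr => i _; ring.
  rewrite !big_split/= sumrN -!mulr_sumr -/A -/B -/S. ring.
by rewrite pmulr_rge0// subr_ge0.
Qed.

Lemma normr_le_sqr (R : realDomainType) (a b : R) : 0 <= b ->
  (`|a| <= b) = (a ^+ 2 <= b ^+ 2).
Proof.
by move=> b0; rewrite -(@ler_pXn2r _ 2) ?nnegrE// -normrX ger0_norm// sqr_ge0.
Qed.

Section Chebyshev.
Variable R : realFieldType.
Implicit Types (x : R) (k n j : nat).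

(* Iterating multiplication by [x + i sqrt(1 - x^2)]: the first component is the
   Chebyshev polynomial T_n and the second one is U_(n-1). *)
Fixpoint chebTV n : {poly R} * {poly R} :=
  if n is m.+1 then
    let: (t, v) := chebTV m in ('X * t - (1 - 'X^2) * v, 'X * v + t)
  else (1, 0).

Definition chebT n := (chebTV n).1.
Definition chebV n := (chebTV n).2.

Lemma chebTS n : chebT n.+1 = 'X * chebT n - (1 - 'X^2) * chebV n.
Proof. by rewrite /chebT /chebV /=; case: (chebTV n). Qed.

Lemma chebVS n : chebV n.+1 = 'X * chebV n + chebT n.
Proof. by rewrite /chebT /chebV /=; case: (chebTV n). Qed.

Lemma chebT0 : chebT 0 = 1. Proof. by []. Qed.
Lemma chebV0 : chebV 0 = 0. Proof. by []. Qed.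

Lemma chebT1 : chebT 1 = 'X.
Proof. by rewrite chebTS chebT0 chebV0 mulr0 subr0 mulr1. Qed.

Lemma chebV1 : chebV 1 = 1.
Proof. by rewrite chebVS chebT0 chebV0 mulr0 add0r. Qed.

Lemma chebT_rec n : chebT n.+2 = 2 *: ('X * chebT n.+1) - chebT n.
Proof.
rewrite chebTS chebVS.
have -> : (1 - 'X^2) * ('X * chebV n + chebT n) =
   'X * ((1 - 'X^2) * chebV n) + (1 - 'X^2) * chebT n by ring.
have -> : (1 - 'X^2) * chebV n = 'X * chebT n - chebT n.+1.
  by rewrite chebTS; ring.
by rewrite scaler_nat; ring.
Qed.

Lemma chebV_rec n : chebV n.+2 = 2 *: ('X * chebV n.+1) - chebV n.
Proof.
rewrite chebVS chebTS (_ : chebT n = chebV n.+1 - 'X * chebV n).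
  by rewrite scaler_nat; ring.
by rewrite chebVS; ring.
Qed.

Lemma chebT_sqr n : chebT n ^+ 2 + (1 - 'X^2) * chebV n ^+ 2 = 1.
Proof.
elim: n => [|n IH]; first by rewrite chebT0 chebV0; ring.
by rewrite -[RHS]IH chebTS chebVS; ring.
Qed.

(** Common to [chebT] and to [chebV] shifted by one: the term [2X u] dominates, so the degree rises
    by one and the leading coefficient doubles at each step. *)
Lemma size_cheb_rec (u : nat -> {poly R}) (d : nat) (c : R) :
  (forall n, u n.+2 = 2 *: ('X * u n.+1) - u n) ->
  size (u 0) = d.+1 -> size (u 1) = d.+2 -> c != 0 -> lead_coef (u 1) = c ->
  forall n, size (u n.+1) = (n + d).+2 /\ lead_coef (u n.+1) = c * 2 ^+ n.
Proof.
move=> urec s0 s1 c0 l1.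
have st n : (size (u n) <= n + d.+1)%N -> size (u n.+1) = (n + d).+2 ->
    lead_coef (u n.+1) = c * 2 ^+ n ->
    size (u n.+2) = (n.+1 + d).+2 /\ lead_coef (u n.+2) = c * 2 ^+ n.+1.
  move=> h1 h2 h3.
  have e1 : size (2 *: ('X * u n.+1)) = (n.+1 + d).+2.
    rewrite size_scale ?pnatr_eq0// mulrC size_mulX ?h2//.
    by rewrite -size_poly_eq0 h2.
  have lt : (size (- u n)%R < size (2 *: ('X * u n.+1))%R)%N.
    by rewrite size_polyN e1; apply: leq_ltn_trans h1 _; lia.
  rewrite urec size_polyDl// e1; split => //.
  rewrite lead_coefDl// lead_coefZ mulrC lead_coefM lead_coefX mul1r h3.
  by rewrite exprSr mulrA.
have : forall n, [/\ (size (u n) <= n + d.+1)%N, size (u n.+1) = (n + d).+2 &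
    lead_coef (u n.+1) = c * 2 ^+ n].
  elim=> [|n [h1 h2 h3]]; first by rewrite s0 s1 l1 expr0 mulr1 add0n.
  have [] := st n h1 h2 h3; by rewrite h2; split => //; lia.
by move=> h n; have [] := h n.
Qed.

Lemma size_chebT n : size (chebT n) = n.+1.
Proof.
case: n => [|n]; first by rewrite chebT0 size_poly1.
have [] := @size_cheb_rec chebT 0 1 chebT_rec _ _ _ _ n;
  rewrite ?chebT0 ?chebT1 ?size_poly1 ?size_polyX ?oner_neq0 ?lead_coefX//.
by rewrite addn0.
Qed.

Lemma lead_coef_chebTS n : lead_coef (chebT n.+1) = 2 ^+ n.
Proof.
have [] := @size_cheb_rec chebT 0 1 chebT_rec _ _ _ _ n;
  rewrite ?chebT0 ?chebT1 ?size_poly1 ?size_polyX ?oner_neq0 ?lead_coefX//.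
by rewrite mul1r.
Qed.

Lemma size_chebVS n : size (chebV n.+1) = n.+1.
Proof.
case: n => [|n]; first by rewrite chebV1 size_poly1.
have V2 : chebV 2 = 2 *: 'X.
  by rewrite chebV_rec chebV1 chebV0 subr0 mulr1.
have two0 : (2 : R) != 0 by rewrite pnatr_eq0.
have [] := @size_cheb_rec (chebV \o succn) 0 2 _ _ _ _ _ n;
  rewrite /= ?chebV1 ?V2 ?size_poly1 ?size_scale ?size_polyX ?lead_coefZ ?lead_coefX ?mulr1 ?addn0//.
by move=> m; rewrite chebV_rec.
Qed.

(** With [x = cos t] these are the derivatives of [cos(nt)] and [sin(nt) / sin t]. They are proved
    together because the inductive step of each uses the other. *)
Lemma chebTV_deriv n : (chebT n)^`() = n%:R *: chebV n /\
  (1 - 'X^2) * (chebV n)^`() = 'X * chebV n - n%:R *: chebT n.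
Proof.
elim: n => [|n [hT hV]].
  by rewrite chebT0 chebV0 -polyC1 derivC deriv0 !scale0r !mulr0 subrr.
have dX2 : (1 - 'X^2 : {poly R})^`() = - (2 *: 'X).
  by rewrite derivB -polyC1 derivC derivXn sub0r /= expr1 scaler_nat.
split.
  rewrite chebTS derivB !derivM dX2 derivX hT hV mul1r chebVS.
  rewrite -!mul_polyC !polyC_natr -natr1; ring.
rewrite chebVS chebTS derivD derivM derivX mul1r hT !mulrDr.
rewrite mulrCA hV -!mul_polyC !polyC_natr -natr1; ring.
Qed.

Lemma chebT_deriv n : (chebT n)^`() = n%:R *: chebV n.
Proof. by have [] := chebTV_deriv n. Qed.

Lemma chebT_ode n : (1 - 'X^2) * (chebT n)^`(2) =
  'X * (chebT n)^`() - (n%:R ^+ 2) *: chebT n.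
Proof.
rewrite derivnS derivn1 chebT_deriv derivZ -scalerAr.
have [_ ->] := chebTV_deriv n; rewrite -!mul_polyC !polyC_natr !rmorphXn /= polyC_natr; ring.
Qed.

(** The Chebyshev equation differentiated [j] times: a recurrence in the order of differentiation,
    from which both the upper bounds and the asymptotics of the derivatives are drawn. *)
Lemma chebT_ode_derivn n j : (1 - 'X^2) * (chebT n)^`(j.+2) =
  ((2 * j + 1)%:R *: 'X) * (chebT n)^`(j.+1) - (n%:R ^+ 2 - j%:R ^+ 2) *: (chebT n)^`(j).
Proof.
elim: j => [|j IH].
  by rewrite muln0 add0n scale1r expr0n/= subr0 chebT_ode.
have := congr1 (@deriv R) IH.
have dX2 : (1 - 'X^2 : {poly R})^`() = - (2 *: 'X).
  by rewrite derivB -polyC1 derivC derivXn sub0r /= expr1 scaler_nat.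
rewrite derivM dX2 derivB derivM !derivZ derivX -!derivnS => /eqP.
rewrite addrC eq_sym -subr_eq => /eqP <-.
rewrite -!mul_polyC !polyC_natr !polyCB !rmorphXn /= !polyC_natr.
rewrite !natrD !natrM -[j.+1%:R]natr1; ring.
Qed.

Lemma horner_chebT_sqr n x :
  (chebT n).[x] ^+ 2 + (1 - x ^+ 2) * (chebV n).[x] ^+ 2 = 1.
Proof. by have := congr1 (horner^~ x) (chebT_sqr n); rewrite !hornerE. Qed.

Lemma chebT_le1 n x : x ^+ 2 <= 1 -> `|(chebT n).[x]| <= 1.
Proof.
move=> x2; rewrite normr_le_sqr// expr1n.
rewrite -(horner_chebT_sqr n x) lerDl mulr_ge0 ?sqr_ge0//; lra.
Qed.

Lemma chebV_bound n x (dl : R) : 0 < dl -> dl <= 1 - x ^+ 2 ->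
  (chebV n).[x] ^+ 2 <= dl^-1.
Proof.
move=> d0 dx; rewrite -[_^-1]mul1r ler_pdivlMr//.
apply: le_trans (_ : (chebV n).[x] ^+ 2 * (1 - x ^+ 2) <= 1).
  by rewrite ler_wpM2l ?sqr_ge0.
by rewrite mulrC -[leRHS](horner_chebT_sqr n x) lerDr sqr_ge0.
Qed.

(* The constants are geometric in [j], so that the Taylor coefficients at scale [1/n]
   stay summable. *)
Lemma chebT_derivn_bound (dl : R) n k j x : 0 < dl -> dl <= 1 -> dl <= 1 - x ^+ 2 ->
  (k <= n)%N ->
  `|(chebT k)^`(j.+1).[x]| <= k%:R * (4 / dl) * ((4 / dl) * n%:R) ^+ j.
Proof.
move=> d0 d1 dx kn; set D := 4 / dl; set M := D * n%:R.
have D0 : 0 < D by rewrite divr_gt0.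
have D4 : 4 <= D by rewrite ler_pdivlMr//; lra.
have x2 : x ^+ 2 <= 1 by lra.
have xn : `|x| <= 1.
  by rewrite normr_le_sqr// expr1n.
have dlM : dl * M = 4 * n%:R by rewrite /M /D mulrA [dl * _]mulrC divfK ?gt_eqF.
have M0 : 0 <= M by rewrite mulr_ge0 ?ler0n// ltW.
have x0 : 0 < 1 - x ^+ 2 by exact: lt_le_trans dx.
have kn' : k%:R <= n%:R :> R by rewrite ler_nat.
have k0 : 0 <= k%:R :> R by rewrite ler0n.
have big (y : {poly R}) : dl * `|y.[x]| <= `|((1 - 'X^2) * y).[x]|.
  rewrite !hornerE normrM ler_wpM2r// gtr0_norm//.
have V1 : `|(chebT k)^`().[x]| <= k%:R * D.
  rewrite chebT_deriv hornerZ normrM normr_nat ler_wpM2l//.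
  rewrite normr_le_sqr; last exact: ltW.
  apply: (le_trans (chebV_bound k d0 dx)).
  apply: (@le_trans _ _ D); last by rewrite expr2 -[X in X <= _]mul1r ler_wpM2r//; lra.
  by rewrite /D -[X in X <= _]mul1r ler_wpM2r ?invr_ge0 ?ltW//; lra.
(* The claim concerns order [j + 1]. Order 1 is the bound on [chebV], order 2 comes from the
   equation and [|T_k| <= 1], every higher order from the two preceding ones. Each division by
   [1 - x^2] costs [1/dl], which [dl * M = 4n] absorbs. *)
elim/ltn_ind: j => -[|[|j]] IH.
- by rewrite expr0 mulr1.
- rewrite expr1 -(ler_pM2l d0); apply: (le_trans (big _)).
  rewrite chebT_ode hornerD hornerN; apply: (le_trans (ler_normB _ _)).
  rewrite hornerM hornerZ hornerX normrM normrM normrX normr_nat expr2.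
  have h1 : `|x| * `|(chebT k)^`().[x]| <= k%:R * D.
    by rewrite -[leRHS]mul1r ler_pM.
  have h2 : k%:R * k%:R * `|(chebT k).[x]| <= k%:R * n%:R.
    rewrite -[leRHS]mulr1; apply: ler_pM => //.
    - by rewrite ler_wpM2l.
    - exact: chebT_le1.
  apply: (le_trans (lerD h1 h2)).
  have -> : dl * (k%:R * D * M) = k%:R * (4 * (D * n%:R)).
    transitivity (k%:R * D * (dl * M)); first by ring.
    by rewrite dlM; ring.
  rewrite -mulrDr; have [->|kz] := posnP k; first by rewrite !mul0r.
  rewrite ler_wpM2l//.
  have n1 : 1 <= n%:R :> R by rewrite (ler_nat _ 1); exact: leq_trans kn.
  have e1 : D <= D * n%:R by rewrite -[leLHS]mulr1 ler_wpM2l// ltW.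
  have e2 : n%:R <= D * n%:R by rewrite -[leLHS]mul1r ler_wpM2r//; lra.
  have e3 : 0 <= D * n%:R by [].
  by lra.
(* If [k <= j + 1] the derivative vanishes by degree. Otherwise [j + 1 < k <= n], so the
   coefficients of the recurrence are at most [3n] and [n^2], and [3nM + n^2 <= 4nM]. *)
- have [kj|jk] := leqP k j.+1.
    have -> : (chebT k)^`(j.+3) = 0 by apply: derivn_poly0; rewrite size_chebT; clear -kj; lia.
    by rewrite horner0 normr0 mulr_ge0 ?exprn_ge0// mulr_ge0// ltW.
  rewrite -(ler_pM2l d0); apply: (le_trans (big _)).
  rewrite chebT_ode_derivn hornerD hornerN; apply: (le_trans (ler_normB _ _)).
  rewrite hornerM !hornerZ hornerX !normrM normr_nat.
  have I1 := IH j.+1 (ltnSn _); have I0 := IH j (ltnW (ltnSn _)).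
  have jn : (j.+1 <= n)%N by clear -jk kn; lia.
  have h1 : (2 * j.+1 + 1)%:R * `|x| * `|(chebT k)^`(j.+2).[x]| <=
            (3 * n%:R) * (k%:R * D * M ^+ j.+1).
    apply: ler_pM => //.
    rewrite -[leRHS]mulr1 ler_pM// -natrM ler_nat; clear -jn; lia.
  have h2 : `|k%:R ^+ 2 - j.+1%:R ^+ 2| * `|(chebT k)^`(j.+1).[x]| <=
     n%:R ^+ 2 * (k%:R * D * M ^+ j).
    apply: ler_pM => //.
    have jk' : j.+1%:R <= k%:R :> R by rewrite ler_nat ltnW.
    have j0 : 0 <= j.+1%:R :> R by rewrite ler0n.
    have e1 : j.+1%:R ^+ 2 <= k%:R ^+ 2 :> R by rewrite lerXn2r ?nnegrE.
    have e2 : k%:R ^+ 2 <= n%:R ^+ 2 :> R by rewrite lerXn2r ?nnegrE.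
    have e3 : 0 <= j.+1%:R ^+ 2 :> R by rewrite sqr_ge0.
    by rewrite ger0_norm; lra.
  apply: (le_trans (lerD h1 h2)).
  have -> : dl * (k%:R * D * M ^+ j.+2) = (k%:R * D * M ^+ j) * (4 * n%:R * M).
    by rewrite -dlM !exprSr; ring.
  have -> : 3 * n%:R * (k%:R * D * M ^+ j.+1) + n%:R ^+ 2 * (k%:R * D * M ^+ j) =
      (k%:R * D * M ^+ j) * (3 * n%:R * M + n%:R ^+ 2).
    by rewrite exprSr; ring.
  rewrite ler_wpM2l //;
  first by rewrite mulr_ge0 ?exprn_ge0// mulr_ge0// ltW.
  have e1 : n%:R <= M by rewrite /M -[leLHS]mul1r ler_wpM2r//; lra.
  have e2 : n%:R ^+ 2 <= n%:R * M by rewrite expr2 ler_wpM2l.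
  by have -> : 4 * n%:R * M = 3 * n%:R * M + n%:R * M; [ring|rewrite lerD2l].
Qed.

Lemma chebT_derivn_bound' (dl : R) n k j x : 0 < dl -> dl <= 1 -> dl <= 1 - x ^+ 2 ->
  (k <= n)%N ->
  `|(chebT k)^`(j).[x]| <= ((4 / dl) * n%:R) ^+ j.
Proof.
move=> d0 d1 dx kn; case: j => [|j].
  by rewrite expr0 derivn0 chebT_le1//; lra.
apply: (le_trans (chebT_derivn_bound _ d0 d1 dx kn)).
have D0 : 0 <= 4 / dl by rewrite divr_ge0// ltW.
rewrite exprS; apply: ler_wpM2r; first by rewrite exprn_ge0// mulr_ge0.
by rewrite mulrC ler_wpM2l// ler_nat.
Qed.

(* Christoffel-Darboux kernel of the Chebyshev measure. *)
Definition chebK n x (t : R) : R :=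
  \sum_(1 <= i < n) 2 * ((chebT i).[x] * (chebT i).[t]) + 1.

Lemma chebK_CD n x t : (x - t) * chebK n.+1 x t =
  (chebT n.+1).[x] * (chebT n).[t] - (chebT n).[x] * (chebT n.+1).[t].
Proof.
elim: n => [|n IH].
  by rewrite /chebK big_nil add0r mulr1 chebT1 chebT0 !hornerE.
have -> : chebK n.+2 x t = chebK n.+1 x t + 2 * ((chebT n.+1).[x] * (chebT n.+1).[t]).
  by rewrite /chebK big_nat_recr//= addrAC.
rewrite mulrDr IH chebT_rec !(hornerD, hornerN, hornerZ, hornerM, hornerX); ring.
Qed.

Lemma chebK_bound n x t : (0 < n)%N -> x ^+ 2 <= 1 -> t ^+ 2 <= 1 ->
  `|x - t| * `|chebK n x t| <= 2.
Proof.
case: n => // n _ x1 t1; rewrite -normrM chebK_CD.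
apply: (le_trans (ler_normB _ _)); rewrite !normrM (_ : 2 = 1 * 1 + 1 * 1); last by ring.
by rewrite lerD// ler_pM// chebT_le1.
Qed.

End Chebyshev.

(** * Bounded measurable functions and the Chebyshev weight *)

Section BoundedMeasurable.
Variable R : realType.
Implicit Types (f g : R -> R) (D : set (measurableTypeR R)).

Definition bmf D f := measurable_fun D (f : measurableTypeR R -> measurableTypeR R) /\
  exists B : R, forall x, D x -> `|f x| <= B.

Lemma bmfD D f g : bmf D f -> bmf D g -> bmf D (fun x => f x + g x).
Proof.
move=> [mf [B hB]] [mg [C hC]]; split; first exact: measurable_funD.
by exists (B + C) => x Dx; apply: (le_trans (ler_normD _ _)); rewrite lerD ?hB ?hC.
Qed.

Lemma bmfM D f g : bmf D f -> bmf D g -> bmf D (fun x => f x * g x).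
Proof.
move=> [mf [B hB]] [mg [C hC]]; split; first exact: measurable_funM.
by exists (B * C) => x Dx; rewrite normrM ler_pM ?hB ?hC.
Qed.

Lemma bmf_cst D c : bmf D (fun=> c).
Proof. by split; [exact: measurable_cst|exists `|c|]. Qed.

Lemma bmfN D f : bmf D f -> bmf D (fun x => - f x).
Proof.
move=> hf; have := bmfM (bmf_cst D (-1)) hf.
by under eq_fun do rewrite mulN1r.
Qed.

Lemma bmfB D f g : bmf D f -> bmf D g -> bmf D (fun x => f x - g x).
Proof. by move=> hf hg; apply: bmfD => //; exact: bmfN. Qed.

Lemma bmfZ D f c : bmf D f -> bmf D (fun x => c * f x).
Proof. by move=> hf; apply: bmfM => //; exact: bmf_cst. Qed.

Lemma bmfX D f k : bmf D f -> bmf D (fun x => f x ^+ k).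
Proof.
move=> hf; elim: k => [|k IH]; first by under eq_fun do rewrite expr0; exact: bmf_cst.
by under eq_fun do rewrite exprS; exact: bmfM.
Qed.

Lemma bmf_norm D f : bmf D f -> bmf D (fun x => `|f x|).
Proof.
move=> [mf [B hB]]; split; first exact: measurableT_comp.
by exists B => x Dx; rewrite normr_id hB.
Qed.

Lemma bmf_sum (I : Type) (r : seq I) (Q : pred I) D (f : I -> R -> R) :
  (forall i, bmf D (f i)) -> bmf D (fun x => \sum_(i <- r | Q i) f i x).
Proof.
move=> hf; elim: r => [|i r IH].
  by under eq_fun do rewrite big_nil; exact: bmf_cst.
under eq_fun do rewrite big_cons.
by case: (Q i) => //; apply: bmfD.
Qed.

Lemma measurable_invr (D : set (measurableTypeR R)) : measurable D ->
  measurable_fun D (GRing.inv : measurableTypeR R -> measurableTypeR R).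
Proof.
move=> mD; apply: (@measurable_funS _ _ _ _ setT) => //.
have <- : [set (0 : R)] `|` ~` [set 0] = setT by exact: setUv.
apply/measurable_funU => //; first exact: measurableC.
split; first exact: measurable_fun_set1.
apply: open_continuous_measurable_fun.
  by apply: closed_openC; exact: closed_eq.
by move=> x; rewrite inE /= => /eqP x0; exact: inv_continuous.
Qed.

Lemma bmfV D f (c : R) : 0 < c -> bmf D f -> (forall x, D x -> c <= `|f x|) ->
  bmf D (fun x => (f x)^-1).
Proof.
move=> c0 [mf _] hc; split; first exact: measurableT_comp (measurable_invr measurableT) mf.
by exists c^-1 => x Dx; rewrite normfV lef_pV2 ?posrE ?hc// (lt_le_trans c0)// hc.
Qed.

Lemma bmf_sub D E f : E `<=` D -> measurable D -> bmf D f -> bmf E f.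
Proof.
move=> ED mD [mf [B hB]]; split; first exact: measurable_funS mf.
by exists B => x /ED; exact: hB.
Qed.

Lemma horner_bounded (P : {poly R}) (C : R) :
  exists2 B, 0 <= B & forall x, `|x| <= C -> `|P.[x]| <= B.
Proof.
exists (\sum_(i < size P) `|P`_i| * `|C| ^+ i); first by apply: sumr_ge0 => i _; rewrite mulr_ge0// exprn_ge0.
move=> x xC; rewrite horner_coef; apply: (le_trans (ler_norm_sum _ _ _)).
apply: ler_sum => i _; rewrite normrM normrX ler_wpM2l// lerXn2r ?nnegrE//.
by apply: (le_trans xC); exact: ler_norm.
Qed.

Lemma bmf_poly D (P : {poly R}) (C : R) : (forall x, D x -> `|x| <= C) ->
  bmf D (horner P).
Proof.
move=> hD; split; first exact: measurable_poly.
by have [B _ hB] := horner_bounded P C; exists B => x /hD; exact: hB.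
Qed.

Lemma bmf_ext D f g : (forall x, D x -> f x = g x) -> measurable D -> bmf D f -> bmf D g.
Proof.
move=> fg mD [mf [B hB]]; split; last by exists B => x Dx; rewrite -fg// hB.
apply: (@eq_measurable_fun _ _ (measurableTypeR R) (measurableTypeR R) D f g) => //.
by move=> x; rewrite inE => /fg.
Qed.

End BoundedMeasurable.

Section RintegralBounded.
Variables (R : realType) (m : {measure set (measurableTypeR R) -> \bar R}).
Variable D : set (measurableTypeR R).
Hypotheses (mD : measurable D) (fD : (m D < +oo)%E).
Implicit Types f g : R -> R.

Lemma bmf_integrable f : bmf D f -> m.-integrable D (EFin \o f).
Proof.
move=> [mf [B hB]]; apply: measurable_bounded_integrable => //.
exists B; split; first exact: num_real.
by move=> M BM x Dx /=; apply: (le_trans (hB _ Dx)); exact: ltW.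
Qed.

Lemma rint_ge0 f : (forall x, D x -> 0 <= f x) -> 0 <= \int[m]_(x in D) f x.
Proof. exact: Rintegral_ge0. Qed.

Lemma rint_le f g : bmf D f -> bmf D g -> (forall x, D x -> f x <= g x) ->
  \int[m]_(x in D) f x <= \int[m]_(x in D) g x.
Proof. by move=> hf hg; apply: le_Rintegral => //; exact: bmf_integrable. Qed.

Lemma rintD f g : bmf D f -> bmf D g ->
  \int[m]_(x in D) (f x + g x) = \int[m]_(x in D) f x + \int[m]_(x in D) g x.
Proof. by move=> hf hg; apply: RintegralD => //; exact: bmf_integrable. Qed.

Lemma rintZ c f : bmf D f ->
  \int[m]_(x in D) (c * f x) = c * \int[m]_(x in D) f x.
Proof. by move=> hf; apply: RintegralZl => //; exact: bmf_integrable. Qed.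

Lemma rintB f g : bmf D f -> bmf D g ->
  \int[m]_(x in D) (f x - g x) = \int[m]_(x in D) f x - \int[m]_(x in D) g x.
Proof. by move=> hf hg; apply: RintegralB => //; exact: bmf_integrable. Qed.

Lemma rint_cst c : \int[m]_(x in D) c = c * fine (m D).
Proof. exact: Rintegral_cst. Qed.

Lemma rint_sum (I : Type) (r : seq I) (Q : pred I) (f : I -> R -> R) :
  (forall i, bmf D (f i)) ->
  \int[m]_(x in D) (\sum_(i <- r | Q i) f i x) = \sum_(i <- r | Q i) \int[m]_(x in D) f i x.
Proof.
move=> hf; elim: r => [|i r IH].
  rewrite big_nil; transitivity (\int[m]_(x in D) (0 : R)).
    by apply: eq_Rintegral => x _; rewrite big_nil.
  by rewrite rint_cst mul0r.
rewrite big_cons; transitivity (\int[m]_(x in D) (if Q i then f i x + \sum_(i <- r | Q i) f i x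
    else \sum_(i <- r | Q i) f i x)).
  by apply: eq_Rintegral => x _; rewrite big_cons.
by case: (Q i) => //; rewrite rintD ?IH//; exact: bmf_sum.
Qed.

Lemma rint_eq f g : (forall x, D x -> f x = g x) ->
  \int[m]_(x in D) f x = \int[m]_(x in D) g x.
Proof. by move=> fg; apply: eq_Rintegral => x; rewrite inE => /fg. Qed.

Lemma rint_EFin f : bmf D f -> (\int[m]_(x in D) (f x)%:E = (\int[m]_(x in D) f x)%:E)%E.
Proof.
by move=> hf; rewrite /Rintegral fineK//; apply: integrable_fin_num => //; exact: bmf_integrable.
Qed.

End RintegralBounded.

Lemma rint_subset (R : realType) (m : {measure set (measurableTypeR R) -> \bar R})
  (E D : set (measurableTypeR R)) (f : R -> R) :
  measurable E -> measurable D -> (m D < +oo)%E -> E `<=` D -> bmf D f ->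
  (forall x, D x -> 0 <= f x) ->
  \int[m]_(x in E) f x <= \int[m]_(x in D) f x.
Proof.
move=> mE mD fD ED hf f0.
have fE : (m E < +oo)%E by apply: le_lt_trans fD; apply: le_measure; rewrite ?inE.
have hfE : bmf E f by exact: bmf_sub hf.
rewrite -lee_fin -!rint_EFin//; apply: ge0_subset_integral => //.
by apply/measurable_EFinP; case: hf.
Qed.

Lemma lebesgue_itvcc_fin (R : realType) (a b : R) : (lebesgue_measure `[a, b]%classic < +oo)%E.
Proof. by rewrite lebesgue_measure_itv /=; case: ifP => // _; rewrite -EFinB ltry. Qed.

Lemma fine_lebesgue_itvcc (R : realType) (a b : R) : a <= b ->
  fine (lebesgue_measure `[a, b]%classic) = b - a.
Proof.
rewrite lebesgue_measure_itv /= lte_fin le_eqVlt => /orP[/eqP ->|ab].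
  by rewrite ltxx subrr.
by rewrite ab.
Qed.

(** * The Chebyshev measure in the variable t = acos x *)

Section ChebyshevFunctional.
Variable R : realType.
Implicit Types (P Q : {poly R}) (t x : R).

Lemma horner_cheb_cos n t : (chebT R n).[cos t] = cos (n%:R * t) /\
  (chebV R n).[cos t] * sin t = sin (n%:R * t).
Proof.
elim: n => [|n [hT hV]].
  by rewrite chebT0 chebV0 mul0r cos0 sin0 hornerC horner0 mul0r.
rewrite -natr1 mulrDl mul1r cosD sinD -hT -hV chebTS chebVS.
rewrite !(hornerD, hornerN, hornerM, hornerX, hornerXn, hornerC).
split; last by ring.
have -> : 1 - cos t ^+ 2 = sin t ^+ 2 by rewrite -(cos2Dsin2 t); ring.
ring.
Qed.

Lemma cos_itv t : `|cos t| <= 1.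
Proof. by rewrite ler_norml cos_geN1 cos_le1. Qed.

Lemma sin_itv t : `|sin t| <= 1.
Proof. by rewrite ler_norml sin_geN1 sin_le1. Qed.

Definition itv0pi : set (measurableTypeR R) := `[0, pi]%classic.

Lemma bmf_hcos P : bmf itv0pi (fun t => P.[cos t]).
Proof.
have [B _ hB] := horner_bounded P 1.
split; last by exists B => t _; exact/hB/cos_itv.
apply: (@measurable_funS _ _ _ _ setT) => //.
apply: (@measurableT_comp _ _ _ (measurableTypeR R) (measurableTypeR R) (measurableTypeR R)
  (horner P) _ cos); first exact: measurable_poly.
by apply: continuous_measurable_fun; exact: continuous_cos.
Qed.

Lemma bmf_sin : bmf itv0pi sin.
Proof.
split; last by exists 1 => t _; exact: sin_itv.
apply: (@measurable_funS _ _ _ _ setT) => //.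
by apply: continuous_measurable_fun; exact: continuous_sin.
Qed.

(** Expectation under the arcsine law [dx / (pi sqrt(1 - x^2))] on [[-1, 1]], written in
    [t = acos x] so that no singular density occurs. *)
Definition chebL P : R := pi^-1 * \int[lebesgue_measure]_(t in itv0pi) P.[cos t].

Let mI : measurable itv0pi. Proof. exact: measurable_itv. Qed.
Let fI : (lebesgue_measure itv0pi < +oo)%E. Proof. exact: lebesgue_itvcc_fin. Qed.

Lemma chebLD P Q : chebL (P + Q) = chebL P + chebL Q.
Proof.
rewrite /chebL -mulrDr -rintD//; [|exact: bmf_hcos..].
by congr (_ * _); apply: rint_eq => x _; rewrite hornerD.
Qed.

Lemma chebLZ c P : chebL (c *: P) = c * chebL P.
Proof.
rewrite /chebL mulrCA -(rintZ mI fI c); last exact: bmf_hcos.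
by congr (_ * _); apply: rint_eq => x _; rewrite hornerZ.
Qed.

Lemma chebL_sum (I : Type) (r : seq I) (p : pred I) (F : I -> {poly R}) :
  chebL (\sum_(i <- r | p i) F i) = \sum_(i <- r | p i) chebL (F i).
Proof.
have L0 : chebL 0 = 0 by rewrite -(scale0r 0) chebLZ mul0r.
by rewrite (big_morph chebL chebLD L0).
Qed.

Lemma chebL_ge0 P : (forall x, -1 <= x <= 1 -> 0 <= P.[x]) -> 0 <= chebL P.
Proof.
move=> hP; rewrite mulr_ge0 ?invr_ge0 ?pi_ge0//; apply: rint_ge0 => t _.
by apply: hP; rewrite cos_geN1 cos_le1.
Qed.

Lemma chebLB P Q : chebL (P - Q) = chebL P - chebL Q.
Proof. by rewrite chebLD -scaleN1r chebLZ mulN1r. Qed.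

Lemma chebL_le P Q : (forall x, -1 <= x <= 1 -> P.[x] <= Q.[x]) -> chebL P <= chebL Q.
Proof.
move=> h; rewrite -subr_ge0 -chebLB; apply: chebL_ge0 => x hx.
by rewrite hornerD hornerN subr_ge0 h.
Qed.

Lemma rint_cos (n : nat) : \int[lebesgue_measure]_(t in itv0pi) cos (n%:R * t) =
  (n == 0%N)%:R * pi.
Proof.
have pi0 : 0 < pi :> R := pi_gt0 R.
case: n => [|n] /=.
  transitivity (\int[lebesgue_measure]_(t in itv0pi) (1 : R)).
    by apply: rint_eq => t _; rewrite mul0r cos0.
  by rewrite rint_cst// fine_lebesgue_itvcc ?subr0 ?ltW.
rewrite mul0r /Rintegral.
pose F (t : R) := n.+1%:R^-1 * sin (n.+1%:R * t).
have d (t : R) : is_derive t (1:R) F (cos (n.+1%:R * t)).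
  apply: is_derive_eq; rewrite /GRing.scale /=.
  by rewrite mulr1 mulrCA mulVf ?mulr1 ?pnatr_eq0.
have cF : continuous F.
  by move=> t; apply: differentiable_continuous; apply/derivable1_diffP; case: (d t).
have cc : continuous (fun t : R => cos (n.+1%:R * t)).
  move=> t; apply: (@continuous_comp _ _ _ (fun t : R => n.+1%:R * t) cos).
    exact: mulrl_continuous.
  exact: continuous_cos.
rewrite (@continuous_FTC2 _ _ F)//=.
- have s0 : sin (n.+1%:R * pi) = 0 :> R.
    by rewrite mulr_natl -[pi *+ _]add0r; elim: n {F d cF cc} => [|m IH]; [rewrite mulr1n add0r sinpi|rewrite mulrSr addrA sinDpi IH oppr0].
  by rewrite /F s0 !mulr0 sin0 mulr0 subrr.
- by apply: continuous_subspaceT.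
- split.
  + by move=> x _; case: (d x).
  + by apply: cvg_at_right_filter; exact: cF.
  + by apply: cvg_at_left_filter; exact: cF.
- by move=> x _; rewrite derive1E; case: (d x).
Qed.

Lemma chebL_chebT n : chebL (chebT R n) = (n == 0%N)%:R.
Proof.
rewrite /chebL (rint_eq _ (g := fun t => cos (n%:R * t))).
  by rewrite rint_cos mulrCA mulVf ?mulr1// gt_eqF// pi_gt0.
by move=> t _; have [-> _] := horner_cheb_cos n t.
Qed.

Lemma chebL_ext P Q : (forall t, P.[cos t] = Q.[cos t]) -> chebL P = chebL Q.
Proof. by move=> h; rewrite /chebL; congr (_ * _); apply: rint_eq => t _. Qed.

Lemma chebL_mulT (j k : nat) : (k <= j)%N -> chebL (chebT R j * chebT R k) =
  ((j == k)%:R + ((j == 0%N) && (k == 0%N))%:R) / 2.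
Proof.
move=> kj; rewrite (@chebL_ext _ (2^-1 *: (chebT R (j + k) + chebT R (j - k)))).
  rewrite chebLZ chebLD !chebL_chebT mulrC; congr (_ / 2).
  rewrite addrC addn_eq0 subn_eq0; congr (_%:R + _).
  by rewrite eqn_leq kj andbT.
move=> t; rewrite hornerM hornerZ hornerD.
have [-> _] := horner_cheb_cos j t; have [-> _] := horner_cheb_cos k t.
have [-> _] := horner_cheb_cos (j + k) t; have [-> _] := horner_cheb_cos (j - k) t.
rewrite natrB// natrD mulrDl mulrBl cosD cosB; by field.
Qed.

(** At [x = cos t] the integrand is [sin(jt) sin(kt)]: the [chebV] are orthogonal for the extra
    weight [1 - x^2]. *)
Lemma chebL_mulV (j k : nat) : (0 < k)%N -> (k <= j)%N ->
  chebL ((1 - 'X^2) * (chebV R j * chebV R k)) = (j == k)%:R / 2.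
Proof.
move=> k0 kj; rewrite (@chebL_ext _ (2^-1 *: (chebT R (j - k) - chebT R (j + k)))).
  rewrite chebLZ chebLB !chebL_chebT mulrC; congr (_ / 2).
  have -> : (j + k == 0)%N = false by rewrite addn_eq0 (gtn_eqF k0) andbF.
  by rewrite subr0 subn_eq0 eqn_leq kj andbT.
move=> t; rewrite hornerM.
have -> : (1 - 'X^2).[cos t] = sin t ^+ 2.
  by rewrite hornerD hornerN hornerXn hornerC -(cos2Dsin2 t); ring.
rewrite hornerM hornerZ hornerD hornerN.
have [_ hj] := horner_cheb_cos j t; have [_ hk] := horner_cheb_cos k t.
have [-> _] := horner_cheb_cos (j + k) t; have [-> _] := horner_cheb_cos (j - k) t.
rewrite natrB// natrD !mulrDl mulNr cosD [in X in _ - X]cosD cosN sinN -hj -hk.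
by field.
Qed.

(* Both Parseval identities are for an expansion without [T_0]. *)
Lemma chebL_parsevalV (n : nat) (c : nat -> R) :
  chebL ((1 - 'X^2) * (\sum_(k < n) c k *: chebV R k.+1) ^+ 2) =
  (\sum_(k < n) c k ^+ 2) / 2.
Proof.
have E (a b : R) (u v : {poly R}) : (1 - 'X^2) * ((a *: u) * (b *: v)) =
    (a * b) *: ((1 - 'X^2) * (u * v)).
  by rewrite -!mul_polyC polyCM; ring.
rewrite [X in chebL (_ * X)]expr2 big_distrlr/= mulr_sumr.
rewrite chebL_sum mulr_suml; apply: eq_bigr => i _.
rewrite mulr_sumr chebL_sum (bigD1 i)//= big1 ?addr0.
  by rewrite E chebLZ chebL_mulV// eqxx mulr1n mul1r expr2.
move=> j ji; rewrite E chebLZ.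
have e : (i.+1 == j.+1) = false by rewrite eqSS; apply/negbTE; rewrite eq_sym.
have [ij|ij] := leqP i j.
  by rewrite [chebV R i.+1 * _]mulrC chebL_mulV// eq_sym e mul0r mulr0.
by rewrite chebL_mulV ?e ?mul0r ?mulr0// ltnS ltnW.
Qed.

Lemma chebL_parsevalT (n : nat) (c : nat -> R) :
  chebL ((\sum_(k < n) c k *: chebT R k) ^+ 2) =
  (\sum_(k < n) c k ^+ 2 * (1 + (k == 0%N :> nat)%:R)) / 2.
Proof.
rewrite expr2 big_distrlr/= chebL_sum mulr_suml; apply: eq_bigr => i _.
rewrite chebL_sum (bigD1 i)//= big1 ?addr0.
  by rewrite -scalerAl -scalerAr scalerA chebLZ chebL_mulT// eqxx andbb mulr1n expr2; ring.
move=> j ji; rewrite -scalerAl -scalerAr scalerA chebLZ.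
have e : (i == j :> nat) = false by apply/negbTE; rewrite eq_sym.
have e0 : (i == 0%N :> nat) && (j == 0%N :> nat) = false.
  by apply/negbTE/negP => /andP[/eqP hi /eqP hj]; move: e; rewrite hi hj eqxx.
have [ij|ij] := leqP i j.
  by rewrite [chebT R i * _]mulrC chebL_mulT// eq_sym e andbC e0 addr0 mul0r mulr0.
by rewrite chebL_mulT ?e ?e0 ?addr0 ?mul0r ?mulr0// ltnW.
Qed.

End ChebyshevFunctional.

Arguments itv0pi : clear implicits.

Section CosineSubstitution.
Variable R : realType.
Implicit Types (P Q : {poly R}) (m h a b : R).

Lemma rint_cos_subst m h a b (f : R -> R) : 0 < h -> 0 <= a -> a <= b -> b <= pi ->
  {within `[m + h * cos b, m + h * cos a], continuous f} ->
  \int[lebesgue_measure]_(x in (`[m + h * cos b, m + h * cos a]%classic : set (measurableTypeR R))) f x =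
  \int[lebesgue_measure]_(t in (`[a, b]%classic : set (measurableTypeR R))) (f (m + h * cos t) * (h * sin t)).
Proof.
move=> h0 a0 ab bpi cf; rewrite /Rintegral; congr fine.
pose F (t : R) := m + h * cos t.
have d (t : R) : is_derive t (1:R) F (- (h * sin t)).
  by apply: is_derive_eq; rewrite /GRing.scale /= add0r; ring.
have cF : continuous F.
  by move=> t; apply: differentiable_continuous; apply/derivable1_diffP; case: (d t).
have F' : (F^`()%classic : R -> R) = (fun t => - (h * sin t)).
  by apply/funext => t; rewrite derive1E; case: (d t).
have cF' : continuous (fun t : R => - (h * sin t)).
  move=> t; apply: cvgN; apply: cvgM; first exact: cvg_cst.
  exact: continuous_sin.
have := @integration_by_substitution_decreasing R F f a b ab.
rewrite F' => ->.
- apply: eq_integral => t _; congr (_%:E).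
  by rewrite /= fctE /= opprK.
- move=> x y; rewrite !in_itv/= => /andP[ax xb] /andP[ay yb] xy.
  have hx : x \in `[0, pi] by rewrite in_itv/= (le_trans a0 ax) (le_trans xb bpi).
  have hy : y \in `[0, pi] by rewrite in_itv/= (le_trans a0 ay) (le_trans yb bpi).
  by rewrite /F ltrD2l ltr_pM2l// ltr_cos.
- by move=> t _; exact: cF'.
- by apply/cvg_ex; exists (- (h * sin a)); apply: cvg_at_right_filter; exact: cF'.
- by apply/cvg_ex; exists (- (h * sin b)); apply: cvg_at_left_filter; exact: cF'.
- split.
  + by move=> x _; case: (d x).
  + by apply: cvg_at_right_filter; exact: cF.
  + by apply: cvg_at_left_filter; exact: cF.
- exact: cf.
Qed.

End CosineSubstitution.

(** * Bernstein inequalities *)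

Section IntervalBounds.
Variable R : realType.
Implicit Types (P Q : {poly R}) (x u v : R).

Definition itvcc (u v : R) : set (measurableTypeR R) := `[u, v]%classic.

Lemma bmf_poly_itvcc u v P : bmf (itvcc u v) (horner P).
Proof.
apply: (@bmf_poly _ _ _ (Num.max `|u| `|v|)) => x; rewrite /itvcc /= in_itv/= => /andP[ux xv].
rewrite le_max; have [x0|x0] := leP 0 x.
  by rewrite (ger0_norm x0) (le_trans xv (ler_norm _)) orbT.
by rewrite (ltr0_norm x0) -(normrN u) (le_trans _ (ler_norm _))// lerN2.
Qed.

Lemma bmf_poly_itvcc_sqr u v P : bmf (itvcc u v) (fun x => P.[x] ^+ 2).
Proof. by apply: bmfX; exact: bmf_poly_itvcc. Qed.

Lemma comp_poly_sqr P Q : (P ^+ 2) \Po Q = (P \Po Q) ^+ 2.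
Proof. by rewrite !expr2 comp_polyM. Qed.

Definition affp u v : {poly R} := ((u + v) / 2)%:P + ((v - u) / 2) *: 'X.

Lemma horner_affp u v (s : R) : (affp u v).[s] = (u + v) / 2 + (v - u) / 2 * s.
Proof. by rewrite hornerD hornerC hornerZ hornerX. Qed.

Lemma derivn_comp_affp u v P j :
  (P \Po affp u v)^`(j) = ((v - u) / 2) ^+ j *: (P^`(j) \Po affp u v).
Proof.
elim: j => [|j IH]; first by rewrite expr0 scale1r.
rewrite !derivnS IH derivZ deriv_comp /affp derivD derivC derivZ derivX add0r.
by rewrite -scalerAr mulr1 scalerA exprSr.
Qed.

Lemma size_comp_affp u v P : (size (P \Po affp u v) <= size P)%N.
Proof.
have sa : ((size (affp u v)).-1 <= 1)%N.
  rewrite -subn1 leq_subLR (leq_trans (size_polyD _ _))// geq_max.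
  by rewrite (leq_trans (size_polyC_leq1 _))// (leq_trans (size_scale_leq _ _))// size_polyX.
have [->|P0] := eqVneq P 0; first by rewrite comp_poly0.
apply: leq_trans (size_comp_poly_leq _ _) _.
rewrite -[leqRHS]prednK ?size_poly_gt0// ltnS -[leqRHS]muln1 leq_mul2l sa orbT//.
Qed.

Lemma rint_affp u v P : u < v ->
  \int[lebesgue_measure]_(x in itvcc u v) P.[x] =
  \int[lebesgue_measure]_(t in itv0pi R) ((P \Po affp u v).[cos t] * ((v - u) / 2 * sin t)).
Proof.
move=> uv; have h0 : 0 < (v - u) / 2 by rewrite divr_gt0// subr_gt0.
have := @rint_cos_subst R ((u + v) / 2) ((v - u) / 2) 0 pi (horner P) h0 (lexx _) (pi_ge0 R) (lexx _)
  (continuous_subspaceT (@continuous_horner R P)).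
rewrite cos0 cospi mulr1 mulrN1.
have -> : (u + v) / 2 - (v - u) / 2 = u by field.
have -> : (u + v) / 2 + (v - u) / 2 = v by field.
move=> ->; apply: rint_eq => t _.
by rewrite horner_comp horner_affp.
Qed.

Lemma horner_one_sub_sqr (x : R) : (1 - 'X^2 : {poly R}).[x] = 1 - x ^+ 2.
Proof. by rewrite hornerD hornerN hornerXn hornerC. Qed.

Lemma horner_wsqr Q x : ((1 - 'X^2) * Q ^+ 2).[x] = (1 - x ^+ 2) * Q.[x] ^+ 2.
Proof. by rewrite hornerM horner_exp horner_one_sub_sqr. Qed.

Lemma horner_w3sqr Q x : ((1 - 'X^2) ^+ 3 * Q ^+ 2).[x] = (1 - x ^+ 2) ^+ 3 * Q.[x] ^+ 2.
Proof. by rewrite hornerM (horner_exp _ _ 3) (horner_exp Q) horner_one_sub_sqr. Qed.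

Lemma sin_sqr_le (t : R) : t \in `[0, pi] -> sin t ^+ 2 <= sin t.
Proof.
move=> tp; rewrite -[leRHS]mulr1 expr2 ler_wpM2l ?sin_le1// sin_ge0_pi//.
Qed.

(** In the variable [t] the weight [1 - x^2] against the Chebyshev measure is [sin^2 t dt], up to
    [pi], while Lebesgue measure is [sin t dt], and [sin^2 t <= sin t] on [[0, pi]]. Hence
    second-kind expansions are controlled by plain [L^2] norms. *)
Lemma chebL_le_rint u v P : u < v -> (forall x, 0 <= P.[x]) ->
  (v - u) / 2 * (pi * chebL ((1 - 'X^2) * (P \Po affp u v))) <=
  \int[lebesgue_measure]_(x in itvcc u v) P.[x].
Proof.
move=> uv P0; rewrite rint_affp// /chebL mulVKf ?gt_eqF ?pi_gt0//.
have h0 : 0 < (v - u) / 2 by rewrite divr_gt0// subr_gt0.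
rewrite -rintZ//; [|exact: measurable_itv|exact: lebesgue_itvcc_fin|exact: bmf_hcos].
apply: rint_le; [exact: measurable_itv|exact: lebesgue_itvcc_fin|..].
- by apply: bmfZ; exact: bmf_hcos.
- by apply: bmfM; [exact: bmf_hcos|apply: bmfZ; exact: bmf_sin].
move=> t tp; rewrite hornerM horner_one_sub_sqr -sin2cos2 [leRHS]mulrCA.
rewrite ler_wpM2l ?(ltW h0)// mulrC ler_wpM2l ?sin_sqr_le//.
by rewrite horner_comp.
Qed.

(** In the coordinate [s] that sends [[u, v]] to [[-1, 1]], [1 - s^2] equals [(x - u)(v - x) / h^2]
    with [h] the half-length; this is its lower bound for [x] in [[u', v']]. *)
Definition gap u v u' v' : R := (u' - u) * (v - v') / ((v - u) / 2) ^+ 2.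

Lemma gap_le u v u' v' x : u < u' -> v' < v -> u' <= x <= v' ->
  [/\ u < v, 0 < gap u v u' v', gap u v u' v' <= 1 &
   exists2 s, x = (affp u v).[s] & gap u v u' v' <= 1 - s ^+ 2].
Proof.
move=> uu vv /andP[ux xv].
have uv : u < v by rewrite (lt_le_trans uu)// (le_trans ux)// (le_trans xv)// ltW.
have h0 : 0 < (v - u) / 2 by rewrite divr_gt0// subr_gt0.
have g0 : 0 < gap u v u' v'.
  by rewrite divr_gt0// ?mulr_gt0 ?subr_gt0// exprn_gt0.
pose s := (x - (u + v) / 2) / ((v - u) / 2).
have xs : x = (affp u v).[s].
  by rewrite horner_affp /s [(v - u) / 2 * _]mulrC divfK ?gt_eqF// addrC subrK.
have gs : gap u v u' v' <= 1 - s ^+ 2.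
  have -> : 1 - s ^+ 2 = (x - u) * (v - x) / ((v - u) / 2) ^+ 2.
    by rewrite /s; field; rewrite subr_eq0 gt_eqF.
  by rewrite ler_pM2r ?invr_gt0 ?exprn_gt0//; apply: ler_pM; lra.
split => //; last by exists s.
by apply: (le_trans gs); rewrite gerBl sqr_ge0.
Qed.

Lemma half_le_rescale (h q S J : R) : 0 < h -> 0 < q -> h * (q * (S / 2)) <= J ->
  S <= 2 / (q * h) * J.
Proof.
move=> h0 q0 hJ; have hn : h != 0 by rewrite gt_eqF.
have qn : q != 0 by rewrite gt_eqF.
have -> : S = 2 / (q * h) * (h * (q * (S / 2))) by field; rewrite hn qn.
by rewrite ler_wpM2l// divr_ge0// mulr_ge0// ltW.
Qed.

(** Cauchy-Schwarz on the expansion in the [chebV]: Parseval bounds the coefficients by the [L^2]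
    norm on [[u, v]], and [T_k' = k V_k] transfers to the basis the geometric derivative bounds of
    [chebT]. *)
Lemma bernstein_pointwise u v u' v' : u < u' -> v' < v -> exists C D : R,
  [/\ 0 < C, 0 < D & forall (n k : nat) P x, (size P <= n)%N -> u' <= x <= v' ->
  (P^`(k).[x]) ^+ 2 <= C * n%:R * ((D * n%:R) ^+ k) ^+ 2 *
     \int[lebesgue_measure]_(t in itvcc u v) (P.[t] ^+ 2)].
Proof.
move=> uu vv.
have [[x0 hx0]|nx] := pselect (exists x0, u' <= x0 <= v'); last first.
  by exists 1, 1; split => // n k P x _ hx; exfalso; apply: nx; exists x.
have [uv g0 g1 _] := gap_le uu vv hx0.
set dl := gap u v u' v' in g0 g1.
pose h : R := (v - u) / 2.
have h0 : 0 < h by rewrite divr_gt0// subr_gt0.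
pose D0 := 4 / dl; have D00 : 0 < D0 by rewrite divr_gt0.
have pi0 := pi_gt0 R.
have hn : h != 0 by rewrite gt_eqF.
have pin : pi != 0 :> R by rewrite gt_eqF.
exists (2 / (pi * h) * D0 ^+ 2), (D0 / h); split.
- by rewrite mulr_gt0 ?exprn_gt0// divr_gt0// mulr_gt0.
- by rewrite divr_gt0.
move=> n k P x sP hx.
have [_ _ _ [s xs gs]] := gap_le uu vv hx.
pose Q := P \Po affp u v.
have sQ : (size Q <= n)%N by apply: leq_trans (size_comp_affp _ _ _) sP.
have [c Qc] := poly_basis_expansion (size_chebVS R) sQ.
set J := \int[lebesgue_measure]_(t in _) _.
have cJ : \sum_(k < n) c k ^+ 2 <= 2 / (pi * h) * J.
  have P2 y : 0 <= (P ^+ 2).[y] by rewrite horner_exp sqr_ge0.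
  have := chebL_le_rint uv P2; rewrite comp_poly_sqr -/Q [X in _ * X ^+ 2]Qc chebL_parsevalV.
  rewrite (_ : Rintegral _ _ _ = J); last by apply: rint_eq => y _; rewrite horner_exp.
  rewrite -/h => hJ.
  exact: half_le_rescale hJ.
have Qk : Q^`(k).[s] = h ^+ k * P^`(k).[x].
  by rewrite derivn_comp_affp hornerZ horner_comp -xs.
have hk0 : 0 < (h ^+ k) ^+ 2 by rewrite !exprn_gt0.
rewrite -(ler_pM2l hk0) -exprMn -Qk.
have -> : Q^`(k).[s] = \sum_(i < n) c i * (chebV R i.+1)^`(k).[s].
  by rewrite Qc linear_sum horner_sum; apply: eq_bigr => i _; rewrite linearZ hornerZ.
apply: (le_trans (sum_mul_CS _ _)).
have Vb : \sum_(i < n) (chebV R i.+1)^`(k).[s] ^+ 2 <= n%:R * (D0 * (D0 * n%:R) ^+ k) ^+ 2.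
  rewrite mulr_natl -[X in _ *+ X]card_ord -sumr_const; apply: ler_sum => i _.
  have M0 : 0 <= D0 * (D0 * n%:R) ^+ k by rewrite mulr_ge0 ?(ltW D00)// exprn_ge0// mulr_ge0// ltW.
  rewrite -[leLHS]real_normK ?num_real// lerXn2r ?nnegrE//.
  have := chebT_derivn_bound k g0 g1 gs (ltn_ord i).
  rewrite derivSn chebT_deriv derivnZ hornerZ normrM normr_nat -mulrA ler_pM2l//.
apply: (le_trans (ler_pM _ _ cJ Vb)).
- by apply: sumr_ge0 => i _; exact: sqr_ge0.
- by apply: sumr_ge0 => i _; exact: sqr_ge0.
rewrite le_eqVlt; apply/orP; left; apply/eqP.
have -> : (D0 / h * n%:R) ^+ k = (D0 * n%:R) ^+ k / h ^+ k by rewrite mulrAC expr_div_n.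
move: (2 / (pi * h)) (h ^+ k) (expf_neq0 k hn) => q hk hkn.
by field.
Qed.

(** After rescaling, [S = (1 - x^2) Q] is expanded in the [chebT]. Since [T_k' = k V_k], the two
    Parseval identities compare [S'] with [S] at the cost of the squared degree. Recovering [Q']
    from [S'] leaves the weight [(1 - x^2)^3], which is bounded below on the inner interval. *)
Lemma bernstein_L2 u v u' v' : u < u' -> v' < v -> exists2 C : R,
  0 < C & forall (n : nat) P, (0 < n)%N -> (size P <= n)%N ->
  \int[lebesgue_measure]_(t in itvcc u' v') (P^`().[t] ^+ 2) <=
  C * n%:R ^+ 2 * \int[lebesgue_measure]_(t in itvcc u v) (P.[t] ^+ 2).
Proof.
move=> uu vv.
have [[x0 hx0]|nx] := pselect (exists x0, u' <= x0 <= v'); last first.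
  exists 1 => // n P n0 _; rewrite (_ : itvcc u' v' = set0).
    rewrite Rintegral_set0 mulr_ge0 ?mulr_ge0// rint_ge0// => x _; exact: sqr_ge0.
  rewrite -subset0 => x; rewrite /itvcc/= in_itv/= => hx; apply: nx; by exists x.
have [uv g0 g1 _] := gap_le uu vv hx0.
set dl := gap u v u' v' in g0 g1.
pose h : R := (v - u) / 2.
have h0 : 0 < h by rewrite divr_gt0// subr_gt0.
have pi0 := pi_gt0 R.
have hn : h != 0 by rewrite gt_eqF.
have pin : pi != 0 :> R by rewrite gt_eqF.
(* [dl ^- 3] undoes the cubed weight, and the two factors in [pi] and [h] come from the two changes
   of variable. The chain below yields [16 n^2], for which 40 leaves room. *)
exists (dl ^- 3 * (pi / h) * (40 / (pi * h))).
  have e1 : 0 < dl ^- 3 by rewrite invr_gt0 exprn_gt0.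
  have e2 : 0 < pi / h by rewrite divr_gt0.
  have e3 : 0 < 40 / (pi * h) by rewrite divr_gt0// mulr_gt0.
  by rewrite mulr_gt0// mulr_gt0.
move=> n P n0 sP.
pose Q := P \Po affp u v.
have sQ : (size Q <= n)%N by apply: leq_trans (size_comp_affp _ _ _) sP.
set J := \int[lebesgue_measure]_(t in itvcc u v) _.
pose S := (1 - 'X^2) * Q.
have QJ : chebL ((1 - 'X^2) * Q ^+ 2) <= J / (pi * h).
  have P2 y : 0 <= (P ^+ 2).[y] by rewrite horner_exp sqr_ge0.
  have := chebL_le_rint uv P2; rewrite comp_poly_sqr -/Q -/h.
  rewrite (_ : Rintegral _ _ _ = J); last by apply: rint_eq => y _; rewrite horner_exp.
  have ph0 : 0 < pi * h by exact: mulr_gt0.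
  move=> hJ; rewrite ler_pdivlMr//; apply: le_trans hJ.
  by rewrite mulrA mulrC [_ * pi]mulrC.
have sS : (size S <= n.+2)%N.
  apply: (leq_trans (size_polyMleq _ _)).
  have s2 : (size (1 - 'X^2 : {poly R})%R <= 3)%N.
    by rewrite (leq_trans (size_polyD _ _))// geq_max size_poly1 size_polyN size_polyXn.
  by rewrite -subn1 leq_subLR (leq_trans (leq_add s2 sQ)).
have [c Sc] := poly_basis_expansion (size_chebT R) sS.
have L1 : chebL ((1 - 'X^2) * S^`() ^+ 2) <= n.+1%:R ^+ 2 * chebL (S ^+ 2).
  rewrite [X in chebL (X ^+ 2)]Sc chebL_parsevalT.
  have -> : S^`() = \sum_(k < n.+1) (c k.+1 * k.+1%:R) *: chebV R k.+1.
    rewrite Sc linear_sum big_ord_recl/= chebT0 derivZ -polyC1 derivC scaler0 add0r.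
    by apply: eq_bigr => i _; rewrite /= /bump/= derivZ chebT_deriv scalerA.
  rewrite (@chebL_parsevalV R n.+1 (fun k => c k.+1 * k.+1%:R)) mulrA ler_pM2r// mulr_sumr [leRHS]big_ord_recl/=.
  apply: (@le_trans _ _ (\sum_(i < n.+1) n.+1%:R ^+ 2 * (c i.+1 ^+ 2))).
    apply: ler_sum => i _; rewrite exprMn mulrC ler_wpM2r ?sqr_ge0// lerXn2r ?nnegrE//.
    by rewrite ler_nat.
  apply: (@le_trans _ _ (\sum_(i < n.+1)
      n.+1%:R ^+ 2 * (c (bump 0 i) ^+ 2 * (1 + (bump 0 i == 0)%:R)))).
    by apply: ler_sum => i _; rewrite /bump/= addr0 mulr1.
  by rewrite lerDr mulr_ge0 ?sqr_ge0// mulr_ge0 ?sqr_ge0.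
have L2 : chebL (S ^+ 2) <= chebL ((1 - 'X^2) * Q ^+ 2).
  apply: chebL_le => x x1; rewrite horner_wsqr horner_exp hornerM horner_one_sub_sqr exprMn.
  have x2 : 0 <= x ^+ 2 <= 1.
    by rewrite sqr_ge0/= -[leRHS](expr1n _ 2) -normr_le_sqr// ler_norml.
  rewrite ler_wpM2r ?sqr_ge0// expr2 -[leRHS]mulr1 ler_wpM2l//; lra.
have dX2 : (1 - 'X^2 : {poly R})^`() = - (2 *: 'X).
  by rewrite derivB -polyC1 derivC derivXn sub0r /= expr1 scaler_nat.
have L3 : chebL ((1 - 'X^2) ^+ 3 * Q^`() ^+ 2) <=
   2 * chebL ((1 - 'X^2) * S^`() ^+ 2) + 8 * chebL ((1 - 'X^2) * Q ^+ 2).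
  rewrite -!chebLZ -chebLD; apply: chebL_le => x x1.
  have x2 : 0 <= x ^+ 2 <= 1.
    by rewrite sqr_ge0/= -[leRHS](expr1n _ 2) -normr_le_sqr// ler_norml.
  rewrite horner_w3sqr hornerD !hornerZ !horner_wsqr.
  have -> : S^`().[x] = - (2 * x) * Q.[x] + (1 - x ^+ 2) * Q^`().[x].
    by rewrite derivM dX2 hornerD !hornerM hornerN hornerZ hornerX horner_one_sub_sqr.
  set a := 1 - x ^+ 2; set q := Q.[x]; set q' := Q^`().[x].
  have a0 : 0 <= a by rewrite /a; lra.
  (* The excess over [a^3 q'^2] is displayed as [a] times a sum of nonnegative terms. *)
  have -> : 2 * (a * (- (2 * x) * q + a * q') ^+ 2) + 8 * (a * q ^+ 2) =
    a ^+ 3 * q' ^+ 2 + a * ((a * q' - 4 * x * q) ^+ 2 + 8 * ((1 - x ^+ 2) * q ^+ 2)) by ring.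
  by rewrite lerDl mulr_ge0// addr_ge0 ?sqr_ge0// mulr_ge0// mulr_ge0 ?sqr_ge0.
have K1 : \int[lebesgue_measure]_(t in itvcc u' v') (P^`().[t] ^+ 2) <=
   dl ^- 3 * (pi / h) * chebL ((1 - 'X^2) ^+ 3 * Q^`() ^+ 2).
  pose Z := (1 - 'X^2) ^+ 3 * Q^`() ^+ 2.
  (* The polynomial that pulls back to [1 - s^2] under [affp]; on [[u', v']] it is at least [dl], so
     its cube may be inserted at the cost of [dl ^- 3]. *)
  pose W : {poly R} := h ^- 2 *: (('X - u%:P) * (v%:P - 'X)).
  have WE x : W.[x] = (x - u) * (v - x) / h ^+ 2.
    by rewrite hornerZ hornerM !hornerD !hornerN !hornerX !hornerC mulrC.
  have uvs : itvcc u' v' `<=` itvcc u v.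
    move=> x; rewrite /itvcc/= !in_itv/= => /andP[? ?]; apply/andP; split; lra.
  pose Y := W ^+ 3 * P^`() ^+ 2.
  have Y0 x : itvcc u v x -> 0 <= Y.[x].
    rewrite /itvcc/= in_itv/= => /andP[ux xv].
    by rewrite hornerM (horner_exp _ _ 3) (horner_exp _ _ 2) WE mulr_ge0 ?sqr_ge0// exprn_ge0// divr_ge0 ?sqr_ge0// mulr_ge0// subr_ge0.
  have Y1 : \int[lebesgue_measure]_(t in itvcc u' v') (P^`().[t] ^+ 2) <=
      dl ^- 3 * \int[lebesgue_measure]_(t in itvcc u v) Y.[t].
    apply: (@le_trans _ _ (dl ^- 3 * \int[lebesgue_measure]_(t in itvcc u' v') Y.[t])).
      rewrite -rintZ; [|exact: measurable_itv|exact: lebesgue_itvcc_fin|exact: bmf_poly_itvcc].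
      apply: rint_le; [exact: measurable_itv|exact: lebesgue_itvcc_fin| | |].
      - exact: bmf_poly_itvcc_sqr.
      - by apply: bmfZ; exact: bmf_poly_itvcc.
      move=> x; rewrite /itvcc/= in_itv/= => /andP[ux xv].
      rewrite hornerM (horner_exp _ _ 3) (horner_exp _ _ 2) mulrA -[leLHS]mul1r ler_wpM2r ?sqr_ge0//.
      rewrite -exprVn -exprMn exprn_ege1// mulrC ler_pdivlMr// mul1r WE.
      by rewrite ler_pM2r ?invr_gt0 ?exprn_gt0//; apply: ler_pM; lra.
    rewrite ler_wpM2l ?invr_ge0 ?exprn_ge0 ?(ltW g0)//.
    apply: rint_subset => //; [exact: measurable_itv|exact: measurable_itv|exact: lebesgue_itvcc_fin|exact: bmf_poly_itvcc].
  apply: (le_trans Y1); rewrite -mulrA ler_wpM2l ?invr_ge0 ?exprn_ge0 ?(ltW g0)//.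
  rewrite rint_affp// /chebL mulrACA divff// mul1r.
  rewrite -rintZ//; [|exact: measurable_itv|exact: lebesgue_itvcc_fin|exact: bmf_hcos].
  apply: rint_le; [exact: measurable_itv|exact: lebesgue_itvcc_fin|..].
  - by apply: bmfM; [exact: bmf_hcos|apply: bmfZ; exact: bmf_sin].
  - by apply: bmfZ; exact: bmf_hcos.
  move=> t tp; rewrite -/h.
  have WQ : W \Po affp u v = 1 - 'X^2.
    rewrite comp_polyZ comp_polyM !comp_polyB !comp_polyX !comp_polyC /affp -/h.
    have e1 : ((u + v) / 2)%:P = u%:P + h%:P by rewrite -polyCD /h; congr (_%:P); field.
    have e2 : v%:P = u%:P + h%:P + h%:P by rewrite -!polyCD /h; congr (_%:P); field.
    rewrite e1 e2 -!mul_polyC.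
    transitivity ((h ^- 2)%:P * h%:P ^+ 2 * (1 - 'X^2)); first by ring.
    rewrite -polyC_exp -polyCM mulVf; first by rewrite polyC1 mul1r.
    exact: (expf_neq0 2 hn).
  have -> : (Y \Po affp u v).[cos t] =
      (1 - cos t ^+ 2) ^+ 3 * (P^`() \Po affp u v).[cos t] ^+ 2.
    have W3 : (W ^+ 3) \Po affp u v = (1 - 'X^2) ^+ 3.
      by rewrite [W ^+ 3]exprS [W ^+ 2]expr2 !comp_polyM WQ -expr2 -exprS.
    by rewrite comp_polyM comp_poly_sqr W3 horner_w3sqr.
  have -> : Q^`() = h *: (P^`() \Po affp u v).
    by have := derivn_comp_affp u v P 1; rewrite expr1.
  rewrite horner_w3sqr hornerZ -sin2cos2; set z := (_ \Po _).[_].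
  have s1 : sin t <= 1 by exact: sin_le1.
  have -> : h^-1 * ((sin t ^+ 2) ^+ 3 * (h * z) ^+ 2) = (sin t ^+ 2) ^+ 3 * z ^+ 2 * h.
    by field.
  apply: ler_wpM2l; first by apply: mulr_ge0; [apply: exprn_ge0|]; exact: sqr_ge0.
  by rewrite -[leRHS]mulr1 ler_wpM2l// ltW.
have n1 : n.+1%:R ^+ 2 <= 4 * n%:R ^+ 2 :> R.
  rewrite -[4](_ : 2 ^+ 2 = _); last by ring.
  by rewrite -exprMn lerXn2r ?nnegrE// -natrM ler_nat; clear -n0; lia.
have n2 : 1 <= n%:R ^+ 2 :> R by rewrite exprn_ege1// ler1n.
apply: (le_trans K1).
set A := chebL _ in K1 L3 *; set B := chebL _ in L1 L3; set C := chebL _ in QJ L2 L3.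
have C0 : 0 <= C.
  apply: chebL_ge0 => x x1; rewrite horner_wsqr mulr_ge0 ?sqr_ge0// subr_ge0.
  by rewrite -[leRHS](expr1n _ 2) -normr_le_sqr// ler_norml.
have AC : A <= 16 * n%:R ^+ 2 * C.
  apply: (le_trans L3); have B1 : B <= 4 * n%:R ^+ 2 * C.
    apply: (le_trans L1); apply: ler_pM => //.
    apply: chebL_ge0 => x _; rewrite horner_exp; exact: sqr_ge0.
  have C1 : C <= n%:R ^+ 2 * C by rewrite -[leLHS]mul1r ler_wpM2r.
  have -> : 16 * n%:R ^+ 2 * C = 2 * (4 * n%:R ^+ 2 * C) + 8 * (n%:R ^+ 2 * C) by ring.
  by rewrite lerD// ler_wpM2l.
have -> : dl ^- 3 * (pi / h) * (40 / (pi * h)) * n%:R ^+ 2 * J =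
  dl ^- 3 * (pi / h) * (40 * n%:R ^+ 2 * (J / (pi * h))).
  by move: (pi / h) ((pi * h)^-1) => q1 q2; ring.
have f1 : 0 < dl ^- 3 by rewrite invr_gt0 exprn_gt0.
have f2 : 0 < pi / h by exact: divr_gt0.
apply: ler_wpM2l; first exact/ltW/mulr_gt0.
apply: (le_trans AC); apply: ler_pM => //.
by rewrite ler_wpM2r ?sqr_ge0// ler_nat.
Qed.

End IntervalBounds.

(** * Spectral theorem and Hadamard inequality *)

Section RealSpectral.
Variable R : realType.

Lemma Re_sum (I : Type) (r : seq I) (F : I -> R[i]) :
  complex.Re (\sum_(i <- r) F i) = \sum_(i <- r) complex.Re (F i).
Proof. by elim/big_rec2: _ => //= i y x _ <-; case: (F i); case: x. Qed.

(* Real and imaginary parts of a unitary matrix diagonalizing [M]. *)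
Lemma real_sym_spectral n (M : 'M[R]_n) : M^T = M ->
  exists (al be : 'M[R]_n) (d : 'I_n -> R),
  [/\ \det M = \prod_i d i,
      forall i, d i = \sum_a \sum_b M a b * (al i a * al i b + be i a * be i b),
      forall i, \sum_a (al i a ^+ 2 + be i a ^+ 2) = 1 &
      forall a b, \sum_i (al i a * al i b + be i a * be i b) = (a == b)%:R].
Proof.
move=> Ms; pose rc := real_complex R.
pose MC : 'M[R[i]]_n := map_mx rc M.
have MCs : MC \is hermsymmx.
  apply: realsym_hermsym.
    by apply/is_hermitianmxP; rewrite expr0 scale1r map_mx_id// /MC; apply/matrixP => i j; rewrite !mxE -[in RHS]Ms mxE.
  by apply/mxOverP => i j; rewrite mxE complex_real.
have Mn := hermitian_normalmx MCs.
pose P := spectralmx MC; pose sp := spectral_diag MC.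
have Pu : P \is unitarymx := spectral_unitarymx MC.
pose Pt := (P ^t Num.conj)%sesqui.
have PP : P *m Pt = 1%:M by apply/unitarymxP.
have PP' : Pt *m P = 1%:M by apply: mulmx1C.
have ME : MC = Pt *m diag_mx sp *m P.
  by rewrite {1}(orthomx_spectralP Mn) invmx_unitary.
have DE : diag_mx sp = P *m MC *m Pt.
  by rewrite ME !mulmxA PP mul1mx -mulmxA PP mulmx1.
have spr : sp \is a mxOver Num.real := hermitian_spectral_diag_real MCs.
have spR i : sp 0 i = rc (complex.Re (sp 0 i)).
  have /mxOverP/(_ 0 i) := spr.
  by move=> /complex_realP[x ->].
exists (\matrix_(i, a) complex.Re (P i a)), (\matrix_(i, a) complex.Im (P i a)),
  (fun i => complex.Re (sp 0 i)); split.
- have : \det MC = rc (\prod_i complex.Re (sp 0 i)).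
    rewrite ME !det_mulmx mulrAC -det_mulmx PP' det1 mul1r det_diag /rc rmorph_prod.
    by apply: eq_bigr => i _; exact: spR.
  by rewrite /MC det_map_mx => /(congr1 (@complex.Re R)).
- move=> i; have := congr1 (fun A : 'M[R[i]]_n => complex.Re (A i i)) DE.
  rewrite /= mxE eqxx mulr1n => ->.
  rewrite !mxE Re_sum exchange_big/=; apply: eq_bigr => b _.
  rewrite !mxE mulr_suml Re_sum; apply: eq_bigr => a _; rewrite !mxE.
  case: (P i a) => x y; case: (P i b) => z t /=; ring.
- move=> i; have := congr1 (fun A : 'M[R[i]]_n => complex.Re (A i i)) PP.
  rewrite /= !mxE eqxx Re_sum /= => <-; apply: eq_bigr => a _; rewrite !mxE.
  by case: (P i a) => x y /=; ring.
- move=> a b; have := congr1 (fun A : 'M[R[i]]_n => complex.Re (A a b)) PP'.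
  rewrite /= !mxE Re_sum => H.
  transitivity (complex.Re ((a == b)%:R : R[i])); last by case: (a == b).
  rewrite -H; apply: eq_bigr => i _; rewrite !mxE.
  by case: (P i a) => x y; case: (P i b) => z t /=; ring.
Qed.

(** The eigenvalues [d i] are nonnegative with sum [n], the trace. Multiplying [d i <= exp(d i - 1)]
    over [i] gives at most [exp 0]. *)
Lemma hadamard_unit_diag n (M : 'M[R]_n) : M^T = M ->
  (forall x : 'I_n -> R, 0 <= \sum_a \sum_b M a b * (x a * x b)) ->
  (forall i, M i i = 1) -> \det M <= 1.
Proof.
move=> Ms Mp M1; have [al [be [d [-> dE _ o]]]] := real_sym_spectral Ms.
have d0 i : 0 <= d i.
  rewrite dE; under eq_bigr => a _ do
    (under eq_bigr => b _ do rewrite mulrDr; rewrite big_split/=).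
  by rewrite big_split/= addr_ge0//; exact: Mp.
have dn : \sum_i d i = n%:R.
  under eq_bigr do rewrite dE.
  rewrite exchange_big/= (eq_bigr (fun=> 1)) ?sumr_const ?card_ord// => a _.
  rewrite exchange_big/= (eq_bigr (fun b => M a b * (a == b)%:R)); last first.
    by move=> b _; rewrite -mulr_sumr o.
  rewrite (bigD1 a)//= eqxx mulr1 M1 big1 ?addr0// => b ba.
  by rewrite eq_sym (negbTE ba) mulr0.
apply: (@le_trans _ _ (\prod_i expR (d i - 1))).
  apply: ler_prod => i _; rewrite d0/=.
  by have := expR_ge1Dx (d i - 1); rewrite addrC subrK.
by rewrite -expR_sum sumrB dn sumr_const card_ord subrr expR0.
Qed.

End RealSpectral.

(** * Orthonormal polynomials and the trace-log inequality *)

Section OpenUnitInterval.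
Variable R : realType.
Variable mu : {finite_measure set (measurableTypeR R) -> \bar R}.
Implicit Types (f g : R -> R) (Q : {poly R}).

Definition ud : set (measurableTypeR R) := `]-1, 1[%classic.

Lemma measurable_ud : measurable ud. Proof. exact: measurable_itv. Qed.

Lemma ud_fin : (mu ud < +oo)%E.
Proof. by rewrite -ge0_fin_numE// fin_num_measure//; exact: measurable_ud. Qed.

Lemma bmf_poly_ud Q : bmf ud (horner Q).
Proof.
apply: (@bmf_poly _ _ _ 1) => x; rewrite /ud/= in_itv/= => /andP[x1 x2].
by rewrite ler_norml !ltW.
Qed.

Definition muL f : R := \int[mu]_(x in ud) f x.

Lemma muLD f g : bmf ud f -> bmf ud g -> muL (fun x => f x + g x) = muL f + muL g.
Proof. exact: (rintD measurable_ud ud_fin). Qed.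

Lemma muLB f g : bmf ud f -> bmf ud g -> muL (fun x => f x - g x) = muL f - muL g.
Proof. exact: (rintB measurable_ud ud_fin). Qed.

Lemma muLZ c f : bmf ud f -> muL (fun x => c * f x) = c * muL f.
Proof. exact: (rintZ measurable_ud ud_fin). Qed.

Lemma muL_sum (I : Type) (r : seq I) (f : I -> R -> R) : (forall i, bmf ud (f i)) ->
  muL (fun x => \sum_(i <- r) f i x) = \sum_(i <- r) muL (f i).
Proof. exact: (rint_sum measurable_ud ud_fin). Qed.

Lemma muL_le f g : bmf ud f -> bmf ud g -> (forall x, ud x -> f x <= g x) -> muL f <= muL g.
Proof. exact: (rint_le measurable_ud ud_fin). Qed.

Lemma muL_ge0 f : (forall x, ud x -> 0 <= f x) -> 0 <= muL f.
Proof. exact: rint_ge0. Qed.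

Lemma muL_eq f g : (forall x, ud x -> f x = g x) -> muL f = muL g.
Proof. exact: rint_eq. Qed.

Lemma muL_cst c : muL (fun=> c) = c * fine (mu ud).
Proof. by rewrite /muL rint_cst//; exact: measurable_ud. Qed.

Lemma muL_gram (I : finType) (F : I -> {poly R}) (x y : I -> R) g : bmf ud g ->
  muL (fun t => (\sum_a x a * (F a).[t]) * (\sum_b y b * (F b).[t]) * g t) =
  \sum_a \sum_b x a * y b * muL (fun t => (F a).[t] * (F b).[t] * g t).
Proof.
move=> hg; have hF a b : bmf ud (fun t => (F a).[t] * (F b).[t] * g t).
  by apply: bmfM => //; apply: bmfM; exact: bmf_poly_ud.
transitivity (muL (fun t => \sum_a \sum_b (x a * y b) * ((F a).[t] * (F b).[t] * g t))).
  apply: muL_eq => t _; rewrite big_distrlr/= mulr_suml; apply: eq_bigr => a _.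
  by rewrite mulr_suml; apply: eq_bigr => b _; ring.
rewrite muL_sum; last by move=> a; apply: bmf_sum => b; exact: bmfZ.
apply: eq_bigr => a _; rewrite muL_sum; last by move=> b; exact: bmfZ.
by apply: eq_bigr => b _; rewrite muLZ.
Qed.

End OpenUnitInterval.

Arguments ud {R}.

Section Orthonormal.
Variable R : realType.
Variable mu : {finite_measure set (measurableTypeR R) -> \bar R}.
Variable P : nat -> {poly R}.
Hypothesis hP : orthonormal_polys mu P.
Implicit Types (f g : R -> R).
Local Notation L := (muL mu).

Lemma size_orth k : size (P k) = k.+1. Proof. by case: hP. Qed.
Lemma lead_orth_gt0 k : 0 < lead_coef (P k). Proof. by case: hP. Qed.

Lemma muL_orth j k : L (fun x => (P j).[x] * (P k).[x]) = (j == k)%:R.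
Proof. by case: hP => _ _ h; rewrite /muL /Rintegral h. Qed.

Lemma muL_orth1 j k : L (fun x => (P j).[x] * (P k).[x] * 1) = (j == k)%:R.
Proof. by rewrite -muL_orth; apply: muL_eq => x _; rewrite mulr1. Qed.

Definition diagK n x : R := \sum_(k < n) (P k).[x] ^+ 2.

Lemma bmf_diagK n : bmf ud (diagK n).
Proof. by apply: bmf_sum => k; apply: bmfX; exact: bmf_poly_ud. Qed.

Lemma muL_diagK n : L (diagK n) = n%:R.
Proof.
rewrite muL_sum; last by move=> i; apply: bmfX; exact: bmf_poly_ud.
rewrite (eq_bigr (fun=> 1)) ?sumr_const ?card_ord// => i _.
by rewrite -[RHS]/(true%:R) -(eqxx (i : nat)) -muL_orth; apply: muL_eq => x _; rewrite expr2.
Qed.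

Definition orthGram n g : 'M[R]_n :=
  \matrix_(i, j) L (fun x => (P i).[x] * (P j).[x] * g x).

(* Jensen's inequality in an eigenbasis of the Gram matrix. *)
Lemma expR_trace_le_det n f g : bmf ud f -> bmf ud g ->
  (forall x, ud x -> expR (f x) <= g x) ->
  expR (L (fun x => f x * diagK n x)) <= \det (orthGram n g).
Proof.
move=> hf hg fg; set M := orthGram n g.
have Ms : M^T = M.
  by apply/matrixP => i j; rewrite !mxE; apply: muL_eq => x _; rewrite [X in X * _]mulrC.
have [al [be [d [-> dE n1 o]]]] := real_sym_spectral Ms.
pose u i x := \sum_a al i a * (P a).[x]; pose v i x := \sum_a be i a * (P a).[x].
(* Squared modulus of the [i]-th, possibly complex, eigenpolynomial. Each [rho i] is a probability
   density for [mu], and together they sum to [diagK n]. *)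
pose rho i x := u i x * u i x + v i x * v i x.
have hP' a : bmf ud (horner (P a)) by exact: bmf_poly_ud.
have hu i : bmf ud (u i) by apply: bmf_sum => a; exact: bmfZ.
have hv i : bmf ud (v i) by apply: bmf_sum => a; exact: bmfZ.
have hr i : bmf ud (rho i) by apply: bmfD; exact: bmfM.
have r0 i x : 0 <= rho i x by rewrite addr_ge0// -expr2 sqr_ge0.
have gr h i : bmf ud h -> L (fun x => rho i x * h x) =
    \sum_a \sum_b (al i a * al i b + be i a * be i b) * L (fun t => (P a).[t] * (P b).[t] * h t).
  move=> hh; transitivity (L (fun x => u i x * u i x * h x + v i x * v i x * h x)).
    by apply: muL_eq => x _; rewrite mulrDl.
  rewrite muLD; [|by apply: bmfM => //; exact: bmfM..].
  have -> := @muL_gram R mu 'I_n (fun a => P a) (al i) (al i) h hh.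
  have -> := @muL_gram R mu 'I_n (fun a => P a) (be i) (be i) h hh.
  rewrite -big_split; apply: eq_bigr => a _; rewrite -big_split.
  by apply: eq_bigr => b _ /=; rewrite mulrDl.
have dg i : d i = L (fun x => rho i x * g x).
  by rewrite gr// dE; apply: eq_bigr => a _; apply: eq_bigr => b _; rewrite mxE mulrC.
have r1 i : L (rho i) = 1.
  transitivity (L (fun x => rho i x * 1)); first by apply: muL_eq => x _; rewrite mulr1.
  rewrite gr /=; last exact: bmf_cst.
  apply: etrans (n1 i); apply: eq_bigr => a _.
  rewrite (bigD1 a)//= muL_orth1 eqxx mulr1 big1 ?addr0 ?expr2// => b ba.
  by rewrite muL_orth1 eq_sym (_ : (b == a :> nat) = false) ?mulr0//; exact/negbTE.
have rK x : \sum_i rho i x = diagK n x.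
  transitivity (\sum_i \sum_a \sum_b (al i a * al i b + be i a * be i b) * ((P a).[x] * (P b).[x])).
    apply: eq_bigr => i _; rewrite /rho /u /v !big_distrlr/= -big_split; apply: eq_bigr => a _ /=.
    by rewrite -big_split; apply: eq_bigr => b _ /=; ring.
  rewrite exchange_big; apply: eq_bigr => a _ /=; rewrite exchange_big/=.
  rewrite (eq_bigr (fun b => (a == b)%:R * ((P a).[x] * (P b).[x]))); last first.
    by move=> b _; rewrite -mulr_suml o.
  rewrite (bigD1 a)//= eqxx mul1r big1 ?addr0 ?expr2// => b ba.
  by rewrite eq_sym (negbTE ba) mul0r.
(* Jensen's inequality through the tangent line of [exp] at the mean [a]:
   [exp y >= exp a (1 + y - a)], integrated against [rho i]. *)
have J i : expR (L (fun x => f x * rho i x)) <= d i.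
  set a := L _; rewrite dg.
  have -> : expR a = L (fun x => expR a * ((1 - a) * rho i x + f x * rho i x)).
    rewrite muLZ; last by apply: bmfD; [exact: bmfZ|exact: bmfM].
    rewrite muLD; [|exact: bmfZ|exact: bmfM].
    by rewrite muLZ// r1 -/a mulr1 subrK mulr1.
  apply: muL_le.
  - by apply: bmfZ; apply: bmfD; [exact: bmfZ|exact: bmfM].
  - exact: bmfM.
  move=> x ux; rewrite -mulrDl mulrA [leRHS]mulrC ler_wpM2r//.
  apply: le_trans (fg x ux); have -> : expR (f x) = expR a * expR (f x - a) by rewrite -expRD addrC subrK.
  rewrite ler_wpM2l ?expR_ge0//.
  by apply: le_trans (expR_ge1Dx _); rewrite addrAC addrA.
have -> : L (fun x => f x * diagK n x) = \sum_i L (fun x => f x * rho i x).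
  rewrite -muL_sum; last by move=> i; exact: bmfM.
  by apply: muL_eq => x _; rewrite -rK mulr_sumr.
by rewrite expR_sum; apply: ler_prod => i _; rewrite expR_ge0 J.
Qed.

(** The passage from [P] to [q] is triangular, with determinant the product of the ratios of leading
    coefficients. Dividing each [q k] by its norm for [g dmu] gives a Gram matrix with unit
    diagonal, to which Hadamard's inequality applies. *)
Lemma det_orthGram_le n (q : nat -> {poly R}) g : bmf ud g ->
  (forall x, ud x -> 0 <= g x) ->
  (forall k, size (q k) = k.+1) ->
  (forall k, 0 < L (fun x => (q k).[x] ^+ 2 * g x)) ->
  \det (orthGram n g) <=
  \prod_(k < n) ((lead_coef (P k) / lead_coef (q k)) ^+ 2 * L (fun x => (q k).[x] ^+ 2 * g x)).
Proof.
move=> hg g0 sq Lq0; set M := orthGram n g.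
pose h k := L (fun x => (q k).[x] ^+ 2 * g x).
pose s k := Num.sqrt (h k).
have s0 k : 0 < s k by rewrite sqrtr_gt0 Lq0.
have [c hc] : exists c : nat -> nat -> R, forall k, q k = \sum_(a < k.+1) c k a *: P a.
  have /choice[c hc] k : exists c : nat -> R, q k = \sum_(a < k.+1) c a *: P a.
    by apply: (poly_basis_expansion size_orth); rewrite sq.
  by exists c.
have lc k : c k k = lead_coef (q k) / lead_coef (P k).
  have lP : lead_coef (P k) != 0 by rewrite gt_eqF// lead_orth_gt0.
  have : (q k)`_k = c k k * (P k)`_k.
    rewrite [q k]hc coef_sum big_ord_recr/= coefZ big1 ?add0r// => i _.
    by rewrite coefZ [X in _ * X]nth_default ?mulr0// size_orth.
  rewrite !lead_coefE sq size_orth /= => ->; rewrite mulfK//.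
  by move: lP; rewrite lead_coefE size_orth.
pose C : 'M[R]_n := \matrix_(k, a) (if (a <= k)%N then c k a / s k else 0).
have qC (k : 'I_n) x : (s k)^-1 * (q k).[x] = \sum_(a < n) C k a * (P a).[x].
  rewrite [q k]hc horner_sum mulr_sumr.
  rewrite (big_ord_widen_cond n xpredT (fun a => (s k)^-1 * (c k a *: P a).[x]))//.
  rewrite big_mkcond/=; apply: eq_bigr => a _; rewrite mxE ltnS.
  by case: ifP => _; rewrite ?mul0r// hornerZ mulrCA mulrA.
pose G : 'M[R]_n := C *m M *m C^T.
have GE k l : G k l = (s k)^-1 * (s l)^-1 * L (fun x => (q k).[x] * (q l).[x] * g x).
  rewrite -muLZ; last by apply: bmfM => //; apply: bmfM; exact: bmf_poly_ud.
  transitivity (L (fun t => (\sum_(a < n) C k a * (P a).[t]) *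
     (\sum_(b < n) C l b * (P b).[t]) * g t)); last first.
    by apply: muL_eq => x _; rewrite -!qC; ring.
  have -> := @muL_gram R mu 'I_n (fun a => P a) (C k) (C l) g hg.
  rewrite mxE exchange_big/=; apply: eq_bigr => b _; rewrite !mxE mulr_suml.
  by apply: eq_bigr => a _; rewrite !mxE; ring.
have Gs : G^T = G.
  apply/matrixP => k l; rewrite mxE !GE [(s l)^-1 * _]mulrC; congr (_ * _).
  by apply: muL_eq => x _; rewrite [X in X * _]mulrC.
have G1 k : G k k = 1.
  rewrite GE (_ : L _ = h k).
    have hs : h k = s k * s k by rewrite -expr2 sqr_sqrtr// ltW// Lq0.
    rewrite hs; field; by rewrite gt_eqF.
  by apply: muL_eq => x _; rewrite expr2.
have Gp (x : 'I_n -> R) : 0 <= \sum_a \sum_b G a b * (x a * x b).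
  have := @muL_gram R mu 'I_n (fun a => q a) (fun a => x a / s a) (fun a => x a / s a) g hg.
  move=> H; apply: (@le_trans _ _ (L (fun t => (\sum_(a < n) (x a / s a) * (q a).[t]) *
     (\sum_(b < n) (x b / s b) * (q b).[t]) * g t))).
    by apply: muL_ge0 => t ut; rewrite mulr_ge0 ?g0// -expr2 sqr_ge0.
  rewrite H le_eqVlt; apply/orP; left; apply/eqP.
  by apply: eq_bigr => a _; apply: eq_bigr => b _; rewrite GE; ring.
have := hadamard_unit_diag Gs Gp G1.
have dC : \det C = \prod_(k < n) (c k k / s k).
  rewrite det_trig; last first.
    by apply/is_trig_mxP => i j ij; rewrite mxE leqNgt ij.
  by apply: eq_bigr => k _; rewrite mxE leqnn.
rewrite !det_mulmx det_tr mulrAC -expr2 dC -prodrXl => dle.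
have c0 : 0 < \prod_(k < n) (c k k / s k) ^+ 2.
  apply: prodr_gt0 => k _; have sn : s k != 0 by rewrite gt_eqF.
  have cn : c k k != 0.
    rewrite lc; apply: mulf_neq0; first by rewrite lead_coef_eq0 -size_poly_eq0 sq.
    by rewrite invr_neq0// gt_eqF// lead_orth_gt0.
  have kn : c k k / s k != 0 by apply: mulf_neq0 => //; exact: invr_neq0.
  by rewrite lt_def sqr_ge0 andbT sqrf_eq0.
move: dle; rewrite -ler_pdivlMl// mulr1 -prodfV => dle; apply: (le_trans dle).
rewrite le_eqVlt; apply/orP; left; apply/eqP; apply: eq_bigr => k _.
have lP : lead_coef (P k) != 0 by rewrite gt_eqF// lead_orth_gt0.
have lq : lead_coef (q k) != 0 by rewrite lead_coef_eq0 -size_poly_eq0 sq.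
have sn : s k != 0 by rewrite gt_eqF.
have hs : L (fun x => (q k).[x] ^+ 2 * g x) = s k * s k by rewrite -expr2 sqr_sqrtr// ltW// Lq0.
by rewrite lc hs; field; rewrite sn lP lq.
Qed.

Lemma trace_log_bound n (q : nat -> {poly R}) f g : bmf ud f -> bmf ud g ->
  (forall x, ud x -> expR (f x) <= g x) ->
  (forall k, size (q k) = k.+1) ->
  (forall k, 0 < L (fun x => (q k).[x] ^+ 2 * g x)) ->
  L (fun x => f x * diagK n x) <=
  \sum_(k < n) ln ((lead_coef (P k) / lead_coef (q k)) ^+ 2 * L (fun x => (q k).[x] ^+ 2 * g x)).
Proof.
move=> hf hg fg sq Lq0.
have g0 x : ud x -> 0 <= g x by move=> /fg; apply: le_trans; exact: expR_ge0.
pose F k := (lead_coef (P k) / lead_coef (q k)) ^+ 2 * L (fun x => (q k).[x] ^+ 2 * g x).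
have : expR (L (fun x => f x * diagK n x)) <= \prod_(k < n) F k.
  exact: le_trans (expR_trace_le_det n hf hg fg) (det_orthGram_le n hg g0 sq Lq0).
have F0 k : 0 < F k.
  rewrite mulr_gt0 ?Lq0// exprn_even_gt0//= mulf_neq0// ?invr_neq0//.
    by rewrite gt_eqF// lead_orth_gt0.
  by rewrite lead_coef_eq0 -size_poly_eq0 sq.
have -> : \prod_(k < n) F k = expR (\sum_(k < n) ln (F k)).
  by rewrite expR_sum; apply: eq_bigr => k _; rewrite lnK// posrE.
by rewrite ler_expR.
Qed.

End Orthonormal.

(** * Chebyshev moments of the diagonal kernel *)

Section BernsteinSzego.
Variable R : realType.
Variables (rho : R) (j : nat).
Implicit Types (N r : nat).

(* With [x = cos t], the polynomial [bsq N r] is the real part of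
   [e^(i r t) (e^(i j t) - rho)^N]. *)
Fixpoint bsq N r : {poly R} :=
  if N is N'.+1 then bsq N' (r + j) - rho *: bsq N' r else chebT R r.

(** Imaginary part of the expression whose real part is [bsq]. *)
Fixpoint bss N r (t : R) : R :=
  if N is N'.+1 then bss N' (r + j) t - rho * bss N' r t else sin (r%:R * t).

(** At [x = cos t] this is [|e^(i j t) - rho|^2]. *)
Definition bsW : {poly R} := (1 + rho ^+ 2)%:P - (2 * rho) *: chebT R j.

(** Raising [r] by [j] multiplies the complex value by [e^(i j t)]. *)
Lemma bsq_bss_shift N r t :
  (bsq N (r + j)).[cos t] = cos (j%:R * t) * (bsq N r).[cos t] - sin (j%:R * t) * bss N r t /\
  bss N (r + j) t = sin (j%:R * t) * (bsq N r).[cos t] + cos (j%:R * t) * bss N r t.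
Proof.
elim: N r => [|N IH] r /=.
  have [-> _] := horner_cheb_cos r t; have [-> _] := horner_cheb_cos (r + j) t.
  rewrite natrD mulrDl cosD sinD; split; ring.
have [h1 h2] := IH (r + j)%N; have [h3 h4] := IH r.
rewrite !hornerD !hornerN !hornerZ h1 h2 h3 h4; split; ring.
Qed.

(** A squared real part is at most the squared modulus, which is [W^N] whatever [r] is. *)
Lemma bsq_sqr_le N r t : (bsq N r).[cos t] ^+ 2 <= bsW.[cos t] ^+ N.
Proof.
have -> : bsW.[cos t] ^+ N = (bsq N r).[cos t] ^+ 2 + bss N r t ^+ 2; last first.
  by rewrite lerDl sqr_ge0.
elim: N r => [|N IH] r /=.
  by have [-> _] := horner_cheb_cos r t; rewrite cos2Dsin2 expr0.
have [h1 h2] := bsq_bss_shift N r t.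
rewrite exprS (IH r) hornerD hornerN hornerZ h1 h2.
have -> : bsW.[cos t] = (cos (j%:R * t) - rho) ^+ 2 + sin (j%:R * t) ^+ 2.
  rewrite /bsW hornerD hornerC hornerN hornerZ; have [-> _] := horner_cheb_cos j t.
  by rewrite sin2cos2; ring.
ring.
Qed.

Lemma size_bsq N r : (0 < j)%N -> size (bsq N r) = (j * N + r).+1 /\
  lead_coef (bsq N r) = lead_coef (chebT R (j * N + r)).
Proof.
move=> j0; elim: N r => [|N IH] r /=; first by rewrite muln0 add0n size_chebT.
have [s1 l1] := IH r; have [s2 l2] := IH (r + j)%N.
have lt : (size (- (rho *: bsq N r))%R < size (bsq N (r + j)))%N.
  rewrite size_polyN s2; apply: leq_ltn_trans (size_scale_leq _ _) _.
  by rewrite s1; clear -j0; lia.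
have e : (j * N + (r + j) = j * N.+1 + r)%N by clear; lia.
by rewrite size_polyDl// lead_coefDl// s2 l2 e.
Qed.

Lemma bsW_ge x : -1 <= x <= 1 -> (1 - `|rho|) ^+ 2 <= bsW.[x].
Proof.
move=> x1; rewrite /bsW hornerD hornerC hornerN hornerZ.
have T1 : `|(chebT R j).[x]| <= 1.
  by apply: chebT_le1; rewrite -[leRHS](expr1n _ 2) -normr_le_sqr// ler_norml.
have : rho * (chebT R j).[x] <= `|rho|.
  by rewrite (le_trans (ler_norm _))// normrM ler_piMr.
have : `|rho| ^+ 2 = rho ^+ 2 by rewrite -normrX ger0_norm// sqr_ge0.
by rewrite sqrrB expr1n; lra.
Qed.

End BernsteinSzego.

Lemma sum_lt_le (R : realDomainType) (n m : nat) (c : R) : 0 <= c ->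
  \sum_(k < n) (if (k < m)%N then c else 0) <= m%:R * c.
Proof.
move=> c0; have -> : \sum_(k < n) (if (k < m)%N then c else 0) = (minn n m)%:R * c.
  elim: n => [|n IH]; first by rewrite big_ord0 min0n mul0r.
  rewrite big_ord_recr/= IH; case: ltnP => nm.
    by rewrite (minn_idPl nm) -natr1 mulrDl mul1r.
  by rewrite (minn_idPr (leqW nm)) addr0.
by rewrite ler_wpM2r// ler_nat geq_minr.
Qed.

Section ChebyshevTrace.
Variable R : realType.
Variable mu : {finite_measure set (measurableTypeR R) -> \bar R}.
Variable P : nat -> {poly R}.
Hypothesis hP : orthonormal_polys mu P.
Hypothesis hreg : regular_measure mu.
Local Notation L := (muL mu).
Local Notation K := (diagK P).

(** From some index on, [gamma_k^(1/k) < 2 exp(eta)]; [C] absorbs the finitely many earlier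
    indices. *)
Lemma regular_log_bound (eta : R) : 0 < eta ->
  exists C, forall k, ln (lead_coef (P k) / 2 ^+ k) <= eta * k%:R + C.
Proof.
move=> eta0; have /cvgrPdist_lt := hreg hP.
have d0 : 0 < 2 * (expR eta - 1) by rewrite mulr_gt0// subr_gt0 expR_gt1.
move=> /(_ _ d0) [k0 _ hk0].
pose a k := ln (lead_coef (P k) / 2 ^+ k).
exists (\sum_(i < k0.+1) `|a i|) => k; rewrite -/(a k).
have S0 : 0 <= \sum_(i < k0.+1) `|a i| by apply: sumr_ge0.
have [kk|kk] := ltnP k k0.+1.
  apply: (le_trans (ler_norm _)); rewrite (bigD1 (Ordinal kk))//= addrCA lerDl.
  by rewrite addr_ge0 ?mulr_ge0 ?(ltW eta0)// sumr_ge0.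
apply: ler_wpDr => //.
have lP := lead_orth_gt0 hP k.
have k1 : 0 < k%:R :> R by rewrite ltr0n; exact: leq_trans kk.
have /= := hk0 k (ltnW kk); rewrite ltr_distlC => /andP[_].
rewrite addrC mulrBr mulr1 subrK => h.
rewrite /a ln_div ?posrE ?exprn_gt0// lnXn//.
have : ln (lead_coef (P k) `^ k%:R^-1) <= ln (2 * expR eta).
  by rewrite ler_ln ?posrE ?powR_gt0 ?mulr_gt0 ?expR_gt0// ltW.
rewrite ln_powR lnM ?posrE ?expR_gt0// expRK mulrC ler_pdivrMr// => h2.
by rewrite lerBlDr (le_trans h2)// -[ln 2 *+ k]mulr_natr mulrDl addrC.
Qed.

Variable j : nat.
Hypothesis j0 : (0 < j)%N.

Lemma mass_gt0 : 0 < L (fun=> 1).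
Proof.
have := muL_orth hP 0 0; rewrite eqxx => e.
have [B B0 hB] := horner_bounded (P 0) 1.
have h : L (fun x => (P 0).[x] * (P 0).[x]) <= L (fun=> B ^+ 2).
  apply: muL_le; [by apply: bmfM; exact: bmf_poly_ud|exact: bmf_cst|].
  move=> x; rewrite /ud/= in_itv/= => /andP[x1 x2].
  rewrite -expr2 -normr_le_sqr// hB// ler_norml !ltW//.
move: h; rewrite e !muL_cst !mul1r => h.
have : 0 <= fine (mu ud) by exact: fine_ge0.
rewrite le_eqVlt => /orP[/eqP m0|//]; move: h; rewrite -m0 mulr0.
by rewrite ler10.
Qed.

(** The trace-log inequality with [f = N (1 - W)] and [g = W^(-N)], admissible because
    [exp(1 - W) <= 1 / W]. *)
Lemma trace_bsW_bound (rho : R) (n N : nat) : `|rho| < 1 ->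
  N%:R * L (fun x => (1 - (bsW rho j).[x]) * K n x) <=
  \sum_(k < n) (2 * ln (lead_coef (P k) / 2 ^+ k) + (2 * ln 2 + ln (L (fun=> 1)))) +
  j%:R * N%:R ^+ 2 * ln ((1 - `|rho|) ^- 2).
Proof.
move=> rho1; set W := bsW rho j; set b := (1 - `|rho|) ^+ 2.
have b0 : 0 < b by rewrite exprn_gt0// subr_gt0.
have Wb x : ud x -> b <= W.[x].
  by rewrite /ud/= in_itv/= => /andP[x1 x2]; apply: bsW_ge; rewrite !ltW.
have W0 x : ud x -> 0 < W.[x] by move=> /Wb; exact: lt_le_trans.
have hW : bmf ud (horner W) by exact: bmf_poly_ud.
pose f x := N%:R * (1 - W.[x]); pose g x := (W.[x]^-1) ^+ N.
have hf : bmf ud f by apply: bmfZ; apply: bmfB => //; exact: bmf_cst.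
have hg : bmf ud g.
  apply: bmfX; apply: (bmfV b0 hW) => x /Wb h; exact: le_trans (ler_norm _).
have fg x : ud x -> expR (f x) <= g x.
  move=> ux; rewrite /f /g mulrC expRM_natr lerXn2r ?nnegrE ?expR_ge0 ?invr_ge0 ?(ltW (W0 x ux))//.
  rewrite -[leLHS]invrK -expRN lef_pV2 ?posrE ?expR_gt0 ?W0//.
  by have := expR_ge1Dx (- (1 - W.[x])); rewrite opprB addrC subrK.
(* From degree [jN] on, Bernstein-Szego polynomials give [q_k^2 W^(-N) <= 1], hence a mass at most
   that of [mu]. Below it [bsq] provides no polynomial of degree [k], and [T_k] is used at the cost
   of a factor [b^(-N)]; these [jN] indices produce the [N^2] term. *)
pose q k := if (k < j * N)%N then chebT R k else bsq rho j N (k - j * N).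
have sq k : size (q k) = k.+1.
  rewrite /q; case: ltnP => h; first exact: size_chebT.
  by have [-> _] := size_bsq rho N (k - j * N) j0; rewrite subnKC.
(* [T_k] has leading coefficient [2^(k-1)] for [k > 0] but 1 for [k = 0]. Half of [2^k] bounds both
   from below and accounts for the term [2 ln 2]. *)
have lq k : 2 ^+ k / 2 <= lead_coef (q k).
  have -> : lead_coef (q k) = lead_coef (chebT R k).
    rewrite /q; case: ltnP => h //.
    by have [_ ->] := size_bsq rho N (k - j * N) j0; rewrite subnKC.
  case: k => [|k]; first by rewrite chebT0 lead_coef1 expr0; lra.
  by rewrite lead_coef_chebTS exprSr mulfK.
have lq0 k : 0 < lead_coef (q k) by apply: lt_le_trans (lq k); rewrite divr_gt0// exprn_gt0.
have hqg k : bmf ud (fun x => (q k).[x] ^+ 2 * g x).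
  by apply: bmfM => //; apply: bmfX; exact: bmf_poly_ud.
pose h k := L (fun x => (q k).[x] ^+ 2 * g x).
pose m0 := L (fun=> 1).
have m00 : 0 < m0 := mass_gt0.
have B1 : 1 <= b^-1.
  have a0 : 0 <= 1 - `|rho| by rewrite subr_ge0 ltW.
  have a1 : 1 - `|rho| <= 1 by rewrite gerBl.
  by rewrite -invr1 lef_pV2 ?posrE// /b exprn_ile1.
have hle k : h k <= m0 * (if (k < j * N)%N then b^-1 ^+ N else 1).
  rewrite mulrC -muLZ; last exact: bmf_cst.
  apply: muL_le => //; first by apply: bmfZ; exact: bmf_cst.
  move=> x ux; have := ux; rewrite /ud/= in_itv/= => /andP[x1 x2].
  have x11 : -1 <= x <= 1 by rewrite !ltW.
  rewrite mulr1 /q; case: ltnP => hk.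
    rewrite -[leRHS]mul1r ler_pM ?sqr_ge0 ?exprn_ge0 ?invr_ge0 ?(ltW (W0 x ux))//.
      rewrite -[leRHS](expr1n _ 2) -normr_le_sqr// chebT_le1//.
      by rewrite -[leRHS](expr1n _ 2) -normr_le_sqr// ler_norml.
    rewrite /g lerXn2r ?nnegrE ?invr_ge0 ?(ltW b0) ?(ltW (W0 x ux))//.
    by rewrite lef_pV2 ?posrE ?W0 ?Wb.
  rewrite /g exprVn ler_pdivrMr ?exprn_gt0 ?W0// mul1r.
  by rewrite -[x]acosK ?in_itv//= bsq_sqr_le.
(* [q k] has a nonzero coefficient on [P k], hence a positive norm for [mu], and [g] is bounded
   below on [(-1, 1)]. *)
have hpos k : 0 < h k.
  have c0 : exists2 c, 0 < c & forall x, ud x -> c <= g x.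
    have [C1 C10 hC1] := horner_bounded W 1.
    pose C := C1 + 1; have C00 : 0 < C by rewrite ltr_wpDl.
    have hC x : ud x -> W.[x] <= C.
      rewrite /ud/= in_itv/= => /andP[x1 x2].
      apply: (le_trans (ler_norm _)); apply: ler_wpDr => //; apply: hC1.
      by rewrite ler_norml !ltW.
    exists (C^-1 ^+ N); first by rewrite exprn_gt0// invr_gt0.
    move=> x ux; rewrite /g lerXn2r ?nnegrE ?invr_ge0 ?(ltW C00) ?(ltW (W0 x ux))//.
    by rewrite lef_pV2 ?posrE ?W0 ?hC.
  have [c c00 hc] := c0.
  have [co qE] := poly_basis_expansion (size_orth hP) (eq_leq (sq k)).
  have cn : co k != 0.
    apply/negP => /eqP ck; have : (q k)`_k = 0.
      rewrite qE coef_sum big_ord_recr/= ck scale0r coef0 addr0 big1// => i _.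
      by rewrite coefZ [X in _ * X]nth_default ?mulr0// (size_orth hP).
    move=> qk0; have := lq0 k; by rewrite lead_coefE sq /= qk0 ltxx.
  apply: (@lt_le_trans _ _ (c * \sum_(a < k.+1) co a ^+ 2)).
    rewrite mulr_gt0// big_ord_recr/= ltr_wpDl ?sumr_ge0// => [i _|]; first exact: sqr_ge0.
    by rewrite exprn_even_gt0.
  have -> : \sum_(a < k.+1) co a ^+ 2 = L (fun x => (q k).[x] ^+ 2).
    have := @muL_gram R mu 'I_k.+1 (fun a => P a) (fun a => co a) (fun a => co a) (fun=> 1) (bmf_cst _ _).
    rewrite (_ : L _ = L (fun x => (q k).[x] ^+ 2)); last first.
      apply: muL_eq => x _; rewrite mulr1 -expr2; congr (_ ^+ 2).
      by rewrite qE horner_sum; apply: eq_bigr => a _; rewrite hornerZ.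
    move=> ->; apply: eq_bigr => a _.
    rewrite (bigD1 a)//= muL_orth1 ?eqxx ?mulr1 ?big1 ?addr0 ?expr2// => b' ba.
    by rewrite muL_orth1// eq_sym (_ : (b' == a :> nat) = false) ?mulr0//; exact/negbTE.
  rewrite -muLZ; last by apply: bmfX; exact: bmf_poly_ud.
  apply: muL_le => //; first by apply: bmfZ; apply: bmfX; exact: bmf_poly_ud.
  by move=> x ux; rewrite mulrC ler_wpM2l ?sqr_ge0 ?hc.
have := trace_log_bound hP n hf hg fg sq hpos.
have -> : L (fun x => f x * K n x) = N%:R * L (fun x => (1 - W.[x]) * K n x).
  rewrite -muLZ; first by apply: muL_eq => x _; rewrite /f mulrA.
  by apply: bmfM; [apply: bmfB => //; exact: bmf_cst|exact: bmf_diagK].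
move=> H; apply: (le_trans H).
apply: (@le_trans _ _ (\sum_(k < n) ((2 * ln (lead_coef (P k) / 2 ^+ k) + (2 * ln 2 + ln m0)) +
   (if (k < j * N)%N then N%:R * ln b^-1 else 0)))).
  apply: ler_sum => k _.
  have lP := lead_orth_gt0 hP k.
  have r1 : lead_coef (P k) / lead_coef (q k) <= lead_coef (P k) / 2 ^+ k * 2.
    rewrite -mulrA ler_wpM2l ?(ltW lP)// -[X in _ <= _ * X]invrK -invfM.
    by rewrite lef_pV2 ?posrE ?divr_gt0 ?exprn_gt0 ?lq.
  have e2 : 0 < lead_coef (P k) / 2 ^+ k by rewrite divr_gt0// exprn_gt0.
  have e3 : 0 < lead_coef (P k) / lead_coef (q k) by rewrite divr_gt0.
  have e4 : 0 < (lead_coef (P k) / lead_coef (q k)) ^+ 2 by rewrite exprn_gt0.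
  have e5 : ln (lead_coef (P k) / lead_coef (q k)) <= ln (lead_coef (P k) / 2 ^+ k) + ln 2.
    have e8 : 0 < lead_coef (P k) / 2 ^+ k * 2 by exact: mulr_gt0.
    by rewrite -lnM ?posrE// ler_ln ?posrE.
  have e6 : 0 < (if (k < j * N)%N then b^-1 ^+ N else 1) by case: ifP; rewrite ?exprn_gt0 ?invr_gt0.
  have e7 : ln (h k) <= ln m0 + (if (k < j * N)%N then N%:R * ln b^-1 else 0).
    apply: (@le_trans _ _ (ln (m0 * (if (k < j * N)%N then b^-1 ^+ N else 1)))).
      by rewrite ler_ln ?posrE ?hpos ?hle// mulr_gt0.
    rewrite lnM ?posrE//; case: ifP => _; last by rewrite ln1.
    by rewrite lnXn ?invr_gt0// mulr_natl.
  have e9 : ln ((lead_coef (P k) / lead_coef (q k)) ^+ 2 * h k) =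
      2 * ln (lead_coef (P k) / lead_coef (q k)) + ln (h k).
    by rewrite lnM ?posrE// lnXn// mulr_natl.
  rewrite -/(h k) e9.
  by move: e5 e7; lra.
rewrite big_split/= lerD2l.
have BN0 : 0 <= N%:R * ln b^-1 by rewrite mulr_ge0// ln_ge0.
apply: (le_trans (sum_lt_le n (j * N) BN0)).
by rewrite natrM le_eqVlt; apply/orP; left; apply/eqP; rewrite expr2; ring.
Qed.

(** Division by [N], with [N] about [n / m]. The [N^2] term becomes about [j B n / m], made small by
    [m]; the leading coefficients contribute about [2 eta m n], made small by choosing [eta] after
    [m]; the constants are absorbed by large [n]. *)
Lemma trace_chebT_half (rho eps : R) : `|rho| < 1 -> 0 < eps ->
  \forall n \near \oo, 2 * rho * L (fun x => (chebT R j).[x] * K n x) <=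
     (rho ^+ 2 + eps) * n%:R.
Proof.
move=> rho1 eps0; pose B := ln ((1 - `|rho|) ^- 2).
have B0 : 0 <= B.
  have a0 : 0 < 1 - `|rho| by rewrite subr_gt0.
  have a1 : 1 - `|rho| <= 1 by rewrite gerBl.
  by rewrite ln_ge0// -[X in X <= _]invr1 lef_pV2 ?posrE ?exprn_gt0// exprn_ile1// ltW.
pose m := (Num.truncn (3 * (j%:R * B) / eps)).+1.
have m0 : 0 < m%:R :> R by rewrite ltr0n.
have hm : j%:R * B / m%:R <= eps / 3.
  rewrite ler_pdivrMr//.
  have : 3 * (j%:R * B) / eps < m%:R by exact: truncnS_gt.
  rewrite ltr_pdivrMr// => h; lra.
pose eta := eps / (6 * m%:R).
have eta0 : 0 < eta by rewrite divr_gt0// mulr_gt0.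
have [C hC] := regular_log_bound eta0.
pose C' := 2 * `|C| + `|2 * ln 2 + ln (L (fun=> 1))|.
pose n0 := (Num.truncn (3 * (m%:R * C' + j%:R * B) / eps)).+1.
near=> n.
have n1 : (0 < n)%N by near: n; exact: nbhs_infty_gt.
have n0R : 0 < n%:R :> R by rewrite ltr0n.
have nn0 : 3 * (m%:R * C' + j%:R * B) / eps < n%:R.
  by apply: (lt_le_trans (truncnS_gt _)); rewrite ler_nat; near: n; exact: nbhs_infty_ge.
pose N := (n %/ m).+1.
have N0 : 0 < N%:R :> R by rewrite ltr0n.
have nNm : n%:R <= N%:R * m%:R :> R by rewrite -natrM ler_nat ltnW// ltn_ceil.
have Nn : N%:R <= n%:R / m%:R + 1 :> R.
  by rewrite -natr1 lerD2r ler_pdivlMr// -natrM ler_nat leq_trunc_div.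
have := trace_bsW_bound n N rho1; rewrite -/B.
set S := \sum_(k < n) _ => H.
have SS : S <= 2 * eta * n%:R ^+ 2 + C' * n%:R.
  apply: (@le_trans _ _ (\sum_(k < n) (2 * eta * n%:R + C'))).
    apply: ler_sum => k _; have hk := hC k.
    have kn : eta * k%:R <= eta * n%:R by rewrite ler_wpM2l ?(ltW eta0)// ler_nat ltnW.
    have c1 := ler_norm C; have c2 := ler_norm (2 * ln 2 + ln (L (fun=> 1))).
    by rewrite /C'; move: hk kn c1 c2; lra.
  by rewrite sumr_const card_ord -mulr_natl; rewrite le_eqVlt; apply/orP; left; apply/eqP; ring.
pose X := L (fun x => (chebT R j).[x] * K n x).
have XE : L (fun x => (1 - (bsW rho j).[x]) * K n x) = 2 * rho * X - rho ^+ 2 * n%:R.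
  have b1 : bmf ud (K n) := bmf_diagK P n.
  have b2 : bmf ud (fun x => (chebT R j).[x] * K n x).
    by apply: bmfM => //; exact: bmf_poly_ud.
  rewrite -(muL_diagK hP n) /X -(muLZ mu (2 * rho) b2) -(muLZ mu (rho ^+ 2) b1).
  rewrite -muLB; [|exact: bmfZ..].
  by apply: muL_eq => x _; rewrite /bsW hornerD hornerC hornerN hornerZ; ring.
rewrite -/X [(_ + eps) * _]mulrDl -lerBlDl -XE.
set Z := L _ in H *.
have H2 : Z <= m%:R * (2 * eta * n%:R + C') + j%:R * B * N%:R.
  rewrite -(ler_pM2l N0); apply: (le_trans H); rewrite mulrDr; apply: lerD.
    apply: (le_trans SS).
    have -> : 2 * eta * n%:R ^+ 2 + C' * n%:R = n%:R * (2 * eta * n%:R + C') by ring.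
    rewrite [leRHS]mulrA; apply: ler_wpM2r => //.
    apply: addr_ge0; first by rewrite mulr_ge0// mulr_ge0// ltW.
    by rewrite addr_ge0// mulr_ge0.
  by rewrite le_eqVlt; apply/orP; left; apply/eqP; rewrite expr2; ring.
apply: (le_trans H2).
have h1 : m%:R * (2 * eta * n%:R) = eps / 3 * n%:R.
  by rewrite /eta; field; rewrite gt_eqF.
have h2 : j%:R * B * N%:R <= eps / 3 * n%:R + j%:R * B.
  apply: (@le_trans _ _ (j%:R * B * (n%:R / m%:R + 1))).
    by rewrite ler_wpM2l// mulr_ge0.
  rewrite mulrDr mulr1 lerD2r mulrCA mulrC ler_wpM2r//.
move: nn0; rewrite ltr_pdivrMr// => h3; rewrite mulrDr h1.
by move: h2 h3; lra.
Unshelve. all: by end_near. Qed.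

(** The preceding bound at [rho = r] and [rho = -r], with slack [r^2], gives [2 r |X| <= 2 r^2 n]
    for the moment [X], and [r <= eps]. *)
Lemma trace_chebT (eps : R) : 0 < eps ->
  \forall n \near \oo, `|L (fun x => (chebT R j).[x] * K n x)| <= eps * n%:R.
Proof.
move=> eps0; pose r := Num.min eps (1 / 2).
have r0 : 0 < r by rewrite lt_min eps0/=.
have rh : r <= 1 / 2 by rewrite ge_min lexx orbT.
have re : r <= eps by rewrite ge_min lexx.
have r1 : `|r| < 1 by rewrite gtr0_norm//; lra.
have r1' : `|- r| < 1 by rewrite normrN.
have e0 : 0 < r ^+ 2 by rewrite exprn_gt0.
have A := trace_chebT_half r1 e0; have B := trace_chebT_half r1' e0.
near=> n.
have := near A n; have := near B n.
set X := L _ => /(_ _)/wrap[//|h1] /(_ _)/wrap[//|h2].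
have n0 : 0 <= n%:R :> R by [].
have a1 : X <= r * n%:R.
  rewrite -(@ler_pM2l _ (2 * r)) ?mulr_gt0//; apply: (le_trans h2).
  by rewrite le_eqVlt; apply/orP; left; apply/eqP; ring.
have a2 : - X <= r * n%:R.
  rewrite -(@ler_pM2l _ (2 * r)) ?mulr_gt0//.
  have -> : 2 * r * - X = 2 * - r * X by ring.
  apply: (le_trans h1).
  by rewrite le_eqVlt; apply/orP; left; apply/eqP; ring.
have a3 : r * n%:R <= eps * n%:R by rewrite ler_wpM2r.
by rewrite ler_norml; apply/andP; split; lra.
Unshelve. all: by end_near. Qed.

End ChebyshevTrace.

(** * Polynomial approximation in L1 *)

Section Weierstrass.
Variable R : realType.
Implicit Types (F : nat -> R) (f : R -> R) (x : R).

(* [bern n F] evaluated at [x] is the expectation of [F] at a binomial variable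
   with parameters [n] and [x]. *)
Fixpoint bern n F : {poly R} :=
  if n is n'.+1 then 'X * bern n' (fun k => F k.+1) + (1 - 'X) * bern n' F
  else (F 0%N)%:P.

Lemma hornerBernS n F x :
  (bern n.+1 F).[x] = x * (bern n (fun k => F k.+1)).[x] + (1 - x) * (bern n F).[x].
Proof. by rewrite /= hornerD !hornerM hornerD hornerN hornerC !hornerX. Qed.

Lemma bern_affine n F (a b : R) x :
  (bern n (fun k => a + b * F k)).[x] = a + b * (bern n F).[x].
Proof.
elim: n F => [|n IH] F; first by rewrite /= !hornerC.
by rewrite !hornerBernS (IH (fun k => F k.+1)) IH; ring.
Qed.

Lemma bern_le n F (G : nat -> R) x : 0 <= x <= 1 ->
  (forall k, (k <= n)%N -> F k <= G k) -> (bern n F).[x] <= (bern n G).[x].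
Proof.
move=> /andP[x0 x1]; elim: n F G => [|n IH] F G FG; first by rewrite /= !hornerC FG.
rewrite !hornerBernS; apply: lerD; apply: ler_wpM2l => //.
- by apply: IH => k kn; apply: FG.
- by rewrite subr_ge0.
- by apply: IH => k kn; apply: FG; exact: leqW.
Qed.

(** Second moment about [c] of a binomial variable: its variance plus the squared bias. *)
Lemma bern_sqr n (c : R) x :
  (bern n (fun k => (k%:R - c) ^+ 2)).[x] = n%:R * x * (1 - x) + (n%:R * x - c) ^+ 2.
Proof.
elim: n c => [|n IH] c; first by rewrite /= hornerC; ring.
rewrite hornerBernS IH -natr1.
have -> : (fun k => (k.+1%:R - c) ^+ 2) = (fun k => (k%:R - (c - 1)) ^+ 2) :> (nat -> R).
  by apply/funext => k; rewrite -natr1; congr (_ ^+ 2); ring.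
by rewrite IH; ring.
Qed.

Lemma uniform_continuity_itv (a b : R) f : continuous f ->
  forall eps, 0 < eps -> exists2 d, 0 < d &
    forall x y, a <= x <= b -> `|x - y| <= d -> `|f x - f y| <= eps.
Proof.
move=> cf eps eps0.
have /compact_near_coveringP K := @segment_compact R a b.
have := K nat \oo (fun n x => forall y, `|x - y| <= n.+1%:R^-1 -> `|f x - f y| <= eps) _.
case.
  move=> x _; have /cvgrPdist_lt/(_ _ (divr_gt0 eps0 (ltr0n R 2))) := cf x.
  rewrite -filter_from_ballE => -[d /= d0 hd].
  pose n0 := (Num.truncn (2 / d)).
  exists (ball x (d / 2), [set n | (n0 <= n)%N]).
    split => /=; first by apply: nbhsx_ballx; rewrite divr_gt0.
    by exists n0.
  move=> [x' n] [/= xx' nn] y xy.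
  have dn : n.+1%:R^-1 < d / 2.
    rewrite -[ltRHS]invrK ltf_pV2 ?posrE ?invr_gt0 ?divr_gt0//.
    rewrite invf_div; apply: (lt_le_trans (truncnS_gt _)).
    by rewrite ler_nat ltnS.
  have h1 : `|f x - f x'| < eps / 2.
    by apply: hd; rewrite /ball/=; apply: (lt_le_trans xx'); rewrite ler_piMr ?(ltW d0)//; lra.
  have h2 : `|f x - f y| < eps / 2.
    apply: hd; rewrite /ball/= -[x](subrK x') -addrA; apply: (le_lt_trans (ler_normD _ _)).
    rewrite [ltRHS](_ : d = d / 2 + d / 2); last by field.
    by apply: ltrD => //; exact: le_lt_trans dn.
  rewrite -(subrK (f x) (f x')) -addrA; apply: (le_trans (ler_normD _ _)).
  by rewrite distrC; lra.
move=> n0 _ h; exists n0.+1%:R^-1; first by rewrite invr_gt0.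
move=> x y xab; apply: (h n0 (leqnn _)) => /=; by rewrite in_itv.
Qed.

Lemma continuous_bounded_itv (a b : R) f : continuous f ->
  exists2 M, 0 < M & forall x, a <= x <= b -> `|f x| <= M.
Proof.
move=> cf; have : compact (f @` `[a, b]%classic).
  by apply: continuous_compact; [exact: continuous_subspaceT|exact: segment_compact].
move=> /compact_bounded[M [_ hM]]; exists (`|M| + 1); first by rewrite ltr_wpDl.
move=> x x01; apply: (hM (`|M| + 1)).
  by rewrite (le_lt_trans (ler_norm _))// ltrDl.
by exists x => //=; rewrite in_itv.
Qed.

Lemma continuous_bmf_itvcc (a b : R) f : continuous f -> bmf (itvcc a b) f.
Proof.
move=> cf; split.
  apply: (@measurable_funS _ _ _ _ setT) => //; exact: continuous_measurable_fun.
have [M _ hM] := continuous_bounded_itv a b cf.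
by exists M => x; rewrite /itvcc/= in_itv; exact: hM.
Qed.

(** Bernstein's proof. Nodes within [d] of [x] deviate by at most [eps / 2], the others by at most
    [2M], which [B (k - n x)^2] dominates; the binomial variance makes the expectation of this
    quadratic at most [eps / 2]. *)
Lemma weierstrass01 f : continuous f -> forall eps, 0 < eps ->
  exists Q : {poly R}, forall x, 0 <= x <= 1 -> `|Q.[x] - f x| <= eps.
Proof.
move=> cf eps eps0.
have [d d0 hd] := @uniform_continuity_itv 0 1 f cf _ (divr_gt0 eps0 (ltr0n R 2)).
have [M M0 hM] := continuous_bounded_itv 0 1 cf.
pose n := (Num.truncn (4 * M / (d ^+ 2 * eps))).+1.
have n0 : 0 < n%:R :> R by rewrite ltr0n.
have hn : 4 * M / (d ^+ 2 * eps) < n%:R by exact: truncnS_gt.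
exists (bern n (fun k => f (k%:R / n%:R))) => x x01.
have x0 : 0 <= x by case/andP: x01.
have x1 : x <= 1 by case/andP: x01.
pose B := 2 * M / (n%:R * d) ^+ 2.
have B0 : 0 <= B by rewrite divr_ge0 ?mulr_ge0 ?sqr_ge0// ltW.
have pt k : (k <= n)%N -> `|f (k%:R / n%:R) - f x| <= eps / 2 + B * (k%:R - n%:R * x) ^+ 2.
  move=> kn; have k01 : (0 <= (k%:R / n%:R : R)) && ((k%:R / n%:R : R) <= 1).
    by apply/andP; split; [exact: divr_ge0|rewrite ler_pdivrMr// mul1r ler_nat].
  have [h|h] := leP `|x - k%:R / n%:R| d.
    rewrite distrC; apply: (le_trans (hd _ _ x01 h)).
    by rewrite lerDl mulr_ge0 ?sqr_ge0.
  apply: ler_wpDl; first by rewrite divr_ge0 ?(ltW eps0).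
  apply: (@le_trans _ _ (M + M)); first by rewrite (le_trans (ler_normB _ _))// lerD ?hM.
  have -> : B * (k%:R - n%:R * x) ^+ 2 = 2 * M * ((x - k%:R / n%:R) ^+ 2 / d ^+ 2).
    by rewrite /B; field; rewrite !gt_eqF.
  have -> : M + M = 2 * M * 1 by ring.
  rewrite ler_wpM2l ?mulr_ge0 ?(ltW M0)// ler_pdivlMr ?exprn_gt0// mul1r.
  by rewrite -[leRHS]real_normK ?num_real// lerXn2r ?nnegrE ?(ltW d0)// ltW.
have e1 : B * (n%:R * x * (1 - x)) <= eps / 2.
  have xx : x * (1 - x) <= 1 by rewrite mulr_ile1// ?subr_ge0// gerBl.
  apply: (@le_trans _ _ (2 * M / (d ^+ 2 * n%:R))).
    have -> : B * (n%:R * x * (1 - x)) = 2 * M / (d ^+ 2 * n%:R) * (x * (1 - x)).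
      by rewrite /B; field; rewrite !gt_eqF.
    have c0 : 0 <= 2 * M / (d ^+ 2 * n%:R).
      by apply: divr_ge0; apply: mulr_ge0 => //; [exact: ltW|exact: sqr_ge0].
    by rewrite -[leRHS]mulr1 ler_wpM2l.
  move: hn; rewrite ltr_pdivrMr ?mulr_gt0 ?exprn_gt0// => hn.
  rewrite ler_pdivrMr ?mulr_gt0 ?exprn_gt0//.
  have -> : eps / 2 * (d ^+ 2 * n%:R) = n%:R * (d ^+ 2 * eps) / 2 by ring.
  by rewrite ler_pdivlMr//; move: hn; lra.
have up : (bern n (fun k => (eps / 2 + f x) + B * (k%:R - n%:R * x) ^+ 2)).[x] <= f x + eps.
  by rewrite bern_affine bern_sqr subrr expr0n addr0; lra.
have lo : f x - eps <= (bern n (fun k => (f x - eps / 2) + (- B) * (k%:R - n%:R * x) ^+ 2)).[x].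
  by rewrite bern_affine bern_sqr subrr expr0n addr0; lra.
rewrite ler_distl; apply/andP; split.
  apply: (le_trans lo); apply: bern_le => // k /pt; rewrite ler_distl => /andP[h _]; lra.
apply: le_trans up; apply: bern_le => // k /pt; rewrite ler_distl => /andP[_ h]; lra.
Qed.

Lemma weierstrass (a b : R) f : a < b -> continuous f -> forall eps, 0 < eps ->
  exists Q : {poly R}, forall x, a <= x <= b -> `|Q.[x] - f x| <= eps.
Proof.
move=> ab cf eps eps0; have ba0 : 0 < b - a by rewrite subr_gt0.
have cg : continuous (fun s => f (a + (b - a) * s)).
  move=> s; apply: (@continuous_comp _ _ _ (fun s => a + (b - a) * s) f); last exact: cf.
  by apply: cvgD; [exact: cvg_cst|exact: mulrl_continuous].
have [Q hQ] := weierstrass01 cg eps0.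
exists (Q \Po ((b - a)^-1 *: ('X - a%:P))) => x /andP[ax xb].
rewrite horner_comp hornerZ hornerD hornerX hornerN hornerC.
have -> : f x = f (a + (b - a) * ((b - a)^-1 * (x - a))).
  by rewrite mulVKf ?gt_eqF// addrC subrK.
apply: hQ; rewrite mulr_ge0 ?invr_ge0 ?subr_ge0 ?(ltW ba0) ?(ltW ab)//=.
by rewrite mulrC ler_pdivrMr// mul1r lerD2r.
Qed.

(* Continuous functions are dense in L^1; truncation keeps the bounds. *)
Lemma poly_L1_approx (a b m M : R) (g : R -> R) : a < b -> 0 < m ->
  measurable_fun (itvcc a b) (g : measurableTypeR R -> measurableTypeR R) ->
  (forall x, a <= x <= b -> m <= g x <= M) ->
  forall eps, 0 < eps -> exists G : {poly R},
   (forall x, a <= x <= b -> m / 2 <= G.[x] <= M + m) /\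
   \int[lebesgue_measure]_(x in itvcc a b) `|G.[x] - g x| <= eps.
Proof.
move=> ab m0 mg hg eps eps0.
have mI : measurable (itvcc a b) by exact: measurable_itv.
have fI : (lebesgue_measure (itvcc a b) < +oo)%E := lebesgue_itvcc_fin a b.
have mM : m <= M.
  have /hg/andP[h1 h2] : a <= a <= b by rewrite lexx ltW.
  exact: le_trans h2.
have inI x : itvcc a b x -> a <= x <= b by rewrite /itvcc/= in_itv.
have hgb : bmf (itvcc a b) g.
  split => //; exists M => x /inI/hg /andP[h1 h2]; by rewrite ger0_norm// (le_trans _ h1)// ltW.
have [h [ch ih hlim]] := approximation_continuous_integrable mI fI (bmf_integrable mI fI hgb).
have e2 : 0 < eps / 2 by rewrite divr_gt0.
have [n hn] : exists n, (\int[lebesgue_measure]_(z in itvcc a b) `|(g z - h n z)%:E| < (eps / 2)%:E)%E.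
  have /fine_cvgP[fi /cvgrPdist_lt/(_ _ e2) nr] := hlim.
  have [n _ hn] : \forall n \near \oo, (\int[lebesgue_measure]_(z in itvcc a b) `|(g z - h n z)%:E| < (eps / 2)%:E)%E.
    near=> n.
    have fin : (\int[lebesgue_measure]_(z in itvcc a b) `|(g z - h n z)%:E|)%E \is a fin_num by near: n.
    rewrite -(fineK fin) lte_fin.
    have : `|0 - fine (\int[lebesgue_measure]_(z in itvcc a b) `|(g z - h n z)%:E|)%E| < eps / 2 by near: n.
    by rewrite sub0r normrN; apply: le_lt_trans; exact: ler_norm.
  by exists n; exact: (hn n (leqnn n)).
pose k x := Num.max m (Num.min M (h n x)).
have ck : continuous k.
  move=> x; apply: (@continuous_max _ _ (fun=> m) (fun x => Num.min M (h n x))).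
    exact: cst_continuous.
  by apply: (@continuous_min _ _ (fun=> M) (h n)); [exact: cst_continuous|exact: ch].
have kb x : m <= k x <= M by rewrite /k le_max lexx/= ge_max mM ge_min lexx.
have kg x : itvcc a b x -> `|k x - g x| <= `|g x - h n x|.
  move=> /inI/hg /andP[h1 h2]; rewrite /k distrC.
  case: (leP M (h n x)) => hM; [case: (leP m M) => hmM|case: (leP m (h n x)) => hmM] => //.
  - by rewrite !ler0_norm ?subr_le0 ?(le_trans h2)// lerN2 lerD2l lerN2.
  - by move: mM hmM; lra.
  - by rewrite !ger0_norm ?subr_ge0 ?(le_trans _ h1)// ?(ltW hmM)// lerD2l lerN2 ltW.
have hh : bmf (itvcc a b) (h n) by apply: continuous_bmf_itvcc; exact: ch.
have hk : bmf (itvcc a b) k by exact: continuous_bmf_itvcc.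
have ikg : \int[lebesgue_measure]_(x in itvcc a b) `|k x - g x| <= eps / 2.
  apply: (@le_trans _ _ (\int[lebesgue_measure]_(x in itvcc a b) `|g x - h n x|)).
    by apply: rint_le => //; apply: bmf_norm; exact: bmfB.
  have hgh : bmf (itvcc a b) (fun x => `|g x - h n x|) by apply: bmf_norm; exact: bmfB.
  rewrite -lee_fin -rint_EFin//; apply: ltW; exact: hn.
pose eta := Num.min (m / 2) (eps / (2 * (b - a))).
have ba0 : 0 < b - a by rewrite subr_gt0.
have eta0 : 0 < eta by rewrite lt_min !divr_gt0// mulr_gt0.
have eta1 : eta <= m / 2 by rewrite ge_min lexx.
have eta2 : eta * (b - a) <= eps / 2.
  apply: (@le_trans _ _ (eps / (2 * (b - a)) * (b - a))).
    by rewrite ler_wpM2r ?(ltW ba0)// ge_min lexx orbT.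
  by rewrite le_eqVlt; apply/orP; left; apply/eqP; field; rewrite gt_eqF.
have [Q hQ] := weierstrass ab ck eta0.
exists Q; split.
  move=> x xab; have := hQ x xab; have /andP[k1 k2] := kb x.
  rewrite ler_distl => /andP[q1 q2]; apply/andP; split; lra.
have hQb : bmf (itvcc a b) (horner Q) by exact: bmf_poly_itvcc.
apply: (@le_trans _ _ (\int[lebesgue_measure]_(x in itvcc a b) (eta + `|k x - g x|))).
  apply: rint_le => //.
  - by apply: bmf_norm; exact: bmfB.
  - by apply: bmfD; [exact: bmf_cst|apply: bmf_norm; exact: bmfB].
  move=> x /inI xab; rewrite -(subrK (k x) Q.[x]) -addrA.
  by rewrite (le_trans (ler_normD _ _))// lerD2r hQ.
rewrite rintD//; [|exact: bmf_cst|by apply: bmf_norm; exact: bmfB].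
by rewrite rint_cst// fine_lebesgue_itvcc ?(ltW ab)//; move: ikg eta2; lra.
Unshelve. all: by end_near.
Qed.

End Weierstrass.

(** * Asymptotics of the diagonal kernel in mean *)

Lemma rint_split (R : realType) (m : {measure set (measurableTypeR R) -> \bar R})
  (E D : set (measurableTypeR R)) (f : R -> R) :
  measurable E -> measurable D -> (m D < +oo)%E -> E `<=` D -> bmf D f ->
  \int[m]_(x in D) f x = \int[m]_(x in E) f x + \int[m]_(x in D `\` E) f x.
Proof.
move=> mE mD fD ED hf.
have mDE : measurable (D `\` E) by exact: measurableD.
have e : D = E `|` (D `\` E) by rewrite setDUK.
rewrite {1}e Rintegral_setU//; first by rewrite -e; exact: bmf_integrable.
by apply/disj_setPS => x [Ex []].
Qed.

Lemma fin_measure_subset (R : realType) (m : {measure set (measurableTypeR R) -> \bar R})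
  (E D : set (measurableTypeR R)) : measurable E -> measurable D ->
  (m D < +oo)%E -> E `<=` D -> (m E < +oo)%E.
Proof. by move=> mE mD fD ED; apply: le_lt_trans fD; apply: le_measure; rewrite ?inE. Qed.

(** * Integration against mu on an interval of absolute continuity *)

Section Density.
Variable R : realType.
Variable mu : {finite_measure set (measurableTypeR R) -> \bar R}.
Variables (w : R -> R) (c d Mw : R).
Hypothesis w_density : ac_density mu w.
Hypotheses (lt_N1c : -1 < c) (lt_d1 : d < 1).
Hypothesis mu_ac : abs_continuous_on mu `[c, d].
Hypothesis wM : forall x, c <= x <= d -> w x <= Mw.
Local Notation leb := (@lebesgue_measure R).
Local Notation I := (itvcc c d).

Let mI : measurable I. Proof. exact: measurable_itv. Qed.
Let fI : (leb I < +oo)%E. Proof. exact: lebesgue_itvcc_fin. Qed.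
Let fmu (E : set (measurableTypeR R)) : measurable E -> (mu E < +oo)%E.
Proof. by move=> mE; rewrite -ge0_fin_numE// fin_num_measure. Qed.

Lemma w_ge0 x : 0 <= w x. Proof. by case: w_density. Qed.

Lemma bmf_w : bmf I w.
Proof.
have [mw w0 _] := w_density; split; first exact: measurable_funTS.
by exists Mw => x; rewrite /itvcc/= in_itv/= => hx; rewrite ger0_norm ?w_ge0// wM.
Qed.

(** The singular part [nu] vanishes on subsets of [I]: on the null set [N] because [mu], which
    dominates [nu], does; off [N] by singularity. *)
Lemma mu_density_set (E : set (measurableTypeR R)) : measurable E -> E `<=` I ->
  fine (mu E) = \int[leb]_(x in E) w x.
Proof.
move=> mE EI; have [_ _ [nu [[N [mN lN nuN]] hmu]]] := w_density.
have mEN : measurable (E `&` N) by exact: measurableI.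
have nuEN : nu (E `&` N) = 0%E.
  have l0 : leb (E `&` N) = 0%E.
    by apply/eqP; rewrite eq_le measure_ge0 andbT -lN; apply: le_measure; rewrite ?inE//; exact: subIsetr.
  have m0 : mu (E `&` N) = 0%E by apply: mu_ac => //; exact: subset_trans (@subIsetl _ _ _) EI.
  have e : 0%E = (\int[leb]_(x in E `&` N) (w x)%:E + nu (E `&` N))%E.
    exact: etrans (esym m0) (hmu _ mEN).
  apply/eqP; rewrite eq_le measure_ge0 andbT [leRHS]e leeDr//; apply: integral_ge0 => x _.
  by rewrite lee_fin w_ge0.
have nuE : nu E = 0%E.
  have mENc : measurable (E `&` ~` N) by apply: measurableI => //; exact: measurableC.
  have z1 : (nu (E `&` N) <= 0)%E by rewrite nuEN.
  have z2 : (nu (E `&` ~` N) <= 0)%E.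
    by rewrite -nuN; apply: le_measure; rewrite ?inE//; first [exact: measurableC|exact: subIsetr].
  apply/eqP; rewrite eq_le measure_ge0 andbT.
  have -> : E = (E `&` N) `|` (E `&` ~` N) by rewrite -setIUr setUv setIT.
  apply: (le_trans (measureU2 _ _ _)) => //.
  by have := leeD z1 z2; rewrite adde0; apply.
by rewrite (hmu _ mE) nuE adde0.
Qed.

(** On the slice where [h] lies between [dl *+ K] and [dl *+ K.+1], both integrals lie between these
    values times the mass of the slice. They therefore differ in total by at most [dl] times the
    mass, for every [dl > 0]. *)
Lemma mu_density (h : R -> R) (E : set (measurableTypeR R)) : measurable E -> E `<=` I ->
  bmf I h -> (forall x, I x -> 0 <= h x) ->
  \int[mu]_(x in E) h x = \int[leb]_(x in E) (h x * w x).
Proof.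
move=> mE EI hh h0.
have hw := bmf_w.
have hhw : bmf I (fun x => h x * w x) by exact: bmfM.
have fle (F : set (measurableTypeR R)) : measurable F -> F `<=` I -> (leb F < +oo)%E.
  by move=> mF FI; exact: fin_measure_subset fI FI.
(* Splitting off one level set of [h] at a time. *)
have key (dl : R) : 0 < dl -> forall K (F : set (measurableTypeR R)), measurable F -> F `<=` I ->
    (forall x, F x -> h x < dl *+ K) ->
    `|\int[mu]_(x in F) h x - \int[leb]_(x in F) (h x * w x)| <= dl * fine (mu F).
  move=> dl0; elim=> [|K IH] F mF FI hF.
    have -> : F = set0.
      by rewrite -subset0 => x Fx; have := hF x Fx; rewrite mulr0n ltNge h0//; exact: FI.
    by rewrite !Rintegral_set0 subrr normr0 measure0 mulr0.
  pose F1 := F `&` [set x | h x < dl *+ K]; pose F2 := F `\` F1.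
  have mF1 : measurable F1.
    have [mh _] := bmf_sub FI mI hh.
    have := mh mF `]-oo, (dl *+ K)[%classic (measurable_itv _).
    by rewrite set_itv_infty_o.
  have mF2 : measurable F2 by exact: measurableD.
  have F1F : F1 `<=` F by exact: subIsetl.
  have F2F : F2 `<=` F by move=> x [].
  have hF' : bmf F h by exact: bmf_sub hh.
  have hFw : bmf F (fun x => h x * w x) by exact: bmf_sub hhw.
  rewrite (rint_split mF1 mF (fmu mF) F1F hF') (rint_split mF1 mF (fle _ mF FI) F1F hFw).
  have h2 x : F2 x -> dl *+ K <= h x <= dl *+ K.+1.
    move=> [Fx nF1]; rewrite (ltW (hF _ Fx)) andbT leNgt; apply/negP => hlt.
    by apply: nF1; split.
  have F2I : F2 `<=` I by exact: subset_trans FI.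
  have b1 : (dl *+ K) * fine (mu F2) <= \int[mu]_(x in F2) h x <= (dl *+ K.+1) * fine (mu F2).
    rewrite -!rint_cst//; apply/andP; split; apply: rint_le => //;
      try (exact: fmu) ; try exact: bmf_cst; try exact: (bmf_sub F2I mI hh);
      by move=> x /h2 /andP[].
  have b2 : (dl *+ K) * fine (mu F2) <= \int[leb]_(x in F2) (h x * w x) <= (dl *+ K.+1) * fine (mu F2).
    rewrite mu_density_set// -!rintZ//; [|exact: fle|exact: (bmf_sub F2I mI hw)|exact: fle|exact: (bmf_sub F2I mI hw)].
    apply/andP; split; apply: rint_le => //; try exact: fle;
      try (apply: bmfZ; exact: (bmf_sub F2I mI hw)); try exact: (bmf_sub F2I mI hhw);
      by move=> x /h2 /andP[? ?]; rewrite ler_wpM2r// w_ge0.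
  have i1 := IH F1 mF1 (subset_trans F1F FI) (fun x Fx => proj2 Fx).
  have mm : fine (mu F) = fine (mu F1) + fine (mu F2).
    rewrite !mu_density_set//; last exact: subset_trans FI.
    by rewrite (rint_split mF1 mF (fle _ mF FI) F1F (bmf_sub FI mI hw)).
  move: b1 b2 i1; rewrite mm mulrSr; move: (fine (mu F1)) (fine (mu F2)) => p q.
  rewrite !ler_norml => /andP[? ?] /andP[? ?] /andP[? ?]; apply/andP; split; lra.
apply/eqP; rewrite -subr_eq0 -normr_le0; apply/ler_addgt0Pl => e e0; rewrite addr0.
pose dl := e / (fine (mu E) + 1).
have m0 : 0 <= fine (mu E) by exact: fine_ge0.
have dl0 : 0 < dl by rewrite divr_gt0// ltr_wpDl.
have [mh [B hB]] := hh.
pose K := (Num.truncn (B / dl)).+1.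
have hK x : E x -> h x < dl *+ K.
  move=> /EI Ix; apply: (@le_lt_trans _ _ B).
    by rewrite (le_trans (ler_norm _))// hB.
  by rewrite -mulr_natr mulrC -ltr_pdivrMr//; exact: truncnS_gt.
apply: (le_trans (key _ dl0 K E mE EI hK)).
rewrite /dl -mulrA ler_piMr ?(ltW e0)// mulrC ler_pdivrMr ?ltr_wpDl// mul1r lerDl//.
Qed.

Lemma itvcc_sub u v : c <= u -> v <= d -> itvcc u v `<=` I.
Proof. by move=> cu vd x; rewrite /itvcc/= !in_itv/= => /andP[? ?]; apply/andP; split; lra. Qed.

Lemma itvcc_ud u v : c <= u -> v <= d -> itvcc u v `<=` ud.
Proof.
move=> cu vd x; rewrite /itvcc /ud/= !in_itv/= => /andP[ux xv].
by rewrite (lt_le_trans lt_N1c (le_trans cu ux)) (le_lt_trans (le_trans xv vd) lt_d1).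
Qed.

Lemma bmf_itvcc_w u v : c <= u -> v <= d -> bmf (itvcc u v) w.
Proof. by move=> cu vd; apply: bmf_sub bmf_w => //; exact: itvcc_sub. Qed.

Lemma muL_ge_density u v (h : R -> R) : c <= u -> v <= d -> bmf ud h -> (forall x, ud x -> 0 <= h x) ->
  \int[leb]_(x in itvcc u v) (h x * w x) <= muL mu h.
Proof.
move=> cu vd hh h0.
have mud : measurable (ud : set (measurableTypeR R)) := @measurable_ud R.
have Iud : I `<=` ud by exact: itvcc_ud.
rewrite -mu_density//; [|exact: measurable_itv|exact: itvcc_sub|exact: bmf_sub hh|by move=> x /Iud; exact: h0].
apply: rint_subset => //; [exact: measurable_itv|exact: ud_fin|exact: itvcc_ud].
Qed.

Lemma muL_le_density u v (h : R -> R) B : c <= u -> v <= d -> bmf ud h -> 0 <= B ->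
  (forall x, ud x -> 0 <= h x) -> (forall x, ud x -> ~ (u <= x <= v) -> h x <= B) ->
  muL mu h <= \int[leb]_(x in itvcc u v) (h x * w x) + B * fine (mu ud).
Proof.
move=> cu vd hh B0 h0 hB.
have mud : measurable (ud : set (measurableTypeR R)) := @measurable_ud R.
have Iud : I `<=` ud by exact: itvcc_ud.
have mE : measurable (itvcc u v) by exact: measurable_itv.
have sE : itvcc u v `<=` ud by exact: itvcc_ud.
rewrite -mu_density//; [|exact: itvcc_sub|exact: bmf_sub hh|by move=> x /Iud; exact: h0].
rewrite /muL (rint_split mE mud (ud_fin mu) sE hh) lerD2l.
have mD : measurable (ud `\` itvcc u v) by exact: measurableD.
have sD : ud `\` itvcc u v `<=` ud by move=> x [].
apply: (@le_trans _ _ (\int[mu]_(x in ud `\` itvcc u v) B)).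
  apply: rint_le => //; [exact: fmu|exact: bmf_sub hh|exact: bmf_cst|].
  move=> x [ux nx]; apply: hB => //; by move=> ?; apply: nx; rewrite /itvcc/= in_itv.
rewrite rint_cst// ler_wpM2l// fine_le ?fin_num_measure//.
by apply: le_measure; rewrite ?inE.
Qed.

End Density.

Section ArcsineTrace.
Variable R : realType.
Local Notation leb := (@lebesgue_measure R).

(** Mass of [[u, v]] under the arcsine law. *)
Definition arcs (u v : R) : R := (acos u - acos v) / pi.

(** One-sided approximation of the indicator of [[u, v]]: a nonnegative polynomial majorant makes
    the trace over the interval comparable with a trace known asymptotically. *)
Lemma poly_above_interval (u v : R) : -1 < u -> u <= v -> v < 1 -> forall eps, 0 < eps ->
  exists f : {poly R}, [/\ forall x, -1 <= x <= 1 -> 0 <= f.[x],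
    forall x, u <= x <= v -> 1 <= f.[x] & chebL f <= arcs u v + eps].
Proof.
move=> u1 uv v1 eps eps0.
pose e := eps * pi / 4; have pi0 := pi_gt0 R.
have e0 : 0 < e by rewrite divr_gt0// mulr_gt0.
have [d1 d10 h1] : exists2 d, 0 < d & forall y, `|u - y| < d -> `|acos u - acos y| < e.
  have /continuous_acos/cvgrPdist_lt/(_ _ e0) : -1 < u < 1 by rewrite u1 (le_lt_trans uv).
  by rewrite -filter_from_ballE => -[d' /= d'0 hd]; exists d' => // y; exact: hd.
have [d2 d20 h2] : exists2 d, 0 < d & forall y, `|v - y| < d -> `|acos v - acos y| < e.
  have /continuous_acos/cvgrPdist_lt/(_ _ e0) : -1 < v < 1 by rewrite v1 (lt_le_trans u1).
  by rewrite -filter_from_ballE => -[d' /= d'0 hd]; exists d' => // y; exact: hd.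
pose dl := Num.min (Num.min (d1 / 2) (d2 / 2)) (Num.min ((u + 1) / 2) ((1 - v) / 2)).
have dl0 : 0 < dl by rewrite !lt_min; apply/andP; split; apply/andP; split; lra.
have [k1 k2 k3 k4] : [/\ dl <= d1 / 2, dl <= d2 / 2, dl <= (u + 1) / 2 & dl <= (1 - v) / 2].
  by split; rewrite /dl !ge_min lexx ?orbT.
pose al := acos (v + dl); pose be := acos (u - dl).
have vd1 : -1 <= v + dl <= 1 by apply/andP; split; lra.
have ud1 : -1 <= u - dl <= 1 by apply/andP; split; lra.
have al0 : 0 <= al by exact: acos_ge0.
have bep : be <= pi by exact: acos_lepi.
have alb : al \in `[0, pi] by rewrite in_itv/= al0 acos_lepi.
have beb : be \in `[0, pi] by rewrite in_itv/= bep acos_ge0.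
have cal : cos al = v + dl by rewrite acosK// in_itv.
have cbe : cos be = u - dl by rewrite acosK// in_itv.
have albe : al <= be.
  by rewrite leNgt; apply/negP => h; have := ltr_cos beb alb; rewrite h cal cbe; lra.
have hal : acos v - e <= al.
  have : `|v - (v + dl)| < d2 by rewrite opprD addNKr normrN gtr0_norm//; lra.
  by move/h2; rewrite ltr_distl -/al => /andP[? ?]; lra.
have hbe : be <= acos u + e.
  have : `|u - (u - dl)| < d1 by rewrite opprB addrC subrK gtr0_norm//; lra.
  by move/h1; rewrite ltr_distl -/be => /andP[? ?]; lra.
(* A trapezoid equal to 1 on [[u, v]] and to 0 beyond distance [dl]. In the variable [t] it is
   supported in [[al, be]], longer than the arc of [[u, v]] by at most [2e]. *)
pose phi x := Num.max 0 (1 - (Num.max 0 (Num.max (u - x) (x - v))) / dl).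
have cphi : continuous phi.
  have cm : continuous (fun x : R => Num.max (u - x) (x - v)).
    move=> x; apply: (@continuous_max _ _ (fun x => u - x) (fun x => x - v)).
      by apply: cvgB; [exact: cvg_cst|exact: cvg_id].
    by apply: cvgB; [exact: cvg_id|exact: cvg_cst].
  have cm0 : continuous (fun x : R => Num.max 0 (Num.max (u - x) (x - v))).
    move=> x; apply: (@continuous_max _ _ (fun=> 0) (fun x => Num.max (u - x) (x - v))).
      exact: cst_continuous.
    exact: cm.
  move=> x; apply: (@continuous_max _ _ (fun=> 0)
      (fun x => 1 - (Num.max 0 (Num.max (u - x) (x - v))) / dl)).
    exact: cst_continuous.
  apply: cvgB; first exact: cvg_cst.
  by apply: cvgM; [exact: cm0|exact: cvg_cst].
have phi0 x : 0 <= phi x by rewrite /phi le_max lexx.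
have phi1 x : phi x <= 1.
  by rewrite /phi ge_max ler01/= gerBl divr_ge0 ?(ltW dl0)// le_max lexx.
have phiin x : u <= x <= v -> phi x = 1.
  move=> /andP[ux xv]; rewrite /phi.
  have -> : Num.max 0 (Num.max (u - x) (x - v)) = 0.
    by apply/max_idPl; rewrite ge_max !subr_le0 ux xv.
  by rewrite mul0r subr0; apply/max_idPr.
have phiout x : x < u - dl \/ v + dl < x -> phi x = 0.
  move=> h; apply/max_idPl; rewrite subr_le0 ler_pdivlMr// mul1r !le_max.
  by case: h => h; apply/orP; right; apply/orP; [left|right]; lra.
pose eta := eps / 8; have eta0 : 0 < eta by rewrite divr_gt0.
have N11 : -1 < 1 :> R by lra.
have [Q hQ] := @weierstrass R (-1) 1 phi N11 cphi eta eta0.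
(* The shift by [eta] turns the two-sided approximation of [phi] into one from above. *)
exists (Q + eta%:P); split.
- move=> x /hQ; rewrite hornerD hornerC ler_distl => /andP[h _]; have := phi0 x; lra.
- move=> x hx; have /hQ : -1 <= x <= 1 by case/andP: hx => ? ?; apply/andP; split; lra.
  by rewrite hornerD hornerC ler_distl (phiin _ hx) => /andP[h _]; lra.
rewrite /chebL mulrC ler_pdivrMr//.
have mT : measurable (itv0pi R) by exact: measurable_itv.
have fT : (leb (itv0pi R) < +oo)%E by exact: lebesgue_itvcc_fin.
have mE : measurable (itvcc al be) by exact: measurable_itv.
have fE : (leb (itvcc al be) < +oo)%E by exact: lebesgue_itvcc_fin.
have sE : itvcc al be `<=` itv0pi R.
  by move=> t; rewrite /itvcc /itv0pi/= !in_itv/= => /andP[? ?]; apply/andP; split; lra.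
have hb : bmf (itv0pi R) (fun t => (Q + eta%:P).[cos t]) by exact: bmf_hcos.
have fup t : (Q + eta%:P).[cos t] <= phi (cos t) + 2 * eta.
  have /hQ : -1 <= cos t <= 1 by rewrite cos_geN1 cos_le1.
  by rewrite hornerD hornerC ler_distl => /andP[_ h]; lra.
rewrite (rint_split mE mT fT sE hb).
have mD : measurable (itv0pi R `\` itvcc al be) by exact: measurableD.
have sD : itv0pi R `\` itvcc al be `<=` itv0pi R by move=> t [].
have fD : (leb (itv0pi R `\` itvcc al be) < +oo)%E by exact: fin_measure_subset fT sD.
have i1 : \int[leb]_(t in itvcc al be) (Q + eta%:P).[cos t] <= (1 + 2 * eta) * (be - al).
  rewrite -fine_lebesgue_itvcc// -rint_cst//; apply: rint_le => //; [exact: bmf_sub hb|exact: bmf_cst|].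
  by move=> t _; apply: (le_trans (fup t)); rewrite lerD2r.
have i2 : \int[leb]_(t in itv0pi R `\` itvcc al be) (Q + eta%:P).[cos t] <= 2 * eta * pi.
  apply: (@le_trans _ _ (2 * eta * fine (leb (itv0pi R `\` itvcc al be)))).
    rewrite -rint_cst//; apply: rint_le => //; [exact: bmf_sub hb|exact: bmf_cst|].
    move=> t [tp nt]; apply: (le_trans (fup t)); rewrite phiout ?add0r//.
    have tpi : t \in `[0, pi] by [].
    move: nt; rewrite /itvcc/= in_itv/= => /negP; rewrite negb_and -!ltNge => /orP[h|h]; [right|left].
      by rewrite -cal ltr_cos.
    by rewrite -cbe ltr_cos.
  have pE : pi = fine (leb (itv0pi R)) by rewrite fine_lebesgue_itvcc ?subr0// pi_ge0.
  apply: ler_wpM2l; first by rewrite mulr_ge0// ltW.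
  rewrite [leRHS]pE.
  apply: fine_le; rewrite ?ge0_fin_numE//.
  by apply: le_measure; rewrite ?inE.
have -> : (arcs u v + eps) * pi = acos u - acos v + eps * pi.
  by rewrite mulrDl /arcs divfK// gt_eqF.
have bal : be - al <= pi by lra.
have i3 : 2 * eta * (be - al) <= 2 * eta * pi by rewrite ler_wpM2l// mulr_ge0// ltW.
have e4 : 4 * (eta * pi) = eps * pi / 2 by rewrite /eta; move: pi => q; field.
move: i1 i2 i3 e4; rewrite /e in hal hbe *; lra.
Qed.

Variable mu : {finite_measure set (measurableTypeR R) -> \bar R}.
Variable P : nat -> {poly R}.
Hypothesis hP : orthonormal_polys mu P.
Hypothesis hreg : regular_measure mu.
Local Notation L := (muL mu).
Local Notation K := (diagK P).

(** In the Chebyshev expansion of [f] only the [T_0] term has a trace of order [n], and its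
    coefficient is [chebL f]. *)
Lemma trace_poly (f : {poly R}) (eps : R) : 0 < eps ->
  \forall n \near \oo, `|L (fun x => f.[x] * K n x) - chebL f * n%:R| <= eps * n%:R.
Proof.
move=> eps0.
have [c fE] := poly_basis_expansion (size_chebT R) (leqnn (size f)).
set s := size f in fE.
pose S := \sum_(k < s) `|c k| + 1.
have S0 : 0 < S by rewrite ltr_wpDl// sumr_ge0.
pose e := eps / S; have e0 : 0 < e by rewrite divr_gt0.
have H : \forall n \near \oo, forall k : 'I_s, (0 < k)%N ->
    `|L (fun x => (chebT R k).[x] * K n x)| <= e * n%:R.
  apply: filter_forall => k; case: (posnP k) => k0; first by near=> n; rewrite k0.
  by have := trace_chebT hP hreg k0 e0; apply: filterS => n h _.
near=> n; have hn := near H n; move/(_ _)/wrap: hn => [//|hn].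
have b k : bmf ud (fun x => c k * ((chebT R k).[x] * K n x)).
  by apply: bmfZ; apply: bmfM; [exact: bmf_poly_ud|exact: bmf_diagK].
have -> : L (fun x => f.[x] * K n x) = \sum_(k < s) c k * L (fun x => (chebT R k).[x] * K n x).
  transitivity (L (fun x => \sum_(k < s) c k * ((chebT R k).[x] * K n x))).
    apply: muL_eq => x _; rewrite fE horner_sum mulr_suml; apply: eq_bigr => k _.
    by rewrite hornerZ mulrA.
  rewrite muL_sum//; apply: eq_bigr => k _; rewrite muLZ//.
  by apply: bmfM; [exact: bmf_poly_ud|exact: bmf_diagK].
have -> : chebL f * n%:R = \sum_(k < s) c k * ((k == 0%N :> nat)%:R * n%:R).
  rewrite {1}fE chebL_sum mulr_suml; apply: eq_bigr => k _.
  by rewrite chebLZ chebL_chebT mulrA.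
rewrite -sumrB; apply: (le_trans (ler_norm_sum _ _ _)).
apply: (@le_trans _ _ (\sum_(k < s) `|c k| * (e * n%:R))).
  apply: ler_sum => k _; rewrite -mulrBr normrM ler_wpM2l//.
  case k0 : (k == 0%N :> nat); last by rewrite mul0r subr0 hn// lt0n k0.
  rewrite (eqP k0) mul1r -(muL_diagK hP n).
  rewrite (_ : L (fun x => (chebT R 0).[x] * K n x) = L (K n)).
    by rewrite subrr normr0 mulr_ge0// ?muL_diagK// ltW.
  by apply: muL_eq => x _; rewrite chebT0 hornerC mul1r.
rewrite -mulr_suml mulrA ler_wpM2r// /e mulrCA ler_piMr ?(ltW eps0)//.
by rewrite ler_pdivrMr// mul1r lerDl.
Unshelve. all: by end_near. Qed.

Variables (w : R -> R) (c d Mw : R).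
Hypothesis w_density : ac_density mu w.
Hypotheses (lt_N1c : -1 < c) (lt_d1 : d < 1).
Hypothesis mu_ac : abs_continuous_on mu `[c, d].
Hypothesis wM : forall x, c <= x <= d -> w x <= Mw.

(** Only this upper half of the weak convergence is stated: the diagonal kernel enters the squared
    difference of kernels with a positive sign. *)
Lemma trace_interval u v : c <= u -> u <= v -> v <= d -> forall eps, 0 < eps ->
  \forall n \near \oo, \int[leb]_(x in itvcc u v) (K n x * w x) <= (arcs u v + eps) * n%:R.
Proof.
move=> cu uv vd eps eps0.
have e0 : 0 < eps / 2 by rewrite divr_gt0.
have [f [f0 f1 fL]] := poly_above_interval (lt_le_trans lt_N1c cu) uv (le_lt_trans vd lt_d1) e0.
near=> n.
have := near (trace_poly f e0) n; move=> /(_ _)/wrap[//|].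
rewrite ler_distl => /andP[_ h].
have bK : bmf ud (K n) := bmf_diagK P n.
have K0 x : 0 <= K n x by apply: sumr_ge0 => k _; exact: sqr_ge0.
have bf : bmf ud (fun x => f.[x] * K n x) by apply: bmfM => //; exact: bmf_poly_ud.
have Iud : itvcc u v `<=` ud by exact: (itvcc_ud lt_N1c lt_d1).
apply: (@le_trans _ _ (L (fun x => f.[x] * K n x))).
  apply: (le_trans _ (muL_ge_density w_density lt_N1c lt_d1 mu_ac wM cu vd bf _)).
    have bw := bmf_itvcc_w w_density wM cu vd.
    have bK' : bmf (itvcc u v) (K n) by apply: bmf_sub bK => //; exact: measurable_ud.
    apply: rint_le; [exact: measurable_itv|exact: lebesgue_itvcc_fin|exact: bmfM| |].
      by apply: bmfM => //; apply: bmfM => //; exact: bmf_poly_itvcc.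
    move=> x; rewrite /itvcc/= in_itv/= => hx.
    by rewrite ler_wpM2r ?(w_ge0 w_density)// -[leLHS]mul1r ler_wpM2r// f1.
  move=> x; rewrite /ud/= in_itv/= => /andP[x1 x2].
  by rewrite mulr_ge0// f0// !ltW.
apply: (le_trans h); rewrite -mulrDl ler_wpM2r//; lra.
Unshelve. all: by end_near. Qed.

End ArcsineTrace.

(** * The equilibrium density *)

Lemma continuous_within_bmf (R : realType) (a b : R) (f : R -> R) :
  {within `[a, b], continuous f} -> bmf (itvcc a b) f.
Proof.
move=> cf; split.
  by apply: subspace_continuous_measurable_fun => //; exact: measurable_itv.
have : compact (f @` `[a, b]%classic).
  by apply: continuous_compact => //; exact: segment_compact.
move=> /compact_bounded[M [_ hM]]; exists (`|M| + 1) => x xI.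
apply: (hM (`|M| + 1)); first by rewrite (le_lt_trans (ler_norm _))// ltrDl.
by exists x.
Qed.

Section Arcsine.
Variable R : realType.
Implicit Types (x t u v : R).
Local Notation leb := (@lebesgue_measure R).

(* Density of the arcsine law, the equilibrium measure of [-1, 1]. *)
Definition om x : R := (pi * Num.sqrt (1 - x ^+ 2))^-1.

Lemma open_unit_sqr x : -1 < x -> x < 1 -> x ^+ 2 < 1.
Proof.
move=> x1 x2; rewrite -subr_gt0 (_ : 1 - x ^+ 2 = (1 - x) * (1 + x)); last by ring.
by apply: mulr_gt0; lra.
Qed.

Lemma continuous_om x : -1 < x -> x < 1 -> {for x, continuous om}.
Proof.
move=> x1 x2; have h : 0 < 1 - x ^+ 2 by rewrite subr_gt0 open_unit_sqr.
apply: (@continuousV _ _ (fun x => pi * Num.sqrt (1 - x ^+ 2))).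
  by rewrite mulf_neq0 ?gt_eqF ?pi_gt0 ?sqrtr_gt0.
apply: cvgM; first exact: cvg_cst.
apply: (@continuous_comp _ _ _ (fun x : R => 1 - x ^+ 2) Num.sqrt); last exact: sqrt_continuous.
apply: cvgB; first exact: cvg_cst.
exact: exprn_continuous.
Qed.

Lemma within_continuous_om_poly u v (Q : {poly R}) : -1 < u -> v < 1 ->
  {within `[u, v], continuous (fun x => om x * Q.[x])}.
Proof.
move=> u1 v1; apply: continuous_in_subspaceT => x; rewrite inE /= in_itv/= => /andP[ux xv].
apply: cvgM; last exact: continuous_horner.
by apply: continuous_om; [exact: lt_le_trans ux|exact: le_lt_trans v1].
Qed.

Lemma bmf_om u v : -1 < u -> v < 1 -> bmf (itvcc u v) om.
Proof.
move=> u1 v1; apply: continuous_within_bmf.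
apply: continuous_in_subspaceT => x; rewrite inE /= in_itv/= => /andP[ux xv].
by apply: continuous_om; [exact: lt_le_trans ux|exact: le_lt_trans v1].
Qed.

Lemma om_ge x : -1 < x -> x < 1 -> pi^-1 <= om x.
Proof.
move=> x1 x2; have h : 0 < 1 - x ^+ 2 by rewrite subr_gt0 open_unit_sqr.
have p0 := pi_gt0 R.
rewrite lef_pV2 ?posrE ?mulr_gt0 ?sqrtr_gt0// -[leRHS]mulr1 ler_wpM2l ?(ltW p0)//.
by rewrite -[leRHS]sqrtr1 ler_wsqrtr// gerBl sqr_ge0.
Qed.

Lemma om_gt0 x : -1 < x -> x < 1 -> 0 < om x.
Proof. by move=> x1 x2; apply: lt_le_trans (om_ge x1 x2); rewrite invr_gt0 pi_gt0. Qed.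

Lemma rint_om_poly u v (Q : {poly R}) : -1 < u -> u <= v -> v < 1 ->
  \int[leb]_(x in itvcc u v) (om x * Q.[x]) =
  pi^-1 * \int[leb]_(t in itvcc (acos v) (acos u)) Q.[cos t].
Proof.
move=> u1 uv v1.
have uI : -1 <= u <= 1 by rewrite (ltW u1) (ltW (le_lt_trans uv v1)).
have vI : -1 <= v <= 1 by rewrite (ltW v1) (ltW (lt_le_trans u1 uv)).
have cu : cos (acos u) = u by rewrite acosK// in_itv.
have cv : cos (acos v) = v by rewrite acosK// in_itv.
have aub : acos u \in `[0, pi] by rewrite in_itv/= acos_ge0// acos_lepi.
have avb : acos v \in `[0, pi] by rewrite in_itv/= acos_ge0// acos_lepi.
have avu : acos v <= acos u.
  by rewrite leNgt; apply/negP => h; have := ltr_cos aub avb; rewrite h cu cv; lra.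
have := @rint_cos_subst R 0 1 (acos v) (acos u) (fun x => om x * Q.[x]) ltr01
  (acos_ge0 vI) avu (acos_lepi uI).
rewrite !add0r !mul1r cu cv => -> //; last exact: within_continuous_om_poly.
have b : bmf (itvcc (acos v) (acos u)) (fun t => Q.[cos t]).
  apply: bmf_sub (bmf_hcos Q); last exact: measurable_itv.
  move=> t; rewrite /itvcc /itv0pi/= !in_itv/= => /andP[t1 t2].
  by rewrite (le_trans (acos_ge0 vI) t1) (le_trans t2 (acos_lepi uI)).
rewrite -rintZ//; [|exact: measurable_itv|exact: lebesgue_itvcc_fin].
apply: rint_eq => t; rewrite /itvcc/= in_itv/= => /andP[t1 t2].
rewrite add0r mul1r mul1r.
have st : 0 < sin t.
  apply: sin_gt0_pi; rewrite (lt_le_trans _ t1) ?acos_gt0 ?v1 ?(andP vI).1//=.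
  by rewrite (le_lt_trans t2)// acos_ltpi// u1 (andP uI).2.
rewrite /om -sin2cos2 sqrtr_sqr gtr0_norm// invfM.
have sn : sin t != 0 by rewrite gt_eqF.
by move: (Q.[cos t]) (sin t) sn (pi^-1) => q s sn p; field.
Qed.

Lemma rint_om u v : -1 < u -> u <= v -> v < 1 ->
  \int[leb]_(x in itvcc u v) om x = arcs u v.
Proof.
move=> u1 uv v1.
have uI : -1 <= u <= 1 by rewrite (ltW u1) (ltW (le_lt_trans uv v1)).
have vI : -1 <= v <= 1 by rewrite (ltW v1) (ltW (lt_le_trans u1 uv)).
have cu : cos (acos u) = u by rewrite acosK// in_itv.
have cv : cos (acos v) = v by rewrite acosK// in_itv.
have aub : acos u \in `[0, pi] by rewrite in_itv/= acos_ge0// acos_lepi.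
have avb : acos v \in `[0, pi] by rewrite in_itv/= acos_ge0// acos_lepi.
have avu : acos v <= acos u.
  by rewrite leNgt; apply/negP => h; have := ltr_cos aub avb; rewrite h cu cv; lra.
transitivity (\int[leb]_(x in itvcc u v) (om x * (1 : {poly R}).[x])).
  by apply: rint_eq => x _; rewrite hornerC mulr1.
rewrite rint_om_poly// /arcs mulrC; congr (_ / _).
transitivity (\int[leb]_(t in itvcc (acos v) (acos u)) (1 : R)).
  by apply: rint_eq => x _; rewrite hornerC.
by rewrite rint_cst ?mul1r ?fine_lebesgue_itvcc//; exact: measurable_itv.
Qed.

Lemma rint_om_le_chebL u v (Q : {poly R}) : -1 < u -> u <= v -> v < 1 ->
  (forall x, -1 <= x <= 1 -> 0 <= Q.[x]) ->
  \int[leb]_(x in itvcc u v) (om x * Q.[x]) <= chebL Q.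
Proof.
move=> u1 uv v1 Q0.
have uI : -1 <= u <= 1 by rewrite (ltW u1) (ltW (le_lt_trans uv v1)).
have vI : -1 <= v <= 1 by rewrite (ltW v1) (ltW (lt_le_trans u1 uv)).
rewrite rint_om_poly// /chebL ler_wpM2l ?invr_ge0 ?pi_ge0//.
apply: rint_subset; [exact: measurable_itv|exact: measurable_itv|exact: lebesgue_itvcc_fin| |exact: bmf_hcos|].
  move=> t; rewrite /itvcc /itv0pi/= !in_itv/= => /andP[t1 t2].
  by rewrite (le_trans (acos_ge0 vI) t1) (le_trans t2 (acos_lepi uI)).
by move=> t _; apply: Q0; rewrite cos_geN1 cos_le1.
Qed.

(** Multiplied by [2 sin th], the sum telescopes to a difference of two sines. *)
Lemma cos_sum_bound n (th ph : R) : 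
  `|\sum_(i < n) cos (2 * i%:R * th - ph)| * `|sin th| <= 1.
Proof.
have E : 2 * sin th * \sum_(i < n) cos (2 * i%:R * th - ph) =
    sin (2 * n%:R * th - th - ph) + sin (th + ph).
  elim: n => [|n IH].
    rewrite big_ord0 mulr0 mulr0 mul0r sub0r -opprD sinN addNr//.
  rewrite big_ord_recr/= mulrDr IH -[n.+1%:R]natr1.
  have -> : 2 * n%:R * th - th - ph = (2 * n%:R * th - ph) - th by ring.
  have -> : 2 * (n%:R + 1) * th - th - ph = (2 * n%:R * th - ph) + th by ring.
  set A := 2 * n%:R * th - ph; rewrite [sin (A + th)]sinD [sin (A - th)]sinB; ring.
have := congr1 (fun z => `|z|) E; rewrite normrM normrM normr_nat => e.
rewrite mulrC -(@ler_pM2l _ 2)// mulrA e mulr1.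
by apply: (le_trans (ler_normD _ _)); have := sin_itv (2 * n%:R * th - th - ph); have := sin_itv (th + ph); lra.
Qed.

(** Inverse of the squared norm of [T_a] for the Chebyshev measure: 1 at [a = 0], and 2
    otherwise. *)
Definition chebw (a : nat) : R := 2 - (a == 0%N)%:R.

Lemma chebKE n x t : (0 < n)%N ->
  chebK n x t = \sum_(a < n) chebw a * ((chebT R a).[x] * (chebT R a).[t]).
Proof.
case: n => // n _; rewrite big_ord_recl/= /chebK chebT0 !hornerC /chebw/= addrC.
rewrite (_ : (2 - 1) * (1 * 1) = 1 :> R); last by ring.
congr (_ + _); rewrite big_add1/= big_mkord; apply: eq_bigr => i _.
by rewrite /bump/= subr0.
Qed.

(** Writing [2 cos^2 = 1 + cos] of the double angle splits the diagonal into [n] and a bounded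
    Dirichlet sum. *)
Lemma chebK_diag n x (dl : R) : (0 < n)%N -> 0 < dl -> dl <= 1 - x ^+ 2 ->
  `|chebK n x x - n%:R| <= 1 + dl^-1.
Proof.
move=> n0 d0 dx.
have x2 : x ^+ 2 <= 1 by lra.
have xI : -1 <= x <= 1 by rewrite -ler_norml normr_le_sqr// expr1n.
pose th := acos x; have cx : cos th = x by rewrite acosK// in_itv.
have E : chebK n x x = n%:R - 1 + \sum_(i < n) cos (2 * i%:R * th - 0).
  rewrite chebKE//; transitivity (\sum_(i < n) (1 + cos (2 * i%:R * th - 0) - (i == 0%N :> nat)%:R)).
    apply: eq_bigr => i _; have [h _] := horner_cheb_cos i th; rewrite -cx h /chebw subr0.
    have -> : cos (2 * i%:R * th) = 2 * cos (i%:R * th) ^+ 2 - 1.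
      by rewrite -mulrA [2 * _]mulr_natl cos_mulr2n -[_ *+ 2]mulr_natl.
    case: eqP => [->|_]; rewrite /= ?mulr0n ?mulr1n; last by ring.
    by rewrite mul0r cos0; ring.
  rewrite sumrB big_split/= sumr_const card_ord [X in _ - X = _](_ : _ = 1); first by ring.
  case: n n0 => // n _; rewrite big_ord_recl/= big1 ?addr0// => i _.
have s2 : dl <= `|sin th| ^+ 2 by rewrite -normrX ger0_norm ?sqr_ge0// sin2cos2 cx.
have s1 : `|sin th| <= 1 by exact: sin_itv.
have s3 : dl <= `|sin th|.
  by apply: (le_trans s2); rewrite expr2 ler_piMr.
rewrite E; set S := \sum_(i < n) _.
have hS : `|S| <= dl^-1.
  rewrite -[leRHS]mul1r ler_pdivlMr//.
  by apply: le_trans (cos_sum_bound n th 0); rewrite ler_wpM2l.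
have -> : n%:R - 1 + S - n%:R = S - 1 by ring.
by apply: (le_trans (ler_normB _ _)); rewrite normr1 addrC lerD2l.
Qed.

Definition chebKp n t : {poly R} := \sum_(a < n) (chebw a * (chebT R a).[t]) *: chebT R a.

Lemma horner_chebKp n x t : (0 < n)%N -> (chebKp n t).[x] = chebK n x t.
Proof.
by move=> n0; rewrite chebKE// horner_sum; apply: eq_bigr => a _; rewrite hornerZ; ring.
Qed.

(** Reproducing property of the Chebyshev kernel. *)
Lemma chebL_chebKp_sqr n t : (0 < n)%N -> chebL (chebKp n t ^+ 2) = chebK n t t.
Proof.
move=> n0; rewrite (@chebL_parsevalT R n (fun a => chebw a * (chebT R a).[t])) chebKE// mulr_suml; apply: eq_bigr => a _.
by rewrite /chebw; case: eqP => _; rewrite /= ?mulr0n ?mulr1n; field.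
Qed.

Lemma chebK_sym n x t : chebK n x t = chebK n t x.
Proof. by rewrite /chebK; congr (_ + _); apply: eq_bigr => a _; rewrite [_.[x] * _]mulrC. Qed.

End Arcsine.

Arguments om {R} x.

(** * Pointwise kernel bounds *)

Lemma acos_near (R : realType) (u e : R) : -1 < u -> u < 1 -> 0 < e ->
  exists2 d, 0 < d & forall y, `|u - y| < d -> `|acos u - acos y| < e.
Proof.
move=> u1 u2 e0; have /continuous_acos/cvgrPdist_lt/(_ _ e0) : -1 < u < 1 by rewrite u1.
by rewrite -filter_from_ballE => -[d' /= d'0 hd]; exists d' => // y; exact: hd.
Qed.

Lemma poly_lipschitz (R : realType) (G : {poly R}) : exists2 Lp, 0 <= Lp &
  forall x t, `|x| <= 1 -> `|t| <= 1 -> `|G.[x] - G.[t]| <= Lp * `|x - t|.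
Proof.
elim/poly_ind: G => [|p k [Lp Lp0 h]].
  by exists 0 => // x t _ _; rewrite !horner0 subrr normr0 mul0r.
have [B B0 hB] := horner_bounded p 1.
exists (Lp + B); first by rewrite addr_ge0.
move=> x t x1 t1; rewrite !hornerMXaddC.
have -> : p.[x] * x + k - (p.[t] * t + k) = (p.[x] - p.[t]) * x + p.[t] * (x - t) by ring.
apply: (le_trans (ler_normD _ _)); rewrite !normrM mulrDl lerD//.
  rewrite -[leRHS]mulr1 ler_pM//; exact: h.
by rewrite ler_wpM2r// hB.
Qed.

Section KernelBounds.
Variable R : realType.
Variable mu : {finite_measure set (measurableTypeR R) -> \bar R}.
Variable P : nat -> {poly R}.
Hypothesis hP : orthonormal_polys mu P.
Variables (w : R -> R) (c d m M : R).
Hypothesis w_density : ac_density mu w.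
Hypotheses (lt_N1c : -1 < c) (lt_d1 : d < 1).
Hypothesis mu_ac : abs_continuous_on mu `[c, d].
Hypothesis m0 : 0 < m.
Hypothesis wb : forall x, c <= x <= d -> m <= w x <= M.
Local Notation leb := (@lebesgue_measure R).
Local Notation L := (muL mu).
Local Notation K := (diagK P).

Let wM x : c <= x <= d -> w x <= M. Proof. by case/wb/andP. Qed.
Let wm x : c <= x <= d -> m <= w x. Proof. by case/wb/andP. Qed.
Let w0 x : 0 <= w x. Proof. exact: (w_ge0 w_density). Qed.

Lemma rint_sqr_le_muL (Q : {poly R}) :
  \int[leb]_(x in itvcc c d) Q.[x] ^+ 2 <= m^-1 * L (fun x => Q.[x] ^+ 2).
Proof.
have hQ : bmf ud (fun x => Q.[x] ^+ 2) by apply: bmfX; exact: bmf_poly_ud.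
have H := muL_ge_density w_density lt_N1c lt_d1 mu_ac wM (lexx c) (lexx d) hQ (fun x _ => sqr_ge0 _).
rewrite mulrC ler_pdivlMr// mulrC; apply: le_trans H.
have bw := bmf_w w_density wM.
rewrite -rintZ; [|exact: measurable_itv|exact: lebesgue_itvcc_fin|exact: bmf_poly_itvcc_sqr].
apply: rint_le; [exact: measurable_itv|exact: lebesgue_itvcc_fin| | |].
- by apply: bmfZ; exact: bmf_poly_itvcc_sqr.
- by apply: bmfM => //; exact: bmf_poly_itvcc_sqr.
by move=> x; rewrite /itvcc/= in_itv/= => hx; rewrite mulrC ler_wpM2l ?sqr_ge0// wm.
Qed.

Lemma muL_comb_sqr n (x : 'I_n -> R) :
  L (fun t => (\sum_(i < n) x i *: P i).[t] ^+ 2) = \sum_i x i ^+ 2.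
Proof.
transitivity (L (fun t => (\sum_(i < n) x i * (P i).[t]) * (\sum_(i < n) x i * (P i).[t]) * 1)).
  by apply: muL_eq => t _; rewrite mulr1 -expr2 horner_sum; congr (_ ^+ 2); apply: eq_bigr => i _; rewrite hornerZ.
have -> := @muL_gram R mu 'I_n (fun a => P a) x x (fun=> 1) (bmf_cst _ _).
apply: eq_bigr => a _; rewrite (bigD1 a)//= muL_orth1// eqxx mulr1 big1 ?addr0 ?expr2// => b ba.
by rewrite muL_orth1// eq_sym (_ : (b == a :> nat) = false) ?mulr0//; exact/negbTE.
Qed.

Lemma size_comb n (x : 'I_n -> R) : (size (\sum_(i < n) x i *: P i)%R <= n)%N.
Proof.
apply: (leq_trans (size_sum _ _ _)); apply/bigmax_leqP => a _.
by rewrite (leq_trans (size_scale_leq _ _))// (size_orth hP).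
Qed.

(** Pointwise Bernstein applied to the extremal polynomial [Q]: its [k]-th derivative at [x] and its
    squared norm for [mu] both equal the sum [S], so the inequality reads [S^2 <= const * S]. The
    factor [1/m] converts Lebesgue norms into norms for [mu]. *)
Lemma dK_diag_bound u v : c < u -> v < d -> exists C D : R, [/\ 0 < C, 0 < D &
  forall n k x, u <= x <= v ->
   \sum_(i < n) (P i)^`(k).[x] ^+ 2 <= C * n%:R * ((D * n%:R) ^+ k) ^+ 2].
Proof.
move=> cu vd; have [C [D [C0 D0 h]]] := bernstein_pointwise cu vd.
exists (C / m), D; split => //; first by rewrite divr_gt0.
move=> n k x hx; set S := \sum_(i < n) _.
pose Q := \sum_(i < n) (P i)^`(k).[x] *: P i.
have S0 : 0 <= S by apply: sumr_ge0 => i _; exact: sqr_ge0.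
have [->|Sn] := eqVneq S 0.
  by rewrite mulr_ge0 ?sqr_ge0// mulr_ge0// divr_ge0// ltW.
have Sp : 0 < S by rewrite lt_def Sn.
have := h n k Q x (size_comb _) hx.
have -> : Q^`(k).[x] = S.
  by rewrite /Q linear_sum horner_sum; apply: eq_bigr => i _; rewrite linearZ hornerZ expr2.
move=> H; have H2 := le_trans H (ler_wpM2l _ (rint_sqr_le_muL Q)).
rewrite -(ler_pM2r Sp) -expr2; apply: le_trans (H2 _) _.
  by rewrite mulr_ge0 ?sqr_ge0// mulr_ge0// ltW.
rewrite muL_comb_sqr -/S le_eqVlt; apply/orP; left; apply/eqP; ring.
Qed.

Definition edge : R := (1 - d) * (1 + c).

Lemma edge_gt0 : 0 < edge.
Proof. by move: lt_N1c lt_d1 => h1 h2; apply: mulr_gt0; lra. Qed.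

Lemma edge_le x : c <= x <= d -> edge <= 1 - x ^+ 2.
Proof.
move=> /andP[cx xd]; rewrite (_ : 1 - x ^+ 2 = (1 - x) * (1 + x)); last by ring.
by move: lt_N1c lt_d1 => h1 h2; apply: ler_pM; lra.
Qed.

Lemma chebK_diag_itv n x : (0 < n)%N -> c <= x <= d -> `|chebK n x x - n%:R| <= 1 + edge^-1.
Proof. by move=> n0 hx; apply: chebK_diag => //; [exact: edge_gt0|exact: edge_le]. Qed.

Lemma om_le x : c <= x <= d -> om x <= (pi * Num.sqrt edge)^-1.
Proof.
move=> hx; have e0 := edge_gt0; have e1 := edge_le hx.
have p0 := pi_gt0 R.
rewrite lef_pV2 ?posrE ?mulr_gt0 ?sqrtr_gt0// ?(lt_le_trans e0)//.
by rewrite ler_wpM2l ?(ltW p0)// ler_wsqrtr.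
Qed.

(** Coefficient on [P i] of [chebK n x] in [L^2(mu)], as a polynomial in [x]. *)
Definition rhoP n i : {poly R} :=
  \sum_(a < n) (chebw R a * L (fun t => (chebT R a).[t] * (P i).[t])) *: chebT R a.

Lemma size_rhoP n i : (size (rhoP n i) <= n)%N.
Proof.
apply: (leq_trans (size_sum _ _ _)); apply/bigmax_leqP => a _.
by rewrite (leq_trans (size_scale_leq _ _))// size_chebT.
Qed.

Lemma chebT_orth_expansion n a : (a < n)%N ->
  chebT R a = \sum_(i < n) L (fun t => (chebT R a).[t] * (P i).[t]) *: P i.
Proof.
move=> an; have sT : (size (chebT R a) <= n)%N by rewrite size_chebT.
have [co E] := poly_basis_expansion (size_orth hP) sT.
rewrite {1}E; apply: eq_bigr => i _; congr (_ *: _).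
transitivity (L (fun t => \sum_(b < n) co b * ((P b).[t] * (P i).[t]))); last first.
  apply: muL_eq => t _; rewrite E horner_sum mulr_suml; apply: eq_bigr => b _.
  by rewrite hornerZ mulrA.
have bb b : bmf ud (fun t => (P b).[t] * (P i).[t]) by apply: bmfM; exact: bmf_poly_ud.
rewrite muL_sum; last by move=> b; apply: bmfZ; exact: bb.
rewrite (bigD1 i)//= big1 ?addr0 => [|b bi].
  by rewrite muLZ// (muL_orth hP) eqxx mulr1.
by rewrite muLZ// (muL_orth hP) (_ : (b == i :> nat) = false) ?mulr0//; exact/negbTE.
Qed.

(** For [a < n] each [T_a] lies in the span of [P_0, ..., P_(n-1)], so the expansion is exact and
    may be differentiated in each variable. *)
Lemma chebK_orth_expansion n j k x y :
  \sum_(i < n) (rhoP n i)^`(j).[x] * (P i)^`(k).[y] =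
  \sum_(a < n) chebw R a * ((chebT R a)^`(j).[x] * (chebT R a)^`(k).[y]).
Proof.
transitivity (\sum_(i < n) \sum_(a < n) chebw R a * (chebT R a)^`(j).[x] *
    (L (fun t => (chebT R a).[t] * (P i).[t]) * (P i)^`(k).[y])).
  apply: eq_bigr => i _; rewrite /rhoP linear_sum horner_sum mulr_suml.
  by apply: eq_bigr => a _; rewrite linearZ hornerZ; ring.
rewrite exchange_big; apply: eq_bigr => a _ /=; rewrite -mulr_sumr mulrA; congr (_ * _).
rewrite {2}(chebT_orth_expansion (ltn_ord a)) linear_sum horner_sum; apply: eq_bigr => i _.
by rewrite linearZ hornerZ.
Qed.

Lemma rhoP_sqr_sum n x : (0 < n)%N ->
  \sum_(i < n) (rhoP n i).[x] ^+ 2 = L (fun t => chebK n x t ^+ 2).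
Proof.
move=> n0; rewrite -(muL_comb_sqr (fun i : 'I_n => (rhoP n i).[x])); apply: muL_eq => t _.
congr (_ ^+ 2); rewrite horner_sum chebKE//.
rewrite -(chebK_orth_expansion n 0 0 x t); apply: eq_bigr => i _.
by rewrite hornerZ !derivn0.
Qed.

Lemma chebK_rhoP n x : (0 < n)%N ->
  chebK n x x = \sum_(i < n) (rhoP n i).[x] * (P i).[x].
Proof.
move=> n0; rewrite chebKE// -(chebK_orth_expansion n 0 0 x x).
by apply: eq_bigr => i _; rewrite !derivn0.
Qed.

Lemma ud_norm (x : R) : ud x -> `|x| <= 1.
Proof. by rewrite /ud/= in_itv/= => /andP[x1 x2]; rewrite ler_norml !ltW. Qed.

Lemma chebK_off n (x t dl : R) : (0 < n)%N -> `|x| <= 1 -> `|t| <= 1 -> 0 < dl -> dl <= `|x - t| ->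
  chebK n x t ^+ 2 <= 4 / dl ^+ 2.
Proof.
move=> n0 x1 t1 d0 dxt.
have x2 : x ^+ 2 <= 1 by rewrite -[leRHS](expr1n _ 2) -normr_le_sqr.
have t2 : t ^+ 2 <= 1 by rewrite -[leRHS](expr1n _ 2) -normr_le_sqr.
have := chebK_bound n0 x2 t2.
have : dl * `|chebK n x t| <= `|x - t| * `|chebK n x t| by rewrite ler_wpM2r.
move=> h1 /(le_trans h1) h.
rewrite ler_pdivlMr ?exprn_gt0// -exprMn -(_ : 2 ^+ 2 = 4 :> R); last by ring.
by rewrite -normr_le_sqr// normrM (gtr0_norm d0) mulrC.
Qed.

Lemma bmf_chebK_ud n (x : R) : (0 < n)%N -> bmf ud (fun t => chebK n x t).
Proof.
move=> n0; apply: (@bmf_ext _ _ (horner (chebKp n x))); last exact: bmf_poly_ud.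
  by move=> t _; rewrite horner_chebKp// chebK_sym.
exact: measurable_ud.
Qed.

(** Cauchy-Schwarz between the coefficients of the two kernels: [chebK n x x ^ 2] is at most the
    squared norm of [chebK n x] in [L^2(mu)] times [K n x]. The left side is at least [(n/2)^2]; the
    norm is at most [A n], since [w <= M <= pi M om] on [[c, d]] and the kernel is bounded off
    it. *)
Lemma diagK_lower u v : c < u -> v < d -> exists2 k0 : R, 0 < k0 &
  \forall n \near \oo, forall x, u <= x <= v -> k0 * n%:R <= K n x.
Proof.
move=> cu vd.
have h1N := lt_N1c; have hd1 := lt_d1.
pose C1 := 1 + edge^-1.
have e0 := edge_gt0.
have C10 : 0 < C1 by rewrite addr_gt0// invr_gt0.
pose dl := Num.min (u - c) (d - v).
have dl0 : 0 < dl by rewrite lt_min !subr_gt0 cu vd.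
have dl1 : dl <= u - c by rewrite ge_min lexx.
have dl2 : dl <= d - v by rewrite ge_min lexx orbT.
pose C2 := 4 / dl ^+ 2 * fine (mu ud).
have C20 : 0 <= C2.
  by rewrite mulr_ge0 ?divr_ge0 ?sqr_ge0// fine_ge0.
(* A point of [[u, v]] provides the sign of [M]; for an empty interval nothing is claimed. *)
have M0 : 0 <= M \/ forall x, ~ (u <= x <= v).
  have [[x hx]|nx] := pselect (exists x, u <= x <= v); last by right => x hx; apply: nx; exists x.
  left; have /wb/andP[h1 h2] : c <= x <= d.
    by move/andP: hx => [? ?]; apply/andP; split; lra.
  by apply: le_trans (le_trans h1 h2); exact: ltW.
case: M0 => [M0|nx]; last by exists 1 => //; near=> n => x /nx.
pose A := pi * M * 2 + C2 + 1.
have p0 := pi_gt0 R.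
have A0 : 0 < A.
  by rewrite ltr_wpDl// addr_ge0// mulr_ge0// mulr_ge0// ltW.
exists (A^-1 / 4); first by rewrite divr_gt0// invr_gt0.
pose n0 := (Num.truncn (2 * C1)).+1.
near=> n => x hx.
have n1 : (0 < n)%N by near: n; exact: nbhs_infty_gt.
have nR1 : 1 <= n%:R :> R by rewrite ler1n.
have nC : 2 * C1 <= n%:R.
  apply: ltW; apply: (lt_le_trans (truncnS_gt _)); rewrite ler_nat; near: n; exact: nbhs_infty_ge.
have cxd : c <= x <= d by move/andP: hx => [? ?]; apply/andP; split; lra.
have x1 : `|x| <= 1 by rewrite ler_norml; move/andP: cxd => [? ?]; apply/andP; split; lra.
have := chebK_diag_itv n1 cxd; rewrite -/C1 ler_distl => /andP[X1 X2].
set X := chebK n x x in X1 X2.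
have L2 : L (fun t => chebK n x t ^+ 2) <= A * n%:R.
  have hb : bmf ud (fun t => chebK n x t ^+ 2) by apply: bmfX; exact: bmf_chebK_ud.
  have off t : ud t -> ~ (c <= t <= d) -> chebK n x t ^+ 2 <= 4 / dl ^+ 2.
    move=> ut nt; apply: chebK_off => //; first exact: ud_norm.
    move/andP: hx => [ux xv]; have [tc|tc] := ltP t c.
      by rewrite ger0_norm; lra.
    have td : d < t by rewrite ltNge; apply/negP => td; apply: nt; rewrite tc td.
    by rewrite ler0_norm; lra.
  have B0 : 0 <= 4 / dl ^+ 2 by rewrite divr_ge0// sqr_ge0.
  apply: (le_trans (muL_le_density w_density lt_N1c lt_d1 mu_ac wM (lexx c) (lexx d) hb B0 (fun t _ => sqr_ge0 _) off)).
  rewrite -/C2.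
  have I1 : \int[leb]_(t in itvcc c d) (chebK n x t ^+ 2 * w t) <= pi * M * X.
    have cd : c <= d by move/andP: cxd => [? ?]; lra.
    have bo := bmf_om lt_N1c lt_d1.
    have bq : bmf (itvcc c d) (horner (chebKp n x ^+ 2)) by exact: bmf_poly_itvcc.
    apply: (@le_trans _ _ (\int[leb]_(t in itvcc c d) (pi * M * (om t * (chebKp n x ^+ 2).[t])))).
      apply: rint_le; [exact: measurable_itv|exact: lebesgue_itvcc_fin| | |].
      - apply: bmfM; last exact: (bmf_w w_density wM).
        apply: bmf_sub hb; last exact: measurable_ud.
        exact: (itvcc_ud lt_N1c lt_d1).
      - by apply: bmfZ; exact: bmfM.
      move=> t; rewrite /itvcc/= in_itv/= => ht.
      rewrite horner_exp horner_chebKp// chebK_sym mulrA mulrC ler_wpM2r ?sqr_ge0//.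
      have t1 : -1 < t by move/andP: ht => [? ?]; lra.
      have t2 : t < 1 by move/andP: ht => [? ?]; lra.
      apply: (le_trans (wM ht)); rewrite mulrAC -[leLHS]mul1r ler_wpM2r//.
      by rewrite mulrC -ler_pdivrMr// mul1r om_ge.
    rewrite rintZ; [|exact: measurable_itv|exact: lebesgue_itvcc_fin|exact: bmfM].
    rewrite ler_wpM2l ?mulr_ge0 ?(ltW p0)// /X -chebL_chebKp_sqr//.
    by apply: rint_om_le_chebL => // y _; rewrite horner_exp sqr_ge0.
  have X3 : X <= 2 * n%:R by lra.
  apply: (@le_trans _ _ (pi * M * (2 * n%:R) + C2 * n%:R)).
    rewrite lerD//; last by rewrite ler_peMr.
    by apply: (le_trans I1); rewrite ler_wpM2l ?mulr_ge0 ?(ltW p0).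
  by rewrite /A; move: (pi * M) => q; have : 0 <= n%:R :> R by []; lra.
have CS := sum_mul_CS (fun i : 'I_n => (rhoP n i).[x]) (fun i : 'I_n => (P i).[x]).
move: CS; rewrite -chebK_rhoP// rhoP_sqr_sum// -/X -/(K n x) => CS.
have K0 : 0 <= K n x by apply: sumr_ge0 => k _; exact: sqr_ge0.
have CS2 : (n%:R / 2) ^+ 2 <= A * n%:R * K n x.
  apply: (@le_trans _ _ (X ^+ 2)); last by apply: (le_trans CS); rewrite ler_wpM2r.
  by rewrite lerXn2r ?nnegrE ?divr_ge0//; lra.
have nR : 0 < n%:R :> R by exact: lt_le_trans ltr01 nR1.
rewrite -(ler_pM2l (mulr_gt0 A0 nR)); apply: le_trans CS2.
rewrite le_eqVlt; apply/orP; left; apply/eqP; field; exact/lt0r_neq0.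
Unshelve. all: by end_near. Qed.

End KernelBounds.

(** * Comparison with the Chebyshev kernel in L2 *)

Lemma dist_enlarged (R : realDomainType) (u v dl x t : R) : u <= x -> x <= v -> 0 < dl ->
  t < u - dl \/ v + dl < t -> dl <= `|x - t|.
Proof. by move=> ux xv d0 [h|h]; [rewrite ger0_norm|rewrite ler0_norm]; lra. Qed.

Section L2Comparison.
Variable R : realType.
Variable mu : {finite_measure set (measurableTypeR R) -> \bar R}.
Variable P : nat -> {poly R}.
Hypothesis hP : orthonormal_polys mu P.
Hypothesis hreg : regular_measure mu.
Variables (w : R -> R) (c d m M : R).
Hypothesis w_density : ac_density mu w.
Hypotheses (lt_N1c : -1 < c) (lt_d1 : d < 1).
Hypothesis mu_ac : abs_continuous_on mu `[c, d].
Hypothesis m0 : 0 < m.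
Hypothesis wb : forall x, c <= x <= d -> m <= w x <= M.
Local Notation leb := (@lebesgue_measure R).
Local Notation L := (muL mu).
Local Notation K := (diagK P).
Local Notation C1 := (1 + (edge c d)^-1).

Let wM x : c <= x <= d -> w x <= M. Proof. by case/wb/andP. Qed.
Let wm x : c <= x <= d -> m <= w x. Proof. by case/wb/andP. Qed.
Let w0 x : 0 <= w x. Proof. exact: (w_ge0 w_density). Qed.

(* [dP G n i] is the i-th coefficient, in the orthonormal basis, of the polynomial
   [t |-> K_n(x, t) - G(x) chebK_n(x, t)], as a polynomial in [x]. *)
Definition dP (G : {poly R}) n i : {poly R} := P i - G * rhoP mu P n i.

Lemma dP_sqr_sum G n x : (0 < n)%N ->
  \sum_(i < n) (dP G n i).[x] ^+ 2 =
  K n x - 2 * G.[x] * chebK n x x + G.[x] ^+ 2 * L (fun t => chebK n x t ^+ 2).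
Proof.
move=> n0; rewrite -(rhoP_sqr_sum hP)// (chebK_rhoP hP)// /diagK !mulr_sumr -sumrB -big_split/=.
by apply: eq_bigr => i _; rewrite /dP hornerD hornerN hornerM; ring.
Qed.

(** The [x]-integral of the quadratic term of the squared difference. Expanded with the coefficients
    [chebcoef], it is a polynomial in [t], and exchanging it with the integral in [t] is a matter of
    finite sums. *)
Definition chebB (G : {poly R}) n u v t : R :=
  \int[leb]_(x in itvcc u v) (om x * G.[x] * chebK n x t ^+ 2).

Definition chebcoef (G : {poly R}) u v a b : R :=
  \int[leb]_(x in itvcc u v) (om x * G.[x] * (chebw R a * (chebT R a).[x] * (chebw R b * (chebT R b).[x]))).

Section Itv.
Variables (u v : R).
Hypotheses (cu : c < u) (uv : u <= v) (vd : v < d).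
Let mI : measurable (itvcc u v). Proof. exact: measurable_itv. Qed.
Let fI : (leb (itvcc u v) < +oo)%E. Proof. exact: lebesgue_itvcc_fin. Qed.
Let u1 : -1 < u. Proof. exact: lt_trans cu. Qed.
Let v1 : v < 1. Proof. exact: lt_trans lt_d1. Qed.
Let bo : bmf (itvcc u v) om. Proof. exact: bmf_om. Qed.
Let bp (Q : {poly R}) : bmf (itvcc u v) (horner Q). Proof. exact: bmf_poly_itvcc. Qed.

Lemma chebBE G n t : (0 < n)%N -> chebB G n u v t =
  \sum_(a < n) \sum_(b < n) chebcoef G u v a b * ((chebT R a).[t] * (chebT R b).[t]).
Proof.
move=> n0.
have bb a b : bmf (itvcc u v) (fun x => om x * G.[x] *
    (chebw R a * (chebT R a).[x] * (chebw R b * (chebT R b).[x]))).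
  by apply: bmfM; [exact: bmfM|apply: bmfM; exact: bmfZ].
have bb2 a b : bmf (itvcc u v) (fun x => ((chebT R a).[t] * (chebT R b).[t]) * (om x * G.[x] *
    (chebw R a * (chebT R a).[x] * (chebw R b * (chebT R b).[x])))).
  by apply: bmfZ; exact: bb.
transitivity (\int[leb]_(x in itvcc u v) (\sum_(a < n) \sum_(b < n) ((chebT R a).[t] * (chebT R b).[t]) *
  (om x * G.[x] * (chebw R a * (chebT R a).[x] * (chebw R b * (chebT R b).[x]))))).
  apply: rint_eq => x _; rewrite chebKE// expr2 big_distrlr/= mulr_sumr.
  by apply: eq_bigr => a _; rewrite mulr_sumr; apply: eq_bigr => b _; ring.
rewrite rint_sum//; last by move=> a; exact: bmf_sum.
apply: eq_bigr => a _; rewrite rint_sum//.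
by apply: eq_bigr => b _; rewrite rintZ// mulrC.
Qed.

Lemma chebB_poly G n : (0 < n)%N -> exists Q : {poly R}, forall t, chebB G n u v t = Q.[t].
Proof.
move=> n0; exists (\sum_(a < n) \sum_(b < n) chebcoef G u v a b *: (chebT R a * chebT R b)) => t.
rewrite chebBE// horner_sum; apply: eq_bigr => a _; rewrite horner_sum.
by apply: eq_bigr => b _; rewrite hornerZ hornerM.
Qed.

Lemma chebK_sqr_expand n x : (0 < n)%N -> L (fun t => chebK n x t ^+ 2) =
  \sum_(a < n) \sum_(b < n) (chebw R a * (chebT R a).[x] * (chebw R b * (chebT R b).[x])) *
    L (fun t => (chebT R a).[t] * (chebT R b).[t]).
Proof.
move=> n0.
have bb a b : bmf ud (fun t => (chebT R a).[t] * (chebT R b).[t]).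
  by apply: bmfM; exact: bmf_poly_ud.
transitivity (L (fun t => \sum_(a < n) \sum_(b < n) (chebw R a * (chebT R a).[x] * (chebw R b * (chebT R b).[x])) *
    ((chebT R a).[t] * (chebT R b).[t]))).
  apply: muL_eq => t _; rewrite chebKE// expr2 big_distrlr/=.
  by apply: eq_bigr => a _; apply: eq_bigr => b _; ring.
rewrite muL_sum; last by move=> a; apply: bmf_sum => b; exact: bmfZ.
apply: eq_bigr => a _; rewrite muL_sum; last by move=> b; exact: bmfZ.
by apply: eq_bigr => b _; rewrite muLZ.
Qed.

Lemma bmf_L_chebK n : (0 < n)%N -> bmf (itvcc u v) (fun x => L (fun t => chebK n x t ^+ 2)).
Proof.
move=> n0; under eq_fun do rewrite chebK_sqr_expand//.
apply: bmf_sum => a; apply: bmf_sum => b.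
apply: bmfM; last exact: bmf_cst.
by apply: bmfM; exact: bmfZ.
Qed.

Lemma chebB_swap G n : (0 < n)%N ->
  \int[leb]_(x in itvcc u v) (om x * G.[x] * L (fun t => chebK n x t ^+ 2)) = L (chebB G n u v).
Proof.
move=> n0.
have bb a b : bmf ud (fun t => (chebT R a).[t] * (chebT R b).[t]).
  by apply: bmfM; exact: bmf_poly_ud.
have bc a b : bmf (itvcc u v) (fun x => om x * G.[x] *
    (chebw R a * (chebT R a).[x] * (chebw R b * (chebT R b).[x]))).
  by apply: bmfM; [exact: bmfM|apply: bmfM; exact: bmfZ].
have -> : L (chebB G n u v) = \sum_(a < n) \sum_(b < n) chebcoef G u v a b * L (fun t => (chebT R a).[t] * (chebT R b).[t]).
  transitivity (L (fun t => \sum_(a < n) \sum_(b < n) chebcoef G u v a b * ((chebT R a).[t] * (chebT R b).[t]))).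
    by apply: muL_eq => t _; rewrite chebBE.
  rewrite muL_sum; last by move=> a; apply: bmf_sum => b; exact: bmfZ.
  apply: eq_bigr => a _; rewrite muL_sum; last by move=> b; exact: bmfZ.
  by apply: eq_bigr => b _; rewrite muLZ.
transitivity (\int[leb]_(x in itvcc u v) (\sum_(a < n) \sum_(b < n) L (fun t => (chebT R a).[t] * (chebT R b).[t]) *
  (om x * G.[x] * (chebw R a * (chebT R a).[x] * (chebw R b * (chebT R b).[x]))))).
  apply: rint_eq => x _; rewrite chebK_sqr_expand// mulr_sumr.
  by apply: eq_bigr => a _; rewrite mulr_sumr; apply: eq_bigr => b _; ring.
have bc2 a b : bmf (itvcc u v) (fun x => L (fun t => (chebT R a).[t] * (chebT R b).[t]) * (om x * G.[x] *
    (chebw R a * (chebT R a).[x] * (chebw R b * (chebT R b).[x])))).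
  by apply: bmfZ; exact: bc.
rewrite rint_sum//; last by move=> a; exact: bmf_sum.
apply: eq_bigr => a _; rewrite rint_sum//.
by apply: eq_bigr => b _; rewrite rintZ// mulrC.
Qed.

Let inI x : itvcc u v x -> c <= x <= d.
Proof. by rewrite /itvcc/= in_itv/= => /andP[ux xv]; rewrite (le_trans (ltW cu) ux) (le_trans xv (ltW vd)). Qed.

Let om0 x : itvcc u v x -> 0 <= om x.
Proof.
move=> /inI /andP[cx xd]; apply: ltW; apply: om_gt0.
  exact: lt_le_trans cx.
exact: le_lt_trans lt_d1.
Qed.

Lemma arcs_le1 : arcs u v <= 1.
Proof.
rewrite /arcs ler_pdivrMr ?pi_gt0// mul1r lerBlDr.
have uI : -1 <= u <= 1 by rewrite (ltW u1) (ltW (le_lt_trans uv v1)).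
have vI : -1 <= v <= 1 by rewrite (ltW v1) (ltW (lt_le_trans u1 uv)).
by rewrite -[leLHS]addr0 lerD ?acos_lepi ?acos_ge0.
Qed.

Lemma bmf_chebK_itv n t : (0 < n)%N -> bmf (itvcc u v) (fun x => chebK n x t).
Proof.
move=> n0; apply: (@bmf_ext _ _ (horner (chebKp n t))); last exact: bp.
  by move=> x _; rewrite horner_chebKp.
exact: mI.
Qed.

Lemma rint_om_chebK_sqr n t : (0 < n)%N -> c <= t <= d ->
  \int[leb]_(x in itvcc u v) (om x * chebK n x t ^+ 2) <= n%:R + C1.
Proof.
move=> n0 ht.
have -> : \int[leb]_(x in itvcc u v) (om x * chebK n x t ^+ 2) =
   \int[leb]_(x in itvcc u v) (om x * (chebKp n t ^+ 2).[x]).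
  by apply: rint_eq => x _; rewrite horner_exp horner_chebKp.
apply: (le_trans (rint_om_le_chebL u1 uv v1 _)).
  by move=> x _; rewrite horner_exp sqr_ge0.
rewrite chebL_chebKp_sqr//.
by have := chebK_diag_itv lt_N1c lt_d1 n0 ht; rewrite ler_distl => /andP[].
Qed.

(** Replacing [G(x)] by [G(t)] costs [Lp |x - t| k^2] for the kernel value [k]. The off-diagonal
    decay reduces this to [2 Lp |k|], and [2 |k| <= k^2 / s + s] makes it a [1/s] fraction of the
    main term. *)
Lemma chebB_near (G : {poly R}) Lp (s : R) n t : (0 < n)%N -> c <= t <= d -> 0 < s -> 0 <= Lp ->
  (forall x t, `|x| <= 1 -> `|t| <= 1 -> `|G.[x] - G.[t]| <= Lp * `|x - t|) ->
  0 <= G.[t] ->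
  chebB G n u v t <= (G.[t] + Lp / s) * (n%:R + C1) + Lp * s.
Proof.
move=> n0 ht s0 Lp0 hLp Gt.
have bK := bmf_chebK_itv t n0.
have in1 x : c <= x <= d -> `|x| <= 1.
  have h1 := lt_N1c; have h2 := lt_d1.
  by move=> /andP[? ?]; rewrite ler_norml; apply/andP; split; lra.
apply: (@le_trans _ _ (\int[leb]_(x in itvcc u v) ((G.[t] + Lp / s) * (om x * chebK n x t ^+ 2) + Lp * s * om x))).
  apply: rint_le => //.
  - by apply: bmfM; [exact: bmfM|exact: bmfX].
  - by apply: bmfD; [apply: bmfZ; apply: bmfM => //; exact: bmfX|exact: bmfZ].
  move=> x xI; have hx := inI xI; have o0 := om0 xI.
  have x1 := in1 x hx; have t1 := in1 t ht.
  have x2 : x ^+ 2 <= 1 by rewrite -[leRHS](expr1n _ 2) -normr_le_sqr.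
  have t2 : t ^+ 2 <= 1 by rewrite -[leRHS](expr1n _ 2) -normr_le_sqr.
  set k := chebK n x t.
  have q0 : 0 <= `|k| by [].
  have kk : k ^+ 2 = `|k| ^+ 2 by rewrite -normrX ger0_norm// sqr_ge0.
  have h1 : `|x - t| * k ^+ 2 <= 2 * `|k|.
    rewrite kk expr2 mulrA ler_wpM2r//; exact: chebK_bound.
  have h2 : 2 * `|k| <= k ^+ 2 / s + s.
    have : 0 <= (`|k| - s) ^+ 2 / s by rewrite divr_ge0 ?sqr_ge0// ltW.
    rewrite kk (_ : (`|k| - s) ^+ 2 / s = `|k| ^+ 2 / s + s - 2 * `|k|) ?subr_ge0//.
    by field; rewrite gt_eqF.
  have h3 : G.[x] <= G.[t] + Lp * `|x - t|.
    by have := hLp x t x1 t1; rewrite ler_distl => /andP[_].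
  have k20 : 0 <= k ^+ 2 by exact: sqr_ge0.
  have h4 : G.[x] * k ^+ 2 <= G.[t] * k ^+ 2 + Lp * (k ^+ 2 / s + s).
    apply: (@le_trans _ _ ((G.[t] + Lp * `|x - t|) * k ^+ 2)); first by rewrite ler_wpM2r.
    rewrite mulrDl lerD2l -mulrA ler_wpM2l//; exact: le_trans h2.
  have -> : (G.[t] + Lp / s) * (om x * k ^+ 2) + Lp * s * om x =
     om x * (G.[t] * k ^+ 2 + Lp * (k ^+ 2 / s + s)) by ring.
  by rewrite -mulrA ler_wpM2l.
have b2 : bmf (itvcc u v) (fun x => om x * chebK n x t ^+ 2) by apply: bmfM => //; exact: bmfX.
rewrite rintD//; [|exact: bmfZ|exact: bmfZ].
rewrite !rintZ// rint_om//; apply: lerD.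
  by apply: ler_wpM2l; [rewrite addr_ge0// divr_ge0// ltW|exact: rint_om_chebK_sqr].
by rewrite -[leRHS]mulr1 ler_wpM2l ?arcs_le1// mulr_ge0// ltW.
Qed.

Lemma chebB_far (G : {poly R}) G1 (dl : R) n t : (0 < n)%N -> `|t| <= 1 -> 0 < dl -> 0 <= G1 ->
  (forall x, c <= x <= d -> 0 <= G.[x] <= G1) ->
  (forall x, u <= x <= v -> dl <= `|x - t|) ->
  chebB G n u v t <= G1 * (4 / dl ^+ 2).
Proof.
move=> n0 t1 d0 G10 hG hdl.
have bK := bmf_chebK_itv t n0.
have q0 : 0 <= 4 / dl ^+ 2 by rewrite divr_ge0// sqr_ge0.
apply: (@le_trans _ _ (\int[leb]_(x in itvcc u v) (G1 * (4 / dl ^+ 2) * om x))).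
  apply: rint_le => //.
  - by apply: bmfM; [exact: bmfM|exact: bmfX].
  - exact: bmfZ.
  move=> x xI; have hx := inI xI; have o0 := om0 xI.
  have x1 : `|x| <= 1.
    have h1 := lt_N1c; have h2 := lt_d1.
    by move/andP: hx => [? ?]; rewrite ler_norml; apply/andP; split; lra.
  have /andP[g0 g1] := hG x hx.
  rewrite -mulrA mulrC; apply: ler_wpM2r => //; apply: ler_pM => //; first exact: sqr_ge0.
  apply: chebK_off => //; apply: hdl; by move: xI; rewrite /itvcc/= in_itv.
rewrite rintZ// rint_om// -[leRHS]mulr1 ler_wpM2l ?arcs_le1// mulr_ge0//.
Qed.

Lemma chebB_ge0 (G : {poly R}) n t : (forall x, c <= x <= d -> 0 <= G.[x]) -> 0 <= chebB G n u v t.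
Proof.
move=> hG; apply: rint_ge0 => x xI; have hx := inI xI; have o0 := om0 xI.
by rewrite mulr_ge0 ?sqr_ge0// mulr_ge0// hG.
Qed.

(* The limit of [K_n(x, x) / n]. *)
Definition gfun x : R := om x / w x.

Lemma bmf_gfun : bmf (itvcc c d) gfun.
Proof.
apply: bmfM; first exact: bmf_om.
apply: (bmfV m0 (bmf_w w_density wM)) => x; rewrite /itvcc/= in_itv/= => hx.
by rewrite ger0_norm// wm.
Qed.

(** Weighted by [om / G], the sum of squares consists of [om K / G], of [-2 om] times the diagonal
    Chebyshev kernel, and of the quadratic term of [chebB]. As [om / G] is close to [w] in [L^1],
    their integrals are at most [arcs u v * n], [-2 arcs u v * n] and [arcs u v * n], up to small
    multiples of [n], and cancel. *)
Lemma L2_comparison : exists G0 G1 : R, [/\ 0 < G0, 0 < G1 & forall eps, 0 < eps ->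
  exists G : {poly R}, [/\ forall x, c <= x <= d -> G0 <= G.[x] <= G1,
    \int[leb]_(x in itvcc c d) `|G.[x] - gfun x| <= eps &
    \forall n \near \oo,
      \int[leb]_(x in itvcc u v) (\sum_(i < n) (dP G n i).[x] ^+ 2) <= eps * n%:R]].
Proof.
have p0 := pi_gt0 R.
have hN1 := lt_N1c; have hd1 := lt_d1; have hcu := cu; have hvd := vd; have huv := uv.
have cd : c < d by lra.
have M0 : 0 < M.
  have /wb/andP[h1 h2] : c <= c <= d by rewrite lexx ltW.
  exact: lt_le_trans (le_trans h1 h2).
pose O := (pi * Num.sqrt (edge c d))^-1.
have e0 := edge_gt0 lt_N1c lt_d1.
have O0 : 0 < O by rewrite invr_gt0 mulr_gt0// sqrtr_gt0.
(* [g0] and [O / m] bound [gfun]. Polynomial approximation halves the lower bound and adds [g0] to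
   the upper one, which fixes [G0] and [G1] independently of [eps]. *)
pose g0 := (pi * M)^-1; have g00 : 0 < g0 by rewrite invr_gt0 mulr_gt0.
pose G0 := g0 / 2; pose G1 := O / m + g0.
have G00 : 0 < G0 by rewrite divr_gt0.
have Om0 : 0 < O / m by rewrite divr_gt0.
have G10 : 0 < G1 by rewrite addr_gt0.
exists G0, G1; split => // eps eps0.
have in1 x : c <= x <= d -> -1 < x /\ x < 1.
  by move=> /andP[cx xd]; rewrite (lt_le_trans lt_N1c cx) (le_lt_trans xd lt_d1).
have gb x : c <= x <= d -> g0 <= gfun x <= O / m.
  move=> hx; have [x1 x2] := in1 x hx.
  have wx0 : 0 < w x by exact: lt_le_trans (wm hx).
  apply/andP; split.
    rewrite /g0 invfM /gfun; apply: ler_pM; rewrite ?invr_ge0 ?(ltW p0) ?(ltW M0)//.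
      exact: om_ge.
    by rewrite lef_pV2 ?posrE// wM.
  rewrite /gfun; apply: ler_pM.
  - exact: ltW (om_gt0 x1 x2).
  - by rewrite invr_ge0 ltW.
  - exact: (om_le lt_N1c lt_d1 hx).
  - by rewrite lef_pV2 ?posrE// wm.
have [Kc [Kd [Kc0 Kd0 hK]]] := dK_diag_bound hP w_density lt_N1c lt_d1 mu_ac m0 wb cu vd.
have KB n x : u <= x <= v -> K n x <= Kc * n%:R.
  by move=> /(hK n 0%N x); rewrite expr0 expr1n mulr1.
(* Six errors of size [e' n] arise: one from the trace, one from replacing [om / G] by [w], two from
   the mass of the enlarged interval weighted by [G w], one from freezing [G], one from the
   constants. The factor [pi * G1] removes the weight [om / G]. *)
pose e' := eps / (pi * G1) / 6.
have pG0 : 0 < pi * G1 by rewrite mulr_gt0.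
have e'0 : 0 < e' by rewrite divr_gt0// divr_gt0.
pose ea := e' / (Kc * (M / G0) + M + 1).
have MG0 : 0 < M / G0 by rewrite divr_gt0.
have den0 : 0 < Kc * (M / G0) + M + 1 by rewrite !addr_gt0// mulr_gt0.
have ea0 : 0 < ea by rewrite divr_gt0.
pose e1 := Num.min eps ea.
have e10 : 0 < e1 by rewrite lt_min eps0.
have e1a : e1 * (Kc * (M / G0)) <= e'.
  apply: (@le_trans _ _ (ea * (Kc * (M / G0) + M + 1))).
    have KM : 0 < Kc * (M / G0) by rewrite mulr_gt0.
    apply: ler_pM; [exact: ltW|exact: ltW|by rewrite ge_min lexx orbT|].
    by move: KM; lra.
  by rewrite divfK// gt_eqF.
have e1b : e1 * M <= e'.
  apply: (@le_trans _ _ (ea * (Kc * (M / G0) + M + 1))).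
    have KM : 0 < Kc * (M / G0) by rewrite mulr_gt0.
    apply: ler_pM; [exact: ltW|exact: ltW|by rewrite ge_min lexx orbT|].
    by move: KM; lra.
  by rewrite divfK// gt_eqF.
have mgf : measurable_fun (itvcc c d) (gfun : measurableTypeR R -> measurableTypeR R).
  by case: bmf_gfun.
have [G [Gb GI]] := poly_L1_approx cd g00 mgf gb e10.
have Gb0 x : c <= x <= d -> G0 <= G.[x] <= G1 by exact: Gb.
exists G; split => //.
  by apply: (le_trans GI); rewrite ge_min lexx.
have [Lp Lp0 hLp] := poly_lipschitz G.
pose s := 2 * M * Lp / e' + 1.
have s0 : 0 < s by rewrite ltr_wpDl// divr_ge0 ?(ltW e'0)// mulr_ge0// mulr_ge0// ltW.
have hs : 2 * M * Lp / s <= e'.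
  rewrite ler_pdivrMr// /s mulrDr mulr1 mulrCA divff ?gt_eqF// mulr1; lra.
have e'p : 0 < e' * pi / 2 by rewrite divr_gt0// mulr_gt0.
have [du du0 hdu] := acos_near u1 (le_lt_trans uv v1) e'p.
have [dv dv0 hdv] := acos_near (lt_le_trans u1 uv) v1 e'p.
(* The enlargement [[u2, v2]] of [[u, v]] stays in [[c, d]] and gains at most [e'] of arcsine mass;
   a point [t] outside it is at distance at least [dl] from [[u, v]], where [chebB_far] applies. *)
pose dl := Num.min (Num.min (du / 2) (dv / 2)) (Num.min (u - c) (d - v)).
have dl0 : 0 < dl by rewrite !lt_min !subr_gt0 cu vd !divr_gt0.
have [k1 k2 k3 k4] : [/\ dl <= du / 2, dl <= dv / 2, dl <= u - c & dl <= d - v].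
  by split; rewrite /dl !ge_min lexx ?orbT.
pose u2 := u - dl; pose v2 := v + dl.
have cu2 : c <= u2 by rewrite /u2; lra.
have v2d : v2 <= d by rewrite /v2; lra.
have uv2 : u2 <= v2 by rewrite /u2 /v2; lra.
have u21 : -1 < u2 by lra.
have v21 : v2 < 1 by lra.
have v2u2 : v2 - u2 <= 2 by lra.
have arc2 : arcs u2 v2 <= arcs u v + e'.
  have a1 : acos u2 <= acos u + e' * pi / 2.
    have : `|u - u2| < du by rewrite /u2 opprB addrC subrK gtr0_norm//; lra.
    by move/hdu; rewrite ltr_distl => /andP[? ?]; lra.
  have a2 : acos v - e' * pi / 2 <= acos v2.
    have : `|v - v2| < dv by rewrite /v2 opprD addNKr normrN gtr0_norm//; lra.
    by move/hdv; rewrite ltr_distl => /andP[? ?]; lra.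
  rewrite /arcs ler_pdivrMr// mulrDl divfK ?gt_eqF//; lra.
pose mass := fine (mu ud).
have mass0 : 0 <= mass by exact: fine_ge0.
pose Bo := G1 * (4 / dl ^+ 2).
have Bo0 : 0 <= Bo by rewrite mulr_ge0 ?(ltW G10)// divr_ge0// sqr_ge0.
have C10 : 0 < C1 by rewrite addr_gt0// invr_gt0.
(* Collects the contributions bounded independently of [n]; for large [n] they are at most
   [e' n]. *)
pose cst := 2 * C1 + C1 * (1 + e' + e') + 2 * M * (Lp * C1 / s + Lp * s) + Bo * mass.
pose n1 := (Num.truncn (cst / e')).+1.
have bG2 : bmf (itvcc u2 v2) (horner G) by exact: bmf_poly_itvcc.
have bw2 : bmf (itvcc u2 v2) w by exact: (bmf_itvcc_w w_density wM).
have mI2 : measurable (itvcc u2 v2) by exact: measurable_itv.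
have fI2 : (leb (itvcc u2 v2) < +oo)%E by exact: lebesgue_itvcc_fin.
have mIc : measurable (itvcc c d) by exact: measurable_itv.
have fIc : (leb (itvcc c d) < +oo)%E by exact: lebesgue_itvcc_fin.
have bGg : bmf (itvcc c d) (fun x => `|G.[x] - gfun x|).
  by apply: bmf_norm; apply: bmfB; [exact: bmf_poly_itvcc|exact: bmf_gfun].
have sub2 : itvcc u2 v2 `<=` itvcc c d by exact: itvcc_sub.
have sub1 : itvcc u v `<=` itvcc c d by apply: itvcc_sub; exact: ltW.
have bGg2 : bmf (itvcc u2 v2) (fun x => `|G.[x] - gfun x|) by exact: bmf_sub bGg.
have bGg1 : bmf (itvcc u v) (fun x => `|G.[x] - gfun x|) by exact: bmf_sub bGg.
have inc x : itvcc c d x -> c <= x <= d by rewrite /itvcc/= in_itv.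
have Gw : \int[leb]_(x in itvcc u2 v2) (G.[x] * w x) <= arcs u v + e' + e'.
  apply: (@le_trans _ _ (\int[leb]_(x in itvcc u2 v2) (om x + M * `|G.[x] - gfun x|))).
    apply: rint_le => //; first exact: bmfM.
    - by apply: bmfD; [exact: bmf_om|exact: bmfZ].
    move=> x /sub2/inc hx; have wx0 : 0 < w x by exact: lt_le_trans (wm hx).
    have -> : G.[x] * w x = om x + w x * (G.[x] - gfun x).
      by rewrite /gfun; field; rewrite gt_eqF.
    rewrite lerD2l; apply: (@le_trans _ _ (w x * `|G.[x] - gfun x|)).
      by rewrite ler_wpM2l ?(ltW wx0)// ler_norm.
    by rewrite ler_wpM2r// wM.
  rewrite rintD//; [|exact: bmf_om|exact: bmfZ].
  rewrite rintZ// rint_om//; apply: lerD => //.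
  apply: le_trans e1b; rewrite mulrC ler_wpM2r ?(ltW M0)//; apply: le_trans GI.
  by apply: rint_subset.
have L3 n : (0 < n)%N -> L (chebB G n u v) <=
    n%:R * (arcs u v + e' + e') + C1 * (1 + e' + e') + 2 * M * (Lp / s * (n%:R + C1) + Lp * s) + Bo * mass.
  move=> n0; have [Q QE] := chebB_poly G n0.
  have bB : bmf ud (chebB G n u v).
    apply: (@bmf_ext _ _ (horner Q)); last exact: bmf_poly_ud.
      by move=> t _; rewrite QE.
    exact: measurable_ud.
  have Gnn x : c <= x <= d -> 0 <= G.[x] <= G1.
    by move=> /Gb0 /andP[h1 h2]; rewrite h2 andbT; apply: le_trans h1; exact: ltW.
  have B0 t : ud t -> 0 <= chebB G n u v t by move=> _; apply: chebB_ge0 => x /Gnn/andP[].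
  have Bf t : ud t -> ~ (u2 <= t <= v2) -> chebB G n u v t <= Bo.
    move=> ut nt; apply: chebB_far => //; [exact: ud_norm|exact: ltW|].
    move=> x /andP[ux xv]; apply: (dist_enlarged ux xv) => //; have [tc|tc] := ltP t u2; [by left|right].
    by rewrite ltNge; apply/negP => td; apply: nt; rewrite tc td.
  apply: (le_trans (muL_le_density w_density lt_N1c lt_d1 mu_ac wM cu2 v2d bB Bo0 B0 Bf)).
  rewrite lerD2r.
  pose q := Lp / s * (n%:R + C1) + Lp * s.
  have q0 : 0 <= q.
    have nC : 0 <= n%:R + C1 by rewrite addr_ge0// ltW.
    have Ls : 0 <= Lp / s by rewrite divr_ge0// ltW.
    by apply: addr_ge0; apply: mulr_ge0 => //; exact: ltW.
  apply: (@le_trans _ _ (\int[leb]_(t in itvcc u2 v2) ((n%:R + C1) * (G.[t] * w t) + q * w t))).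
    apply: rint_le => //.
    - apply: bmfM => //; apply: bmf_sub bB; [|exact: measurable_ud].
      exact: (itvcc_ud lt_N1c lt_d1).
    - by apply: bmfD; [apply: bmfZ; exact: bmfM|exact: bmfZ].
    move=> t /sub2/inc ht.
    have -> : (n%:R + C1) * (G.[t] * w t) + q * w t =
       ((G.[t] + Lp / s) * (n%:R + C1) + Lp * s) * w t by rewrite /q; ring.
    by apply: ler_wpM2r => //; apply: chebB_near => //; have /andP[] := Gnn t ht.
  rewrite rintD//; [|by apply: bmfZ; exact: bmfM|exact: bmfZ].
  rewrite !rintZ//; last exact: bmfM.
  have W2 : \int[leb]_(t in itvcc u2 v2) w t <= 2 * M.
    apply: (@le_trans _ _ (M * (v2 - u2))).
      rewrite -fine_lebesgue_itvcc// -rint_cst//; apply: rint_le => //; first exact: bmf_cst.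
      by move=> t /sub2/inc; exact: wM.
    by rewrite mulrC ler_wpM2r ?(ltW M0).
  have nC : 0 <= n%:R + C1 by rewrite addr_ge0// ltW.
  have h1 := ler_wpM2l nC Gw; have h2 := ler_wpM2l q0 W2.
  apply: (le_trans (lerD h1 h2)); rewrite [q * _]mulrC lerD2r mulrDl lerD2l ler_wpM2l ?(ltW C10)//.
  by rewrite !lerD2r arcs_le1.
have TI := trace_interval hP hreg w_density lt_N1c lt_d1 mu_ac wM (ltW cu) uv (ltW vd) e'0.
near=> n.
have n0 : (0 < n)%N by near: n; exact: nbhs_infty_gt.
have ncst : cst <= e' * n%:R.
  rewrite mulrC -ler_pdivrMr//; apply: ltW; apply: (lt_le_trans (truncnS_gt _)).
  rewrite ler_nat; near: n; exact: nbhs_infty_ge.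
have T1 : \int[leb]_(x in itvcc u v) (K n x * w x) <= (arcs u v + e') * n%:R by near: n; exact: TI.
have nR : 0 <= n%:R :> R by [].
have bKn : bmf (itvcc u v) (K n) by apply: bmf_sum => i; apply: bmfX; exact: bmf_poly_itvcc.
have bw : bmf (itvcc u v) w by apply: (bmf_itvcc_w w_density wM); exact: ltW.
have bL : bmf (itvcc u v) (fun x => L (fun t => chebK n x t ^+ 2)) by exact: bmf_L_chebK.
have bd : bmf (itvcc u v) (fun x => \sum_(i < n) (dP G n i).[x] ^+ 2).
  by apply: bmf_sum => i; apply: bmfX; exact: bmf_poly_itvcc.
(* Majorant of the weighted sum of squares: [om / G] is replaced by [w] at the price of the [L^1]
   error, and the diagonal Chebyshev kernel by its lower bound [n - C1]. *)
pose H x := K n x * w x + M / G0 * Kc * n%:R * `|G.[x] - gfun x| - 2 * (n%:R - C1) * om x +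
   om x * G.[x] * L (fun t => chebK n x t ^+ 2).
have b1 : bmf (itvcc u v) (fun x => K n x * w x) by exact: bmfM.
have b2 : bmf (itvcc u v) (fun x => M / G0 * Kc * n%:R * `|G.[x] - gfun x|) by exact: bmfZ.
have b3 : bmf (itvcc u v) (fun x => 2 * (n%:R - C1) * om x) by exact: bmfZ.
have b4 : bmf (itvcc u v) (fun x => om x * G.[x] * L (fun t => chebK n x t ^+ 2)).
  by apply: bmfM => //; exact: bmfM.
have b12 : bmf (itvcc u v) (fun x => K n x * w x + M / G0 * Kc * n%:R * `|G.[x] - gfun x|) by exact: bmfD.
have b123 : bmf (itvcc u v) (fun x => K n x * w x + M / G0 * Kc * n%:R * `|G.[x] - gfun x| - 2 * (n%:R - C1) * om x) by exact: bmfB.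
have bH : bmf (itvcc u v) H by exact: bmfD.
apply: (@le_trans _ _ (\int[leb]_(x in itvcc u v) (pi * G1 * H x))).
  apply: rint_le => //; first exact: bmfZ.
  move=> x xI; have hx := inI xI; have o0 := om0 xI.
  have /andP[gx0 gx1] := Gb0 x hx.
  have gx : 0 < G.[x] by exact: lt_le_trans gx0.
  have wx0 : 0 < w x by exact: lt_le_trans (wm hx).
  have [x1 x2] := in1 x hx.
  have uvx : u <= x <= v by move: xI; rewrite /itvcc/= in_itv.
  set S := \sum_(i < n) _.
  have S0 : 0 <= S by apply: sumr_ge0 => i _; exact: sqr_ge0.
  have K0 : 0 <= K n x by apply: sumr_ge0 => i _; exact: sqr_ge0.
  apply: (@le_trans _ _ (pi * G1 * (om x / G.[x] * S))).
    rewrite mulrA -[leLHS]mul1r ler_wpM2r//.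
    have oo := om_ge x1 x2.
    rewrite mulrA ler_pdivlMr// mul1r; apply: (le_trans gx1).
    rewrite mulrAC -[leLHS]mul1r ler_wpM2r ?(ltW G10)//.
    by rewrite mulrC -ler_pdivrMr// mul1r.
  rewrite ler_wpM2l ?(ltW pG0)// /S dP_sqr_sum//.
  have -> : om x / G.[x] * (K n x - 2 * G.[x] * chebK n x x + G.[x] ^+ 2 * L (fun t => chebK n x t ^+ 2)) =
     om x / G.[x] * K n x - 2 * om x * chebK n x x + om x * G.[x] * L (fun t => chebK n x t ^+ 2).
    by field; rewrite gt_eqF.
  rewrite /H lerD2r; apply: lerD; last first.
    rewrite lerN2 mulrAC ler_wpM2l// ?mulr_ge0//.
    by have := chebK_diag_itv lt_N1c lt_d1 n0 hx; rewrite ler_distl => /andP[].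
  have h1 : om x / G.[x] - w x <= M / G0 * `|G.[x] - gfun x|.
    have -> : om x / G.[x] - w x = w x / G.[x] * (gfun x - G.[x]).
      by rewrite /gfun; field; rewrite !gt_eqF.
    have wG : w x / G.[x] <= M / G0.
      by apply: ler_pM; rewrite ?invr_ge0 ?(ltW wx0) ?(ltW gx)// ?wM// lef_pV2 ?posrE.
    apply: (@le_trans _ _ (w x / G.[x] * `|G.[x] - gfun x|)).
      by rewrite distrC ler_wpM2l ?ler_norm// divr_ge0// ltW.
    by rewrite ler_wpM2r.
  have h2 := KB n x uvx.
  have h3 : (om x / G.[x] - w x) * K n x <= M / G0 * `|G.[x] - gfun x| * (Kc * n%:R).
    apply: (@le_trans _ _ (M / G0 * `|G.[x] - gfun x| * K n x)); first by rewrite ler_wpM2r.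
    by rewrite ler_wpM2l// mulr_ge0// ltW.
  move: h3; rewrite mulrBl => h3.
  have -> : M / G0 * Kc * n%:R * `|G.[x] - gfun x| = M / G0 * `|G.[x] - gfun x| * (Kc * n%:R) by ring.
  by rewrite [K n x * w x]mulrC -lerBlDl.
rewrite rintZ//.
have HI : \int[leb]_(x in itvcc u v) H x <= 6 * e' * n%:R.
  rewrite /H rintD// rintB// rintD// chebB_swap//.
  rewrite (rintZ _ _ (M / G0 * Kc * n%:R)) // (rintZ _ _ (2 * (n%:R - C1)))// rint_om//.
  have i2 : M / G0 * Kc * n%:R * \int[leb]_(x in itvcc u v) `|G.[x] - gfun x| <= e' * n%:R.
    apply: (@le_trans _ _ (M / G0 * Kc * n%:R * e1)).
      apply: ler_wpM2l; first by rewrite mulr_ge0// mulr_ge0// ltW.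
      by apply: le_trans GI; apply: rint_subset.
    have -> : M / G0 * Kc * n%:R * e1 = e1 * (Kc * (M / G0)) * n%:R by ring.
    by rewrite ler_wpM2r.
  have i4 := L3 n n0.
  have i5 : 2 * M * (Lp / s * (n%:R + C1) + Lp * s) <= e' * n%:R + 2 * M * (Lp * C1 / s + Lp * s).
    have -> : 2 * M * (Lp / s * (n%:R + C1) + Lp * s) =
      2 * M * Lp / s * n%:R + 2 * M * (Lp * C1 / s + Lp * s) by ring.
    by rewrite lerD2r ler_wpM2r.
  have a1 := arcs_le1.
  have i6 : C1 * arcs u v <= C1 by rewrite -[leRHS]mulr1 ler_wpM2l// ltW.
  move: T1 i2 i4 i5 i6 ncst; rewrite /cst.
  move: (\int[leb]_(x in itvcc u v) (K n x * w x)) (M / G0 * Kc * n%:R * _) (L (chebB G n u v)) => z1 z2 z3.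
  move: (2 * M * (Lp / s * (n%:R + C1) + Lp * s)) (2 * M * (Lp * C1 / s + Lp * s)) (Bo * mass) => z4 z5 z6.
  have e1' : n%:R * (arcs u v + e' + e') = n%:R * arcs u v + 2 * (e' * n%:R) by ring.
  have e2' : (arcs u v + e') * n%:R = n%:R * arcs u v + e' * n%:R by ring.
  have e3' : 2 * (n%:R - C1) * arcs u v = 2 * (n%:R * arcs u v) - 2 * (C1 * arcs u v) by ring.
  have e4' : 6 * e' * n%:R = 6 * (e' * n%:R) by ring.
  rewrite e1' e2' e3' e4'; move: (n%:R * arcs u v) (e' * n%:R) (C1 * arcs u v) => y1 y2 y3.
  by move: (C1 * (1 + e' + e')) => y4; lra.
apply: (le_trans (ler_wpM2l (ltW pG0) HI)).
by rewrite /e' le_eqVlt; apply/orP; left; apply/eqP; move: (pi * G1) pG0 => pG pG0'; field; rewrite gt_eqF.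
Unshelve. all: by end_near. Qed.

End Itv.
End L2Comparison.

(** * Asymptotics of derivatives of the Chebyshev kernel *)

Section PowerSums.
Variable R : realType.

Lemma powS_diff_bounds (y : R) q : 0 <= y ->
  q.+1%:R * y ^+ q <= (y + 1) ^+ q.+1 - y ^+ q.+1 <= q.+1%:R * (y + 1) ^+ q.
Proof.
move=> y0; have y10 : 0 <= y + 1 by rewrite addr_ge0.
have e (r : nat) : (y + 1) ^+ r.+1 - y ^+ r.+1 = y * ((y + 1) ^+ r - y ^+ r) + (y + 1) ^+ r.
  by rewrite !exprS; ring.
have e' (r : nat) : (y + 1) ^+ r.+1 - y ^+ r.+1 = (y + 1) * ((y + 1) ^+ r - y ^+ r) + y ^+ r.
  by rewrite !exprS; ring.
have yq (r : nat) : y ^+ r <= (y + 1) ^+ r by rewrite lerXn2r ?nnegrE// lerDl.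
elim: q => [|q /andP[h1 h2]]; first by rewrite !expr0 !expr1; apply/andP; split; lra.
rewrite -[q.+2%:R]natr1 !mulrDl !mul1r; apply/andP; split.
  rewrite e; apply: lerD; last exact: yq.
  by rewrite [X in _ * X <= _]exprS mulrCA ler_wpM2l.
rewrite e'; apply: lerD; last exact: yq.
by rewrite [X in _ <= q.+1%:R * X]exprS mulrCA ler_wpM2l.
Qed.

Lemma sum_pow_bound n q :
  `|\sum_(a < n) (a%:R : R) ^+ q - n%:R ^+ q.+1 / q.+1%:R| <= n%:R ^+ q.
Proof.
have q0 : 0 < q.+1%:R :> R by [].
have qn : q.+1%:R != 0 :> R by [].
suff : n%:R ^+ q.+1 - q.+1%:R * n%:R ^+ q <= q.+1%:R * (\sum_(a < n) (a%:R : R) ^+ q) <= n%:R ^+ q.+1.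
  move=> /andP[h1 h2]; rewrite ler_distl; apply/andP; split.
    by rewrite lerBlDr -(ler_pM2l q0) mulrDr mulrCA divff// mulr1; lra.
  rewrite -(ler_pM2l q0) mulrDr mulrCA divff// mulr1; apply: (le_trans h2).
  by rewrite lerDl mulr_ge0// exprn_ge0.
elim: n => [|n /andP[h1 h2]].
  by rewrite big_ord0 mulr0 expr0n/= sub0r lexx andbT oppr_le0 mulr_ge0// exprn_ge0.
have /andP[k1 k2] := powS_diff_bounds q (ler0n R n).
by rewrite big_ord_recr/= mulrDr -[n.+1%:R]natr1; apply/andP; split; lra.
Qed.

Lemma abel_pow_bound n q (b : nat -> R) (B : R) : 0 <= B ->
  (forall k, `|\sum_(a < k) b a| <= B) ->
  `|\sum_(a < n) a%:R ^+ q * b a| <= 2 * B * n%:R ^+ q.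
Proof.
move=> B0 hB; pose S k := \sum_(a < k) b a.
have mono a : (a%:R : R) ^+ q <= a.+1%:R ^+ q by rewrite lerXn2r ?nnegrE// ler_nat.
have -> : \sum_(a < n) a%:R ^+ q * b a =
    n%:R ^+ q * S n - \sum_(a < n) (a.+1%:R ^+ q - a%:R ^+ q) * S a.+1.
  elim: n => [|n IH]; first by rewrite /S !big_ord0 mulr0 subr0.
  rewrite big_ord_recr/= IH [X in _ = _ - X]big_ord_recr/= /S.
  by rewrite [\sum_(a < n.+1) b a]big_ord_recr/=; ring.
apply: (le_trans (ler_normB _ _)).
have n0 : 0 <= (n%:R : R) ^+ q by rewrite exprn_ge0.
have -> : 2 * B * n%:R ^+ q = n%:R ^+ q * B + n%:R ^+ q * B by ring.
apply: lerD; first by rewrite normrM ger0_norm// ler_wpM2l// hB.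
apply: (le_trans (ler_norm_sum _ _ _)).
apply: (@le_trans _ _ (\sum_(a < n) (a.+1%:R ^+ q - a%:R ^+ q) * B)).
  by apply: ler_sum => a _; rewrite normrM ger0_norm ?subr_ge0// ler_wpM2l ?subr_ge0// hB.
rewrite -mulr_suml ler_wpM2r//.
have -> : \sum_(a < n) ((a.+1%:R : R) ^+ q - a%:R ^+ q) = n%:R ^+ q - 0%:R ^+ q.
  elim: n {n0} => [|n IH]; first by rewrite big_ord0 subrr.
  by rewrite big_ord_recr/= IH; ring.
by rewrite gerBl exprn_ge0.
Qed.

End PowerSums.

Section ChebyshevAsymptotics.
Variable R : realType.
Implicit Types (x th r dl : R).

(** Phase acquired by a cosine after [j] differentiations, up to sign convention. *)
Definition phs (j : nat) : R := j%:R * (pi / 2).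

Lemma cos_phs2 t j : cos (t - phs j.+2) = - cos (t - phs j).
Proof.
have -> : phs j.+2 = phs j + pi.
  rewrite /phs -[j.+2%:R]natr1 -[j.+1%:R]natr1 [X in _ = _ * _ + X]splitr.
  by move: (pi / 2 : R) => q; ring.
by rewrite opprD addrA; move: (t - phs j) => A; rewrite cosD sinN cosN cospi sinpi oppr0 mulr0 subr0 mulrN1.
Qed.

(* leading part of the [j]-th derivative of [T_a] at [cos th], where [r = 1 / sin th] *)
Definition leadT a j th r : R := (a%:R * r) ^+ j * cos (a%:R * th - phs j).

(** [leadT] solves the differentiated equation with its two lower-order terms dropped, so the error
    obeys the recurrence with those terms, bounded by the geometric estimates, as source. The factor
    [n] on the left expresses an error [O(n^(j-1))] without an exponent that is negative at
    [j = 0]. *)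
Lemma chebT_derivn_asymp dl j : 0 < dl -> exists2 C, 0 <= C &
  forall n a th, (0 < n)%N -> (a <= n)%N -> dl <= sin th -> dl <= 1 - cos th ^+ 2 ->
  n%:R * `|(chebT R a)^`(j).[cos th] - leadT a j th (sin th)^-1| <= C * n%:R ^+ j.
Proof.
move=> d0.
have d1' : exists2 d1, 0 < d1 & d1 <= dl /\ d1 <= 1.
  exists (Num.min dl 1); first by rewrite lt_min d0 ltr01.
  by split; rewrite ge_min lexx ?orbT.
have [d1 d10 [d1d d11]] := d1'.
elim/ltn_ind: j => -[|[|j]] IH.
- exists 0 => // n a th n0 an ds dc; have [h _] := horner_cheb_cos a th.
  by rewrite derivn0 h /leadT expr0 mul1r /phs mul0r subr0 subrr normr0 mulr0 mul0r.
- exists 0 => // n a th n0 an ds dc; have [_ h] := horner_cheb_cos a th.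
  have s0 : 0 < sin th by exact: lt_le_trans ds.
  rewrite derivn1 chebT_deriv hornerZ /leadT expr1 /phs mul1r cosBpihalf -h.
  rewrite (_ : _ - _ = 0) ?normr0 ?mulr0 ?mul0r//.
  by field; rewrite gt_eqF.
have [C C0 hC] := IH j (ltnW (ltnSn _)).
pose D := 4 / d1; have D0 : 0 < D by rewrite divr_gt0.
pose C' := dl^-1 * ((2 * j + 1)%:R * D ^+ j.+1 + j%:R ^+ 2 * D ^+ j + C).
exists C'.
  have DD i : 0 <= D ^+ i by rewrite exprn_ge0// ltW.
  rewrite mulr_ge0 ?invr_ge0 ?(ltW d0)//; apply: addr_ge0 => //; apply: addr_ge0; apply: mulr_ge0 => //.
move=> n a th n0 an ds dc.
have s0 : 0 < sin th by exact: lt_le_trans ds.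
have nR : 1 <= n%:R :> R by rewrite ler1n.
have aR : a%:R <= n%:R :> R by rewrite ler_nat.
set x := cos th; set T := chebT R a.
have ode := congr1 (horner^~ x) (chebT_ode_derivn R a j).
move: ode; rewrite hornerM horner_one_sub_sqr hornerD hornerN hornerM !hornerZ hornerX -/T => ode.
pose E := T^`(j.+2).[x] - leadT a j.+2 th (sin th)^-1.
pose E0 := T^`(j).[x] - leadT a j th (sin th)^-1.
have key : (1 - x ^+ 2) * E = (2 * j + 1)%:R * x * T^`(j.+1).[x] + j%:R ^+ 2 * T^`(j).[x] - a%:R ^+ 2 * E0.
  rewrite /E mulrBr ode /E0.
  have -> : (1 - x ^+ 2) * leadT a j.+2 th (sin th)^-1 = - (a%:R ^+ 2 * leadT a j th (sin th)^-1).
    rewrite /leadT cos_phs2 -sin2cos2 !exprS.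
    by field; rewrite gt_eqF.
  by ring.
have x1 : `|x| <= 1 by exact: cos_itv.
have B1 : `|T^`(j.+1).[x]| <= (D * n%:R) ^+ j.+1.
  by apply: chebT_derivn_bound' => //; exact: le_trans dc.
have B0 : `|T^`(j).[x]| <= (D * n%:R) ^+ j.
  by apply: chebT_derivn_bound' => //; exact: le_trans dc.
have B2 := hC n a th n0 an ds dc.
have E1 : dl * `|E| <= `|(1 - x ^+ 2) * E|.
  by rewrite normrM ler_wpM2r// ger0_norm ?(le_trans (ltW d0) dc).
have nj0 : 0 <= (n%:R : R) ^+ j by rewrite exprn_ge0.
have F1 : n%:R * `|(2 * j + 1)%:R * x * T^`(j.+1).[x]| <= (2 * j + 1)%:R * D ^+ j.+1 * n%:R ^+ j.+2.
  rewrite !normrM normr_nat.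
  have -> : (2 * j + 1)%:R * D ^+ j.+1 * n%:R ^+ j.+2 = n%:R * ((2 * j + 1)%:R * 1 * (D * n%:R) ^+ j.+1).
    by rewrite [X in _ = _ * (_ * X)]exprMn [n%:R ^+ j.+2]exprS; move: (D ^+ j.+1) (n%:R ^+ j.+1) (2 * j + 1)%:R => s t z; ring.
  by rewrite ler_wpM2l// ler_pM// ?mulr_ge0// ler_pM.
have F0 : n%:R * `|j%:R ^+ 2 * T^`(j).[x]| <= j%:R ^+ 2 * D ^+ j * n%:R ^+ j.+2.
  rewrite normrM (ger0_norm (sqr_ge0 _)).
  apply: (@le_trans _ _ (n%:R * (j%:R ^+ 2 * (D * n%:R) ^+ j))).
    by rewrite ler_wpM2l// ler_wpM2l// sqr_ge0.
  have -> : n%:R * (j%:R ^+ 2 * (D * n%:R) ^+ j) = j%:R ^+ 2 * D ^+ j * n%:R ^+ j.+1.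
    by rewrite [X in n%:R * (_ * X)]exprMn [n%:R ^+ j.+1]exprS; move: (D ^+ j) (n%:R ^+ j) (j%:R ^+ 2) => s t z; ring.
  apply: ler_wpM2l; first by rewrite mulr_ge0 ?sqr_ge0// exprn_ge0// ltW.
  by apply: ler_weXn2l.
have F2 : n%:R * `|a%:R ^+ 2 * E0| <= C * n%:R ^+ j.+2.
  rewrite normrM (ger0_norm (sqr_ge0 _)) mulrCA.
  apply: (@le_trans _ _ (n%:R ^+ 2 * (C * n%:R ^+ j))).
    by apply: ler_pM => //; first [exact: sqr_ge0|by rewrite mulr_ge0|by rewrite lerXn2r ?nnegrE].
  by rewrite !exprS le_eqVlt; apply/orP; left; apply/eqP; ring.
have tot : dl * (n%:R * `|E|) <= ((2 * j + 1)%:R * D ^+ j.+1 + j%:R ^+ 2 * D ^+ j + C) * n%:R ^+ j.+2.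
  rewrite mulrCA; apply: (le_trans (ler_wpM2l (ler0n _ n) E1)).
  rewrite key; apply: (le_trans (ler_wpM2l (ler0n _ n) (ler_normB _ _))).
  rewrite mulrDr mulrDl; apply: lerD => //.
  apply: (le_trans (ler_wpM2l (ler0n _ n) (ler_normD _ _))).
  by rewrite mulrDr mulrDl; apply: lerD.
rewrite -/x -/T -/E /C' -mulrA -(ler_pM2l d0) mulVKf ?gt_eqF//.
Qed.

Definition phcos (j k : nat) : R := cos (phs j - phs k).

(** For the leading terms, a product of cosines is half a constant plus an oscillation of frequency
    [2 a th]. The constant gives a power sum of order [n^(j+k+1)]; Abel summation and the Dirichlet
    bound leave [O(n^(j+k))] for the oscillation. *)
Lemma cheb_double_sum_asymp dl j k : 0 < dl -> exists2 C, 0 <= C &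
  forall n x, (0 < n)%N -> -1 < x -> x < 1 -> dl <= 1 - x ^+ 2 ->
  `|\sum_(a < n) chebw R a * ((chebT R a)^`(j).[x] * (chebT R a)^`(k).[x]) -
    n%:R ^+ (j + k).+1 * ((pi * om x) ^+ (j + k) * phcos j k / (j + k).+1%:R)| <= C * n%:R ^+ (j + k).
Proof.
move=> d0.
have d1' : exists2 d1, 0 < d1 & d1 <= dl /\ d1 <= 1.
  exists (Num.min dl 1); first by rewrite lt_min d0 ltr01.
  by split; rewrite ge_min lexx ?orbT.
have [d1 d10 [d1d d11]] := d1'.
have [Cj Cj0 hj] := chebT_derivn_asymp j d10.
have [Ck Ck0 hk] := chebT_derivn_asymp k d10.
set q := (j + k)%N.
pose D := 4 / d1; have D0 : 0 < D by rewrite divr_gt0.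
have Di : d1^-1 <= D by rewrite /D -[leLHS]mul1r ler_wpM2r ?invr_ge0 ?(ltW d10)//; lra.
have D1 : 0 <= d1^-1 by rewrite invr_ge0 ltW.
pose C := 2 * (D ^+ j * Ck + Cj * D ^+ k) + D ^+ q * (1 + 2 * d1^-1) + 1.
exists C.
  have DD i : 0 <= D ^+ i by rewrite exprn_ge0// ltW.
  by rewrite /C addr_ge0// addr_ge0//; [apply: mulr_ge0 => //; apply: addr_ge0; exact: mulr_ge0|apply: mulr_ge0 => //; rewrite addr_ge0// mulr_ge0].
move=> n x n0 x1 x2 hx.
have xI : -1 <= x <= 1 by rewrite !ltW.
pose th := acos x; have cx : cos th = x by rewrite acosK// in_itv.
have sE : sin th = Num.sqrt (1 - x ^+ 2) by rewrite sin_acos.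
have x20 : 0 < 1 - x ^+ 2 by exact: lt_le_trans hx.
have s0 : 0 < sin th by rewrite sE sqrtr_gt0.
have s1 : sin th <= 1 by exact: sin_le1.
have dc : d1 <= 1 - cos th ^+ 2 by rewrite cx; exact: le_trans hx.
have ds : d1 <= sin th.
  by apply: (le_trans dc); rewrite -sin2cos2 expr2 ler_piMr// ltW.
set r := (sin th)^-1.
have rE : pi * om x = r.
  by rewrite /om invfM mulrA divff ?mul1r -?sE// gt_eqF// pi_gt0.
have r0 : 0 < r by rewrite invr_gt0.
have rD : r <= D by apply: le_trans Di; rewrite lef_pV2 ?posrE.
have nR : 1 <= n%:R :> R by rewrite ler1n.
rewrite rE; set z := phcos j k.
pose Lj a := leadT a j th r; pose Lk a := leadT a k th r.
have LL a : 2 * (Lj a * Lk a) = r ^+ q * (a%:R ^+ q * z + a%:R ^+ q * cos (2 * a%:R * th - phs q)).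
  rewrite /Lj /Lk /leadT.
  have -> : cos (2 * a%:R * th - phs q) = cos ((a%:R * th - phs j) + (a%:R * th - phs k)).
    by congr cos; rewrite /phs /q natrD; ring.
  have -> : z = cos ((a%:R * th - phs k) - (a%:R * th - phs j)).
    by rewrite /z /phcos; congr cos; ring.
  rewrite (cosD (_ - _) (_ - _)) [X in a%:R ^+ q * X]cosB /q !exprMn !exprD.
  ring.
have Lb i a : (a <= n)%N -> `|leadT a i th r| <= (D * n%:R) ^+ i.
  move=> an; rewrite /leadT normrM normrX -[leRHS]mulr1 ler_pM ?exprn_ge0//; last exact: cos_itv.
  rewrite lerXn2r ?nnegrE ?mulr_ge0 ?(ltW D0)// normrM normr_nat (gtr0_norm r0) mulrC.
  by apply: ler_pM => //; [exact: ltW|rewrite ler_nat].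
have S1 : `|\sum_(a < n) chebw R a * ((chebT R a)^`(j).[x] * (chebT R a)^`(k).[x]) -
    \sum_(a < n) chebw R a * (Lj a * Lk a)| <= 2 * (D ^+ j * Ck + Cj * D ^+ k) * n%:R ^+ q.
  rewrite -sumrB; apply: (le_trans (ler_norm_sum _ _ _)).
  apply: (@le_trans _ _ (\sum_(a < n) 2 * (D ^+ j * Ck + Cj * D ^+ k) * n%:R ^+ q / n%:R)); last first.
    by rewrite sumr_const card_ord -[leLHS]mulr_natr divfK// gt_eqF// (lt_le_trans ltr01).
  apply: ler_sum => a _; have an := ltnW (ltn_ord a).
  have np : 0 < n%:R :> R by exact: lt_le_trans ltr01 nR.
  rewrite ler_pdivlMr// -mulrBr normrM mulrC.
  have w2 : `|chebw R a| <= 2.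
    by rewrite /chebw; case: (_ == _); rewrite /= ?mulr0n ?mulr1n; [rewrite (_ : 2 - 1 = 1) ?normr1; [|ring]|rewrite subr0 normr_nat]; lra.
  set u := _^`(j).[x]; set v := _^`(k).[x].
  have hu : `|u| <= (D * n%:R) ^+ j by apply: chebT_derivn_bound' => //; rewrite -cx.
  have hv := Lb k a an.
  have e1 := hj n a th n0 an ds dc; have e2 := hk n a th n0 an ds dc.
  move: e1 e2; rewrite cx -/u -/v -/r -/(Lj a) -/(Lk a) => e1 e2.
  have -> : u * v - Lj a * Lk a = u * (v - Lk a) + (u - Lj a) * Lk a by ring.
  apply: (@le_trans _ _ (n%:R * (2 * (`|u| * `|v - Lk a| + `|u - Lj a| * `|Lk a|)))).
    rewrite ler_wpM2l// ler_pM// -!normrM; exact: ler_normD.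
  have f1 : `|u| * (n%:R * `|v - Lk a|) <= (D * n%:R) ^+ j * (Ck * n%:R ^+ k).
    by apply: ler_pM => //; rewrite mulr_ge0.
  have f2 : n%:R * `|u - Lj a| * `|Lk a| <= (Cj * n%:R ^+ j) * (D * n%:R) ^+ k.
    by apply: ler_pM => //; rewrite mulr_ge0.
  have -> : n%:R * (2 * (`|u| * `|v - Lk a| + `|u - Lj a| * `|Lk a|)) =
    2 * (`|u| * (n%:R * `|v - Lk a|) + n%:R * `|u - Lj a| * `|Lk a|) by ring.
  have -> : 2 * (D ^+ j * Ck + Cj * D ^+ k) * n%:R ^+ q =
     2 * ((D * n%:R) ^+ j * (Ck * n%:R ^+ k) + (Cj * n%:R ^+ j) * (D * n%:R) ^+ k).
    by rewrite /q exprD !exprMn; ring.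
  by rewrite ler_wpM2l// lerD.
(* [chebw R a] differs from 2 only at [a = 0]. *)
have S2 : `|\sum_(a < n) chebw R a * (Lj a * Lk a) - \sum_(a < n) 2 * (Lj a * Lk a)| <= n%:R ^+ q.
  rewrite -sumrB; case: n n0 {nR S1} Lb => // n _ Lb.
  have nq1 : 1 <= (n.+1%:R : R) ^+ q by rewrite exprn_ege1// ler1n.
  rewrite big_ord_recl/= big1 ?addr0 => [|i _].
    apply: le_trans nq1; rewrite -mulrBl /chebw eqxx/= mulr1n (_ : 2 - 1 - 2 = -1); last by ring.
    rewrite mulN1r normrN normrM mulr_ile1//.
      rewrite /Lj /leadT mul0r normrM mulr_ile1 ?cos_itv// normrX normr0.
      by rewrite exprn_ile1.
    rewrite /Lk /leadT mul0r normrM mulr_ile1 ?cos_itv// normrX normr0.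
    by rewrite exprn_ile1.
  by rewrite /chebw/= /bump/= subr0 subrr.
have S3 : `|\sum_(a < n) 2 * (Lj a * Lk a) - n%:R ^+ q.+1 * (r ^+ q * z / q.+1%:R)| <=
    D ^+ q * (1 + 2 * d1^-1) * n%:R ^+ q.
  have -> : \sum_(a < n) 2 * (Lj a * Lk a) - n%:R ^+ q.+1 * (r ^+ q * z / q.+1%:R) =
    r ^+ q * (z * (\sum_(a < n) a%:R ^+ q - n%:R ^+ q.+1 / q.+1%:R) + \sum_(a < n) a%:R ^+ q * cos (2 * a%:R * th - phs q)).
    rewrite (eq_bigr _ (fun (a : 'I_n) _ => LL a)) -mulr_sumr big_split/= -mulr_suml; ring.
  have z1 : `|z| <= 1 by exact: cos_itv.
  have h1 := sum_pow_bound R n q.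
  have h2 : `|\sum_(a < n) a%:R ^+ q * cos (2 * a%:R * th - phs q)| <= 2 * d1^-1 * n%:R ^+ q.
    apply: (@abel_pow_bound R n q (fun a => cos (2 * a%:R * th - phs q))) => // i.
    have := cos_sum_bound i th (phs q); rewrite (gtr0_norm s0) -(ler_pdivlMr _ _ s0) => h.
    by apply: (le_trans h); rewrite mul1r lef_pV2 ?posrE.
  rewrite normrM normrX (gtr0_norm r0) -mulrA; apply: ler_pM; rewrite ?exprn_ge0 ?(ltW r0)//.
    by rewrite lerXn2r ?nnegrE ?(ltW r0) ?(ltW D0).
  apply: (le_trans (ler_normD _ _)); rewrite mulrDl mul1r lerD// normrM -[leRHS]mul1r.
  by rewrite ler_pM.
set A := \sum_(a < n) _ in S1 *; set B := \sum_(a < n) _ in S1 S2; set E := \sum_(a < n) _ in S2 S3.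
set F := n%:R ^+ q.+1 * _ in S3 *.
have -> : A - F = (A - B) + (B - E) + (E - F) by ring.
apply: (le_trans (ler_normD _ _)); apply: (le_trans (lerD (ler_normD _ _) (lexx _))).
apply: (le_trans (lerD (lerD S1 S2) S3)).
by rewrite /C le_eqVlt; apply/orP; left; apply/eqP; ring.
Qed.

End ChebyshevAsymptotics.

(** * L1 convergence of the kernel derivatives *)

(** Leibniz' rule with the lower-order coefficients left unspecified: what matters is that they
    depend on [G] and [j] alone, not on [Q] and hence not on [n]. *)
Lemma derivn_mul_expansion (R : comNzRingType) (G : {poly R}) j :
  exists H : nat -> {poly R}, forall Q : {poly R},
    (G * Q)^`(j) = G * Q^`(j) + \sum_(l < j) H l * Q^`(l).
Proof.
elim: j => [|j [H hH]]; first by exists (fun=> 0) => Q; rewrite big_ord0 addr0 !derivn0.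
exists (fun l => (if (l < j)%N then (H l)^`() else G^`()) + (if l is l'.+1 then H l' else 0)) => Q.
rewrite derivnS hH derivD derivM linear_sum/= -derivnS.
rewrite (eq_bigr (fun l : 'I_j => (H l)^`() * Q^`(l) + H l * Q^`(l.+1))); last first.
  by move=> l _; rewrite derivM -derivnS.
rewrite big_split/= addrA [X in _ = _ + X](eq_bigr (fun l : 'I_j.+1 =>
  (if (l < j)%N then (H l)^`() else G^`()) * Q^`(l) + (if l : nat is l'.+1 then H l' else 0) * Q^`(l))); last first.
  by move=> l _; rewrite mulrDl.
rewrite big_split/= [X in _ = _ + (X + _)]big_ord_recr/= ltnn [X in _ = _ + (_ + X)]big_ord_recl/= mul0r add0r.
rewrite [X in _ = _ + (X + _ + _)](eq_bigr (fun l : 'I_j => (H l)^`() * Q^`(l))); last by move=> l _; rewrite ltn_ord.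
ring.
Qed.

(** Each derivative spends half of the remaining margin between the inner and the outer interval. *)
Lemma bernstein_L2_derivn (R : realType) (j : nat) (u v u' v' : R) : u < u' -> v' < v ->
  exists2 C : R, 0 < C & forall (n : nat) (Q : {poly R}), (0 < n)%N -> (size Q <= n)%N ->
  \int[lebesgue_measure]_(t in itvcc u' v') (Q^`(j).[t] ^+ 2) <=
  C * (n%:R ^+ j) ^+ 2 * \int[lebesgue_measure]_(t in itvcc u v) (Q.[t] ^+ 2).
Proof.
elim: j u' v' => [|j IH] u' v' uu vv.
  exists 1 => // n Q _ _; rewrite derivn0 expr0 expr1n mulr1 mul1r.
  apply: rint_subset; [exact: measurable_itv|exact: measurable_itv|exact: lebesgue_itvcc_fin| |exact: bmf_poly_itvcc_sqr|].
    move=> t; rewrite /itvcc/= !in_itv/= => /andP[h1 h2].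
    by rewrite (le_trans (ltW uu) h1) (le_trans h2 (ltW vv)).
  by move=> t _; exact: sqr_ge0.
have u1 : u < (u + u') / 2 < u' by apply/andP; split; lra.
have v1 : v' < (v + v') / 2 < v by apply/andP; split; lra.
have [/andP[u1a u1b] /andP[v1a v1b]] := (u1, v1).
have [C C0 hC] := IH _ _ u1a v1b.
have [C' C'0 hC'] := bernstein_L2 u1b v1a.
exists (C' * C); first exact: mulr_gt0.
move=> n Q n0 sQ; rewrite derivnS.
have sj : (size Q^`(j) <= n)%N.
  elim: (j) => [|i Hi]; first by rewrite derivn0.
  rewrite derivnS; have [->|q0] := eqVneq Q^`(i) 0; first by rewrite deriv0 size_poly0.
  exact: leq_trans (ltnW (lt_size_deriv q0)) Hi.
apply: (le_trans (hC' n _ n0 sj)).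
have -> : C' * C * (n%:R ^+ j.+1) ^+ 2 * \int[lebesgue_measure]_(t in itvcc u v) Q.[t] ^+ 2 =
   C' * n%:R ^+ 2 * (C * (n%:R ^+ j) ^+ 2 * \int[lebesgue_measure]_(t in itvcc u v) Q.[t] ^+ 2).
  by rewrite [n%:R ^+ j.+1]exprS; ring.
by rewrite ler_wpM2l ?hC// mulr_ge0 ?sqr_ge0// ltW.
Qed.

Section L1Convergence.
Variable R : realType.
Variable mu : {finite_measure set (measurableTypeR R) -> \bar R}.
Variable P : nat -> {poly R}.
Hypothesis hP : orthonormal_polys mu P.
Hypothesis hreg : regular_measure mu.
Variables (w : R -> R) (c d m M : R).
Hypothesis w_density : ac_density mu w.
Hypotheses (lt_N1c : -1 < c) (lt_d1 : d < 1).
Hypothesis mu_ac : abs_continuous_on mu `[c, d].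
Hypothesis m0 : 0 < m.
Hypothesis wb : forall x, c <= x <= d -> m <= w x <= M.
Local Notation leb := (@lebesgue_measure R).

Definition dKer n j k x : R := \sum_(i < n) (P i)^`(j).[x] * (P i)^`(k).[x].

(** Multiplied by [gfun], the [L^1] limit of [dKer n j k / n^(j+k+1)]. *)
Definition limKer j k x : R := (pi * om x) ^+ (j + k) * phcos R j k / (j + k).+1%:R.

Lemma bmf_dKer u v n j k : bmf (itvcc u v) (dKer n j k).
Proof. by apply: bmf_sum => i; apply: bmfM; exact: bmf_poly_itvcc. Qed.

Lemma limKer_bound j k : exists2 S, 0 <= S & forall x, c <= x <= d -> `|limKer j k x| <= S.
Proof.
exists ((pi * (pi * Num.sqrt (edge c d))^-1) ^+ (j + k)).
  by rewrite exprn_ge0// mulr_ge0 ?pi_ge0// invr_ge0 mulr_ge0 ?sqrtr_ge0 ?pi_ge0.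
move=> x hx; have hx' := hx; move: hx' => /andP[h1 h2].
have o0 : 0 < om x by apply: om_gt0; [exact: lt_le_trans h1|exact: le_lt_trans lt_d1].
rewrite /limKer normrM normrM -[leRHS]mulr1 ler_pM//.
  rewrite -[leRHS]mulr1 ler_pM//; last exact: cos_itv.
  rewrite normrX lerXn2r ?nnegrE// ?mulr_ge0 ?pi_ge0 ?invr_ge0 ?mulr_ge0 ?sqrtr_ge0 ?pi_ge0//.
  rewrite ger0_norm ?mulr_ge0 ?pi_ge0 ?(ltW o0)// ler_wpM2l ?pi_ge0//.
  exact: (om_le lt_N1c lt_d1).
by rewrite ger0_norm ?invr_ge0// invf_le1// ler1n.
Qed.

Lemma bmf_limKer u v j k : -1 < u -> v < 1 -> bmf (itvcc u v) (limKer j k).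
Proof.
move=> u1 v1; apply: bmfM; last exact: bmf_cst.
apply: bmfM; last exact: bmf_cst.
by apply: bmfX; apply: bmfZ; exact: bmf_om.
Qed.

(* The Leibniz remainder only involves double sums of lower order. *)
Lemma dKer_comparison (G : {poly R}) j k : exists2 C, 0 <= C & forall n x, (0 < n)%N -> c <= x <= d ->
  `|dKer n j k x - n%:R ^+ (j + k).+1 * (limKer j k x * G.[x])| <=
  `|\sum_(i < n) (dP mu P G n i)^`(j).[x] * (P i)^`(k).[x]| + C * n%:R ^+ (j + k).
Proof.
have [H hH] := derivn_mul_expansion G j.
have e0 : 0 < edge c d := edge_gt0 lt_N1c lt_d1.
pose T n l x := \sum_(a < n) chebw R a * ((chebT R a)^`(l).[x] * (chebT R a)^`(k).[x]).
have inx x : c <= x <= d -> [/\ -1 < x, x < 1 & edge c d <= 1 - x ^+ 2].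
  move=> hx; split; last exact: (edge_le lt_N1c lt_d1).
    by apply: (lt_le_trans lt_N1c); case/andP: hx.
  by apply: le_lt_trans lt_d1; case/andP: hx.
have [B B0 hB] := horner_bounded G 1.
have [Cm Cm0 hCm] := cheb_double_sum_asymp j k e0.
have lowl l : (l < j)%N -> exists2 C, 0 <= C & forall n x, (0 < n)%N -> c <= x <= d ->
    `|(H l).[x] * T n l x| <= C * n%:R ^+ (j + k).
  move=> lj; have [Cl Cl0 hCl] := cheb_double_sum_asymp l k e0.
  have [S S0 hS] := limKer_bound l k.
  have [Bl Bl0 hBl] := horner_bounded (H l) 1.
  exists (Bl * (S + Cl)); first by rewrite mulr_ge0// addr_ge0.
  move=> n x n0 hx; have [x1 x2 xe] := inx x hx.
  have nR : 1 <= n%:R :> R by rewrite ler1n.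
  rewrite normrM -mulrA; apply: ler_pM => //.
    by apply: hBl; rewrite ler_norml !ltW.
  have h := hCl n x n0 x1 x2 xe; rewrite -/(limKer l k x) -/(T n l x) in h.
  rewrite -(subrK (n%:R ^+ (l + k).+1 * limKer l k x) (T n l x)).
  apply: (le_trans (ler_normD _ _)); rewrite mulrDl addrC; apply: lerD.
    rewrite normrM normrX normr_nat mulrC; apply: ler_pM => //; first exact: hS.
    by apply: ler_weXn2l => //; rewrite -addSn leq_add2r.
  apply: (le_trans h); apply: ler_wpM2l => //; apply: ler_weXn2l => //.
  by rewrite leq_add2r ltnW.
have [Cs Cs0 hCs] : exists2 C, 0 <= C & forall n x, (0 < n)%N -> c <= x <= d ->
    `|\sum_(l < j) (H l).[x] * T n l x| <= C * n%:R ^+ (j + k).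
  have aux i : (i <= j)%N -> exists2 C, 0 <= C & forall n x, (0 < n)%N -> c <= x <= d ->
    `|\sum_(l < i) (H l).[x] * T n l x| <= C * n%:R ^+ (j + k).
    elim: i => [|i IH] ij; first by exists 0 => // n x _ _; rewrite big_ord0 normr0 mul0r.
    have [C C0 hC] := IH (ltnW ij); have [C' C'0 hC'] := lowl i ij.
    exists (C + C'); first exact: addr_ge0.
    move=> n x n0 hx; rewrite big_ord_recr/= mulrDl; apply: (le_trans (ler_normD _ _)).
    by rewrite lerD ?hC ?hC'.
  exact: aux (leqnn j).
exists (B * Cm + Cs); first by rewrite addr_ge0// mulr_ge0.
move=> n x n0 hx; have [x1 x2 xe] := inx x hx.
have -> : dKer n j k x = \sum_(i < n) (dP mu P G n i)^`(j).[x] * (P i)^`(k).[x] +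
    (G.[x] * T n j x + \sum_(l < j) (H l).[x] * T n l x).
  transitivity (\sum_(i < n) (dP mu P G n i)^`(j).[x] * (P i)^`(k).[x] +
    \sum_(i < n) (G * rhoP mu P n i)^`(j).[x] * (P i)^`(k).[x]).
    rewrite -big_split/=; apply: eq_bigr => i _.
    by rewrite -mulrDl -hornerD -derivnD /dP subrK.
  congr (_ + _).
  transitivity (\sum_(i < n) (G.[x] * ((rhoP mu P n i)^`(j).[x] * (P i)^`(k).[x]) +
     \sum_(l < j) (H l).[x] * ((rhoP mu P n i)^`(l).[x] * (P i)^`(k).[x]))).
    apply: eq_bigr => i _; rewrite hH hornerD hornerM mulrDl mulrA; congr (_ + _).
    by rewrite horner_sum mulr_suml; apply: eq_bigr => l _; rewrite hornerM mulrA.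
  rewrite big_split/= -mulr_sumr /T -(chebK_orth_expansion hP); congr (_ + _).
  rewrite exchange_big/=; apply: eq_bigr => l _.
  by rewrite -mulr_sumr -(chebK_orth_expansion hP).
set Dm := \sum_(i < n) _.
have -> : Dm + (G.[x] * T n j x + \sum_(l < j) (H l).[x] * T n l x) - n%:R ^+ (j + k).+1 * (limKer j k x * G.[x]) =
  Dm + (G.[x] * (T n j x - n%:R ^+ (j + k).+1 * limKer j k x) + \sum_(l < j) (H l).[x] * T n l x) by ring.
apply: (le_trans (ler_normD _ _)); rewrite lerD2l.
apply: (le_trans (ler_normD _ _)); rewrite mulrDl; apply: lerD; last exact: hCs.
rewrite normrM -mulrA; apply: ler_pM => //; last exact: hCm.
by apply: hB; rewrite ler_norml !ltW.
Qed.

Section Itv.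
Variables (u v : R).
Hypotheses (cu : c < u) (uv : u <= v) (vd : v < d).
Let mI : measurable (itvcc u v). Proof. exact: measurable_itv. Qed.
Let fI : (leb (itvcc u v) < +oo)%E. Proof. exact: lebesgue_itvcc_fin. Qed.
Let u1 : -1 < u. Proof. exact: lt_trans cu. Qed.
Let v1 : v < 1. Proof. exact: lt_trans lt_d1. Qed.
Let bp (Q : {poly R}) : bmf (itvcc u v) (horner Q). Proof. exact: bmf_poly_itvcc. Qed.

Lemma size_dP (G : {poly R}) n i : (i < n)%N -> (size G <= n)%N -> (size (dP mu P G n i) <= 2 * n)%N.
Proof.
move=> lin sG; apply: (leq_trans (size_polyD _ _)); rewrite geq_max size_polyN (size_orth hP).
rewrite mul2n -addnn (leq_trans lin) ?leq_addr//=.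
apply: (leq_trans (size_polyMleq _ _)); apply: (leq_trans (leq_pred _)).
by rewrite leq_add// size_rhoP.
Qed.

Lemma rint_dP_small u0 v0 j k : u0 < u -> v < v0 -> exists C D : R, [/\ 0 <= C, 0 <= D &
  forall (G : {poly R}) n (tau e : R), (0 < n)%N -> (size G <= n)%N -> 0 < tau ->
  \int[leb]_(x in itvcc u0 v0) (\sum_(i < n) (dP mu P G n i).[x] ^+ 2) <= e * n%:R ->
  \int[leb]_(x in itvcc u v) `|\sum_(i < n) (dP mu P G n i)^`(j).[x] * (P i)^`(k).[x]| <=
    (C * e / tau + D * tau) * n%:R ^+ (j + k).+1].
Proof.
move=> u0u vv0; have [C C0 hC] := bernstein_L2_derivn j u0u vv0.
have [D1 [D2 [D10 D20 hD]]] := dK_diag_bound hP w_density lt_N1c lt_d1 mu_ac m0 wb cu vd.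
have vu0 : 0 <= v - u by rewrite subr_ge0.
have D2k : 0 <= (D2 ^+ k) ^+ 2 by exact: sqr_ge0.
exists (C * 2 ^+ j ^+ 2), (D1 * (D2 ^+ k) ^+ 2 * (v - u)); split.
- by rewrite mulr_ge0 ?sqr_ge0// ltW.
- by rewrite mulr_ge0// mulr_ge0// ltW.
move=> G n tau e n0 sG tau0 hG.
have nR : 0 < n%:R :> R by rewrite ltr0n.
have mI0 : measurable (itvcc u0 v0) by exact: measurable_itv.
have fI0 : (leb (itvcc u0 v0) < +oo)%E by exact: lebesgue_itvcc_fin.
set d_ := dP mu P G n.
pose A x := \sum_(i < n) (d_ i)^`(j).[x] ^+ 2.
have bA : bmf (itvcc u v) A by apply: bmf_sum => i; exact: bmf_poly_itvcc_sqr.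
have bS : bmf (itvcc u v) (fun x => \sum_(i < n) (d_ i)^`(j).[x] * (P i)^`(k).[x]).
  by apply: bmf_sum => i; apply: bmfM.
have IA : \int[leb]_(x in itvcc u v) A x <= C * 2 ^+ j ^+ 2 * (n%:R ^+ j) ^+ 2 * (e * n%:R).
  apply: (@le_trans _ _ (C * 2 ^+ j ^+ 2 * (n%:R ^+ j) ^+ 2 * \int[leb]_(x in itvcc u0 v0) (\sum_(i < n) (d_ i).[x] ^+ 2))); last first.
    by rewrite ler_wpM2l// mulr_ge0 ?sqr_ge0// mulr_ge0 ?sqr_ge0// ltW.
  rewrite /A rint_sum//; last by move=> i; exact: bmf_poly_itvcc_sqr.
  rewrite rint_sum//; last by move=> i; exact: bmf_poly_itvcc_sqr.
  rewrite mulr_sumr; apply: ler_sum => i _.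
  have := hC (2 * n)%N (d_ i) _ (size_dP (ltn_ord i) sG); rewrite muln_gt0 n0 => /(_ isT).
  by rewrite natrM exprMn exprMn mulrA.
pose q := (j + k)%N.
have pt x : itvcc u v x -> 2 * n%:R ^+ q * `|\sum_(i < n) (d_ i)^`(j).[x] * (P i)^`(k).[x]| <=
    (n%:R ^+ k) ^+ 2 / tau * A x + tau * (D1 * (D2 ^+ k) ^+ 2) * (n%:R ^+ q) ^+ 2 * n%:R.
  move=> xI; have hx : u <= x <= v by move: xI; rewrite /itvcc/= in_itv.
  have hB := hD n k x hx; set B := \sum_(i < n) (P i)^`(k).[x] ^+ 2 in hB.
  have CS := sum_mul_CS (fun i : 'I_n => (d_ i)^`(j).[x]) (fun i : 'I_n => (P i)^`(k).[x]).
  rewrite -/(A x) -/B in CS; set S := \sum_(i < n) _ in CS *.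
  have A0 : 0 <= A x by apply: sumr_ge0 => i _; exact: sqr_ge0.
  have B0 : 0 <= B by apply: sumr_ge0 => i _; exact: sqr_ge0.
  have n2 i : 0 <= ((n%:R : R) ^+ i) ^+ 2 by exact: sqr_ge0.
  pose a := (n%:R ^+ k) ^+ 2 / tau * A x; pose b := tau * (n%:R ^+ j) ^+ 2 * B.
  have a0 : 0 <= a by rewrite mulr_ge0// divr_ge0// ltW.
  have b0 : 0 <= b by rewrite mulr_ge0// mulr_ge0// ltW.
  apply: (@le_trans _ _ (a + b)); last first.
    rewrite lerD2l; apply: (@le_trans _ _ (tau * (n%:R ^+ j) ^+ 2 * (D1 * n%:R * ((D2 * n%:R) ^+ k) ^+ 2))).
      by rewrite ler_wpM2l// mulr_ge0// ltW.
    rewrite /q exprMn exprD le_eqVlt; apply/orP; left; apply/eqP.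
    by move: (n%:R ^+ j) (n%:R ^+ k) (D2 ^+ k) => s1 s2 s3; ring.
  have -> : 2 * n%:R ^+ q * `|S| = `|2 * n%:R ^+ q * S|.
    by rewrite normrM (ger0_norm (_ : 0 <= 2 * n%:R ^+ q))// mulr_ge0// exprn_ge0.
  rewrite normr_le_sqr ?addr_ge0//.
  apply: (@le_trans _ _ (4 * (a * b))); last first.
    have -> : (a + b) ^+ 2 = 4 * (a * b) + (a - b) ^+ 2 by ring.
    by rewrite lerDl sqr_ge0.
  have -> : 4 * (a * b) = 4 * (n%:R ^+ q) ^+ 2 * (A x * B).
    rewrite /a /b /q exprD; move: (n%:R ^+ j) (n%:R ^+ k) (A x) => s1 s2 s3.
    by field; rewrite gt_eqF.
  have -> : (2 * n%:R ^+ q * S) ^+ 2 = 4 * (n%:R ^+ q) ^+ 2 * S ^+ 2.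
    by move: (n%:R ^+ q) => s1; ring.
  by rewrite ler_wpM2l// mulr_ge0// sqr_ge0.
have nq0 : 0 < (n%:R : R) ^+ q by rewrite exprn_gt0.
have c2 : 0 < 2 * (n%:R : R) ^+ q by rewrite mulr_gt0.
rewrite -(ler_pM2l c2) -rintZ//; last exact: bmf_norm.
have t0 : 0 <= (n%:R ^+ k) ^+ 2 / tau by rewrite divr_ge0 ?sqr_ge0// ltW.
apply: (@le_trans _ _ (\int[leb]_(x in itvcc u v) ((n%:R ^+ k) ^+ 2 / tau * A x + tau * (D1 * (D2 ^+ k) ^+ 2) * (n%:R ^+ q) ^+ 2 * n%:R))).
  apply: rint_le => //; first by apply: bmfZ; exact: bmf_norm.
  by apply: bmfD; [exact: bmfZ|exact: bmf_cst].
rewrite rintD//; [|exact: bmfZ|exact: bmf_cst].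
rewrite (rintZ mI fI _ bA) rint_cst// fine_lebesgue_itvcc//.
apply: (le_trans (lerD (ler_wpM2l t0 IA) (lexx _))).
set X := (n%:R ^+ k) ^+ 2 / tau * _ + _.
have X0 : 0 <= X.
  apply: addr_ge0; first apply: mulr_ge0 => //.
    apply: (le_trans _ IA); apply: rint_ge0 => x _.
    by apply: sumr_ge0 => i _; exact: sqr_ge0.
  by rewrite mulr_ge0// mulr_ge0// mulr_ge0 ?sqr_ge0// mulr_ge0 ?(ltW tau0)// mulr_ge0// ltW.
have -> : 2 * n%:R ^+ q * ((C * 2 ^+ j ^+ 2 * e / tau + D1 * (D2 ^+ k) ^+ 2 * (v - u) * tau) * n%:R ^+ (j + k).+1) = 2 * X.
  rewrite /X -/q [n%:R ^+ q.+1]exprS /q [n%:R ^+ (j + k)]exprD.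
  move: (n%:R ^+ j) (n%:R ^+ k) (D2 ^+ k) (2 ^+ j) => s1 s2 s3 s4.
  by field; rewrite gt_eqF.
by lra.
Qed.

(** Four errors of [e / 4] each: [tau] is fixed first to make [D tau] small, then the accuracy [e1]
    of [G] makes [C e1 / tau] and [S e1] small, and finally [n] absorbs the lower-order terms of the
    comparison, whose constant depends on [G]. *)
Lemma dKer_L1 j k e : 0 < e -> \forall n \near \oo,
  \int[leb]_(x in itvcc u v) `|dKer n j k x - n%:R ^+ (j + k).+1 * (limKer j k x * gfun w x)| <=
    e * n%:R ^+ (j + k).+1.
Proof.
move=> e0; pose u0 := (c + u) / 2; pose v0 := (v + d) / 2.
have c0 := cu; have d0 := vd; have uv' := uv.
have [cu0 u0u vv0 v0d u0v0] : [/\ c < u0, u0 < u, v < v0, v0 < d & u0 <= v0].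
  by rewrite /u0 /v0; split; lra.
have [G0 [G1 [G00 G10 hG]]] := L2_comparison hP hreg w_density lt_N1c lt_d1 mu_ac m0 wb cu0 u0v0 v0d.
have [C [D [C0 D0 hCD]]] := rint_dP_small j k u0u vv0.
have [S S0 hS] := limKer_bound j k.
pose tau := e / (4 * (D + 1)).
have tau0 : 0 < tau by rewrite divr_gt0// mulr_gt0// ltr_wpDl.
pose e1 := Num.min (e * tau / (4 * (C + 1))) (e / (4 * (S + 1))).
have e10 : 0 < e1.
  have C1 : 0 < C + 1 by exact: ltr_wpDl.
  have S1 : 0 < S + 1 by exact: ltr_wpDl.
  by rewrite lt_min; apply/andP; split; apply: divr_gt0 => //; exact: mulr_gt0.
have [G [Gb GI GL2]] := hG e1 e10.
have [Cg Cg0 hCg] := dKer_comparison G j k.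
near=> n.
have n0 : (0 < n)%N by near: n; exact: nbhs_infty_gt.
have sG : (size G <= n)%N by near: n; exact: nbhs_infty_ge.
have nbig : Cg * (v - u) * 4 / e <= n%:R by near: n; exact: nbhs_infty_ger.
have L2n : \int[leb]_(x in itvcc u0 v0) (\sum_(i < n) (dP mu P G n i).[x] ^+ 2) <= e1 * n%:R by near: n.
have I1 := hCD G n tau e1 n0 sG tau0 L2n.
have nR : 0 < n%:R :> R by rewrite ltr0n.
set q := (j + k)%N in I1 *.
have nq0 : 0 < (n%:R : R) ^+ q by rewrite exprn_gt0.
have nq1 : 0 < (n%:R : R) ^+ q.+1 by rewrite exprn_gt0.
have uvcd : itvcc u v `<=` itvcc c d.
  by move=> x; rewrite /itvcc/= !in_itv/= => /andP[h1 h2]; rewrite (le_trans (ltW cu) h1) (le_trans h2 (ltW vd)).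
have bg0 : bmf (itvcc c d) (gfun w) := bmf_gfun w_density lt_N1c lt_d1 m0 wb.
have bg : bmf (itvcc u v) (gfun w) by apply: bmf_sub bg0; [|exact: measurable_itv].
have bl : bmf (itvcc u v) (limKer j k) by exact: bmf_limKer.
have bS : bmf (itvcc u v) (fun x => \sum_(i < n) (dP mu P G n i)^`(j).[x] * (P i)^`(k).[x]).
  by apply: bmf_sum => i; apply: bmfM.
have bK := bmf_dKer u v n j k.
pose F x := `|\sum_(i < n) (dP mu P G n i)^`(j).[x] * (P i)^`(k).[x]|.
have bF : bmf (itvcc u v) F by exact: bmf_norm.
have bGg : bmf (itvcc u v) (fun x => `|G.[x] - gfun w x|) by apply: bmf_norm; exact: bmfB.
apply: (@le_trans _ _ (\int[leb]_(x in itvcc u v) (F x + (n%:R ^+ q.+1 * S * `|G.[x] - gfun w x| + Cg * n%:R ^+ q)))).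
  apply: rint_le => //.
  - by apply: bmf_norm; apply: bmfB => //; apply: bmfZ; exact: bmfM.
  - by apply: bmfD => //; apply: bmfD; [exact: bmfZ|exact: bmf_cst].
  move=> x xI; have hx : c <= x <= d by have := uvcd x xI; rewrite /itvcc/= in_itv.
  have h := hCg n x n0 hx.
  have -> : dKer n j k x - n%:R ^+ q.+1 * (limKer j k x * gfun w x) =
    (dKer n j k x - n%:R ^+ q.+1 * (limKer j k x * G.[x])) + n%:R ^+ q.+1 * limKer j k x * (G.[x] - gfun w x) by ring.
  apply: (le_trans (ler_normD _ _)); apply: (le_trans (lerD h (lexx _))).
  rewrite -addrA lerD2l addrC lerD2r normrM [X in X * _ <= _]normrM (gtr0_norm nq1) ler_wpM2r//.
  by rewrite ler_wpM2l ?(ltW nq1)// hS.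
have bGg' : bmf (itvcc u v) (fun x => n%:R ^+ q.+1 * S * `|G.[x] - gfun w x|) by exact: bmfZ.
have bc : bmf (itvcc u v) (fun=> Cg * n%:R ^+ q) by exact: bmf_cst.
rewrite rintD//; last exact: bmfD.
rewrite rintD// rintZ// rint_cst// fine_lebesgue_itvcc//.
have I2 : \int[leb]_(x in itvcc u v) `|G.[x] - gfun w x| <= e1.
  apply: le_trans GI; apply: rint_subset => //; [exact: measurable_itv|exact: lebesgue_itvcc_fin|].
  by apply: bmf_norm; apply: bmfB => //; exact: bmf_poly_itvcc.
have J1 : C * e1 / tau <= e / 4.
  rewrite ler_pdivrMr//; apply: (@le_trans _ _ (C * (e * tau / (4 * (C + 1))))).
    by rewrite ler_wpM2l// ge_min lexx.
  have C1 : 0 < 4 * (C + 1) by rewrite mulr_gt0// ltr_wpDl.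
  rewrite mulrA ler_pdivrMr//.
  have -> : e / 4 * tau * (4 * (C + 1)) = C * (e * tau) + e * tau by field.
  by rewrite lerDl mulr_ge0// ltW.
have J2 : D * tau <= e / 4.
  rewrite /tau mulrA ler_pdivrMr; last by rewrite mulr_gt0// ltr_wpDl.
  have -> : e / 4 * (4 * (D + 1)) = D * e + e by field.
  by rewrite lerDl ltW.
have J3 : S * e1 <= e / 4.
  apply: (@le_trans _ _ (S * (e / (4 * (S + 1))))); first by rewrite ler_wpM2l// ge_min lexx orbT.
  rewrite mulrA ler_pdivrMr; last by rewrite mulr_gt0// ltr_wpDl.
  have -> : e / 4 * (4 * (S + 1)) = S * e + e by field.
  by rewrite lerDl ltW.
have J4 : Cg * (v - u) <= e / 4 * n%:R.
  by move: nbig; rewrite ler_pdivrMr// => h; lra.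
apply: (@le_trans _ _ ((C * e1 / tau + D * tau) * n%:R ^+ q.+1 + (n%:R ^+ q.+1 * (S * e1) + n%:R ^+ q * (Cg * (v - u))))).
  apply: lerD => //; apply: lerD; last by rewrite mulrAC mulrC.
  by rewrite -mulrA; apply: ler_wpM2l; [exact: ltW|exact: ler_wpM2l].
have K1 : (C * e1 / tau + D * tau) * n%:R ^+ q.+1 <= e / 2 * n%:R ^+ q.+1.
  by rewrite ler_wpM2r ?(ltW nq1)//; lra.
have K2 : n%:R ^+ q.+1 * (S * e1) <= e / 4 * n%:R ^+ q.+1 by rewrite mulrC ler_wpM2r ?(ltW nq1).
have K3 : n%:R ^+ q * (Cg * (v - u)) <= e / 4 * n%:R ^+ q.+1.
  by rewrite [n%:R ^+ q.+1]exprS [e / 4 * _]mulrA [leRHS]mulrC ler_wpM2l ?(ltW nq0).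
apply: (le_trans (lerD K1 (lerD K2 K3))).
by rewrite le_eqVlt; apply/orP; left; apply/eqP; field.
Unshelve. all: by end_near. Qed.

End Itv.
End L1Convergence.

(** * Power series of the complex sinc function *)

Section ComplexSeries.
Variable R : realType.
Implicit Types (x y : R) (z a b : R[i]).
Local Notation toC := (real_complex R).
Local Notation normc := (@Normc.normc R).

Lemma normc_sum (I : Type) (r : seq I) (Q : pred I) (f : I -> R[i]) :
  normc (\sum_(i <- r | Q i) f i) <= \sum_(i <- r | Q i) normc (f i).
Proof.
apply: (big_ind2 (fun s t => normc s <= t)) => //; first by rewrite Normc.normc0.
by move=> s1 t1 s2 t2 h1 h2; apply: (le_trans (le_normcD _ _)); exact: lerD.
Qed.

Lemma normc_real x : normc (toC x) = `|x|.
Proof. by rewrite /Normc.normc/= expr0n/= addr0 sqrtr_sqr. Qed.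

Lemma normcX z n : normc (z ^+ n) = normc z ^+ n.
Proof. by elim: n => [|n IH]; rewrite ?expr0 ?Normc.normc1// !exprS Normc.normcM IH. Qed.

Lemma normc_ge0 z : 0 <= normc z.
Proof. by case: z => s t; exact: sqrtr_ge0. Qed.

Lemma normc_le_ReIm z : normc z <= `|complex.Re z| + `|complex.Im z|.
Proof.
case: z => s t /=; rewrite -(@ler_pXn2r _ 2) ?nnegrE ?addr_ge0 ?sqrtr_ge0//.
rewrite sqr_sqrtr ?addr_ge0 ?sqr_ge0// -(real_normK (num_real s)) -(real_normK (num_real t)).
have -> : (`|s| + `|t|) ^+ 2 = `|s| ^+ 2 + `|t| ^+ 2 + 2 * (`|s| * `|t|) by ring.
by rewrite lerDl mulr_ge0// mulr_ge0.
Qed.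

Lemma normc_sub_le z a b : normc (z - b) <= normc (z - a) + normc (a - b).
Proof. by rewrite (_ : z - b = (z - a) + (a - b)) ?le_normcD//; ring. Qed.

Lemma normc_distC a b : normc (a - b) = normc (b - a).
Proof. by rewrite -normcN opprB. Qed.

Lemma sum_triangle (V : nmodType) (f : nat -> nat -> V) n N : (N <= n)%N ->
  \sum_(j < n) \sum_(k < n) (if (j + k < N)%N then f j k else 0) =
  \sum_(m < N) \sum_(j < m.+1) f j (m - j)%N.
Proof.
elim: N => [|N IH] Nn; first by rewrite big_ord0 big1// => j _; rewrite big1.
rewrite big_ord_recr/= -IH; last exact: ltnW.
rewrite (eq_bigr (fun j : 'I_n => \sum_(k < n) (if (j + k < N)%N then f j k else 0) +
   \sum_(k < n) (if (j + k == N)%N then f j k else 0))); last first.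
  move=> j _; rewrite -big_split/=; apply: eq_bigr => k _.
  by rewrite ltnS leq_eqVlt; case: eqP => [->|_] /=; rewrite ?ltnn ?add0r ?addr0.
rewrite big_split/=; congr (_ + _).
rewrite (big_ord_widen n (fun j => f j (N - j)%N) Nn) [RHS]big_mkcond/=; apply: eq_bigr => j _.
case: ltnP => jN.
  have kn : (N - j < n)%N by rewrite (leq_ltn_trans (leq_subr _ _)).
  rewrite (bigD1 (Ordinal kn))//= subnKC// eqxx big1 ?addr0// => k /negP nk.
  case: eqP => // e; exfalso; apply: nk; apply/eqP/val_inj => /=.
  by rewrite -e addKn.
by rewrite big1// => k _; case: eqP => // e; move: jN; rewrite -e -addnS -[X in (_ <= X)%N]addn0 leq_add2l.
Qed.

Lemma sum_square_split (V : nmodType) (f : nat -> nat -> V) n N : (N <= n)%N ->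
  \sum_(j < n) \sum_(k < n) f j k =
  \sum_(m < N) \sum_(j < m.+1) f j (m - j)%N +
  \sum_(j < n) \sum_(k < n) (if (j + k < N)%N then 0 else f j k).
Proof.
move=> Nn; rewrite -(sum_triangle f Nn) -big_split/=; apply: eq_bigr => j _.
by rewrite -big_split/=; apply: eq_bigr => k _; case: ifP; rewrite ?addr0 ?add0r.
Qed.

Lemma exp_binom (F : numFieldType) (s t : F) m :
  (s + t) ^+ m / m`!%:R = \sum_(j < m.+1) s ^+ j / j`!%:R * (t ^+ (m - j) / (m - j)`!%:R).
Proof.
rewrite addrC exprDn mulr_suml; apply: eq_bigr => j _; have jm := ltn_ord j; rewrite ltnS in jm.
have f0 k : k`!%:R != 0 :> F by rewrite pnatr_eq0 -lt0n fact_gt0.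
rewrite -(bin_fact jm) !natrM -mulr_natl.
by field; rewrite !f0 pnatr_eq0 -lt0n bin_gt0 jm.
Qed.

Definition exp_sum (F : numFieldType) N (s : F) : F := \sum_(m < N) s ^+ m / m`!%:R.

(** Taken at moduli, the remainder is itself a difference of exponential sums. This controls both
    the convergence to [cexp] and the tail of the double series of the kernel. *)
Lemma exp_sumM (F : numFieldType) n N (s t : F) : (N <= n)%N ->
  exp_sum n s * exp_sum n t = exp_sum N (s + t) +
  \sum_(j < n) \sum_(k < n) (if (j + k < N)%N then 0 else s ^+ j / j`!%:R * (t ^+ k / k`!%:R)).
Proof.
move=> Nn; rewrite /exp_sum mulr_suml.
under eq_bigr do rewrite mulr_sumr.
rewrite (sum_square_split (fun j k => s ^+ j / j`!%:R * (t ^+ k / k`!%:R)) Nn); congr (_ + _).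
by apply: eq_bigr => m _; rewrite exp_binom.
Qed.

Lemma cvg_exp_sum x : (fun N => exp_sum N x) @ \oo --> expR x.
Proof.
have -> : (fun N => exp_sum N x) = series (exp_coeff x).
  by apply/funext => N; rewrite /exp_sum /series/= big_mkord.
by rewrite /expR; exact: is_cvg_series_exp_coeff.
Qed.

Lemma cvg_cos_sum x : (fun N => \sum_(m < N) cos_coeff x m) @ \oo --> cos x.
Proof.
have -> : (fun N => \sum_(m < N) cos_coeff x m) = series (cos_coeff x).
  by apply/funext => N; rewrite /series/= big_mkord.
by rewrite unlock; exact: is_cvg_series_cos_coeff.
Qed.

Lemma cvg_sin_sum x : (fun N => \sum_(m < N) sin_coeff x m) @ \oo --> sin x.
Proof.
have -> : (fun N => \sum_(m < N) sin_coeff x m) = series (sin_coeff x).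
  by apply/funext => N; rewrite /series/= big_mkord.
by rewrite unlock; exact: is_cvg_series_sin_coeff.
Qed.

Lemma exp_sum_le N n x : 0 <= x -> (N <= n)%N -> exp_sum N x <= exp_sum n x.
Proof.
move=> x0 /subnKC <-; elim: (n - N)%N => [|k IH]; first by rewrite addn0.
rewrite addnS /exp_sum big_ord_recr/=; apply: (le_trans IH).
by rewrite lerDl divr_ge0// exprn_ge0.
Qed.

Lemma exp_sum_le_expR N x : 0 <= x -> exp_sum N x <= expR x.
Proof.
move=> x0; have /cvg_lim <- // := @cvg_exp_sum x.
apply: limr_ge; first by apply/cvg_ex; exists (expR x); exact: cvg_exp_sum.
by near=> n; apply: exp_sum_le => //; near: n; exact: nbhs_infty_ge.
Unshelve. all: by end_near. Qed.

Lemma exp_sum_real N x : exp_sum N (toC x) = toC (exp_sum N x).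
Proof.
rewrite /exp_sum rmorph_sum; apply: eq_bigr => m _.
by rewrite rmorphM rmorphXn fmorphV rmorph_nat.
Qed.

Definition Ci : R[i] := Complex 0 1.

Lemma Ci_sqr : Ci * Ci = -1.
Proof. by rewrite -expr2; exact: sqr_i. Qed.

Lemma exp_sum_imag N y : exp_sum N (Ci * toC y) =
  Complex (\sum_(m < N) cos_coeff y m) (\sum_(m < N) sin_coeff y m).
Proof.
have term m : (Ci * toC y) ^+ m / m`!%:R = Complex (cos_coeff y m) (sin_coeff y m) /\
    (Ci * toC y) ^+ m.+1 / m.+1`!%:R = Complex (cos_coeff y m.+1) (sin_coeff y m.+1).
  have e (s : R) k : Ci ^+ 0 * (toC s / k%:R) = Complex (s / k%:R) 0.
    by rewrite mul1r -(rmorph_nat (real_complex R)) -fmorphV -rmorphM.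
  have e1 (s : R) k : Ci * (toC s / k%:R) = Complex 0 (s / k%:R).
    rewrite -(rmorph_nat (real_complex R)) -fmorphV -rmorphM.
    by apply/eqP; rewrite eq_complex/= !mul0r !mul1r subr0 add0r !eqxx.
  have pw k : Ci ^+ k.*2 = (-1) ^+ k.
    by elim: k => [|k IH]; rewrite ?expr0// doubleS !exprS IH mulrA Ci_sqr.
  have ev k : (Ci * toC y) ^+ k.*2 / k.*2`!%:R = Complex (cos_coeff y k.*2) (sin_coeff y k.*2).
    rewrite exprMn pw -rmorphXn -mulrA -(rmorph_nat (real_complex R)) -fmorphV -rmorphM.
    rewrite -(rmorphN1 (real_complex R)) -rmorphXn -rmorphM.
    by rewrite /cos_coeff /sin_coeff/= odd_double/= doubleK !mul0r mul1r mulrA.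
  have od k : (Ci * toC y) ^+ k.*2.+1 / k.*2.+1`!%:R = Complex (cos_coeff y k.*2.+1) (sin_coeff y k.*2.+1).
    rewrite exprMn [Ci ^+ k.*2.+1]exprS pw -rmorphXn -mulrA -(rmorph_nat (real_complex R)) -fmorphV -rmorphM.
    rewrite -(rmorphN1 (real_complex R)) -rmorphXn -mulrA -rmorphM.
    apply/eqP; rewrite eq_complex/= /cos_coeff /sin_coeff/= odd_double/= doubleK.
    by rewrite !mul0r !mul1r subr0 add0r mulrA !eqxx.
  by rewrite -(odd_double_half m); case: (odd m); rewrite /= ?add1n ?add0n; split; rewrite -?doubleS; [exact: od|exact: ev|exact: ev|exact: od].
rewrite /exp_sum; elim: N => [|N IH]; first by rewrite !big_ord0.
by rewrite !big_ord_recr/= IH (term N).1.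
Qed.

(** Since [cexp] is given by real functions, the series at [x + iy] is compared with the product of
    the series at [x] and at [iy]; the defect is bounded by the same defect at [|x|] and [|y|],
    which tends to 0. *)
Lemma exp_sum_cexp_cvg z : (fun N => normc (exp_sum N z - cexp z)) @ \oo --> (0 : R).
Proof.
case: z => x y; set z := Complex x y.
have zE : z = toC x + Ci * toC y.
  by apply/eqP; rewrite eq_complex/= !mul0r !mul1r subr0 !add0r addr0 !eqxx.
pose cN N := \sum_(m < N) cos_coeff y m; pose sN N := \sum_(m < N) sin_coeff y m.
pose rho N := exp_sum N `|x| * exp_sum N `|y| - exp_sum N (`|x| + `|y|).
pose g N := rho N + (`|exp_sum N x * cN N - expR x * cos y| + `|exp_sum N x * sN N - expR x * sin y|).
have g0 : g N @[N --> \oo] --> 0.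
  rewrite -[0]addr0; apply: cvgD.
    have <- : expR `|x| * expR `|y| - expR (`|x| + `|y|) = 0 by rewrite expRD subrr.
    by apply: cvgB; [apply: cvgM|]; exact: cvg_exp_sum.
  rewrite -[0]addr0; apply: cvgD.
    have <- : `|expR x * cos y - expR x * cos y| = 0 by rewrite subrr normr0.
    apply: cvg_norm; apply: cvgB; last exact: cvg_cst.
    by apply: cvgM; [exact: cvg_exp_sum|exact: cvg_cos_sum].
  have <- : `|expR x * sin y - expR x * sin y| = 0 by rewrite subrr normr0.
  apply: cvg_norm; apply: cvgB; last exact: cvg_cst.
  by apply: cvgM; [exact: cvg_exp_sum|exact: cvg_sin_sum].
apply: (squeeze_cvgr _ (cvg_cst (0 : R)) g0); near=> N; rewrite normc_ge0/=.
apply: (le_trans (normc_sub_le _ (exp_sum N (toC x) * exp_sum N (Ci * toC y)) _)); apply: lerD.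
  rewrite zE (exp_sumM _ _ (leqnn N)) opprD addNKr normcN.
  apply: (le_trans (normc_sum _ _ _)).
  rewrite /rho (exp_sumM _ _ (leqnn N)) addrAC subrr add0r.
  apply: ler_sum => j _; apply: (le_trans (normc_sum _ _ _)); apply: ler_sum => k _.
  case: ifP => _; first by rewrite Normc.normc0.
  have nn l : normc (l`!%:R^-1) = l`!%:R^-1.
    by rewrite -(rmorph_nat (real_complex R)) -fmorphV normc_real ger0_norm ?invr_ge0.
  rewrite !Normc.normcM !normcX !nn Normc.normcM !normc_real.
  by rewrite /Normc.normc/= expr0n expr1n/= add0r sqrtr1 mul1r.
apply: (le_trans (normc_le_ReIm _)).
rewrite exp_sum_real exp_sum_imag -/(cN N) -/(sN N) /=.
by rewrite !mul0r subr0 addr0.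
Unshelve. all: by end_near. Qed.

(** Taylor coefficient of [sin z / z]: the cosine vanishes for odd [m] and alternates in sign over
    even [m]. *)
Definition sinc_coef m : R := cos (phs R m) / m.+1`!%:R.
Definition sinc_sum N z : R[i] := \sum_(m < N) toC (sinc_coef m) * z ^+ m.

Lemma Ci_pow_sum m : Ci ^+ m + (- Ci) ^+ m = toC (2 * cos (phs R m)).
Proof.
have cosS k : cos (phs R k.+2) = - cos (phs R k).
  by have := @cos_phs2 R 0 k; rewrite !sub0r !cosN.
elim/ltn_ind: m => -[|[|m]] IH.
- by rewrite !expr0 /phs mul0r cos0 mulr1 rmorph_nat.
- by rewrite !expr1 subrr /phs mul1r cos_pihalf mulr0 rmorph0.
transitivity (- toC (2 * cos (phs R m))); last by rewrite cosS mulrN rmorphN.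
rewrite -IH; last exact: ltnW.
by rewrite !exprS !mulrA mulrNN Ci_sqr !mulN1r opprD.
Qed.

Lemma sinc_sum_exp N z :
  (exp_sum N.+1 (Ci * z) - exp_sum N.+1 (- (Ci * z))) = 2 * Ci * (z * sinc_sum N z).
Proof.
rewrite /exp_sum -sumrB big_ord_recl/= !expr0 subrr add0r /sinc_sum !mulr_sumr.
apply: eq_bigr => m _; rewrite /bump/= add1n -[- (Ci * z)]mulNr !exprMn -mulrBl.
have -> : toC (sinc_coef m) = (Ci ^+ m + (- Ci) ^+ m) / 2 / m.+1`!%:R.
  by rewrite Ci_pow_sum /sinc_coef !rmorphM rmorph_nat fmorphV rmorph_nat; field.
have f0 : m.+1`!%:R != 0 :> R[i] by rewrite pnatr_eq0 -lt0n fact_gt0.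
by rewrite !exprS; field; rewrite f0.
Qed.

Lemma sinc_sum_cvg z : (fun N => normc (sinc_sum N (toC pi * z) - sinc_pi z)) @ \oo --> (0 : R).
Proof.
rewrite /sinc_pi; case: eqP => [->|/eqP z0].
  have sN N : (0 < N)%N -> normc (sinc_sum N 0 - 1) = 0.
    case: N => // N _; rewrite /sinc_sum big_ord_recl/= big1 => [|m _]; last by rewrite expr0n mulr0.
    by rewrite addr0 expr0 mulr1 /sinc_coef /phs mul0r cos0 divr1 subrr Normc.normc0.
  rewrite mulr0; apply: cvg_near_cst; near=> N.
  by rewrite sN//; near: N; exact: nbhs_infty_gt.
set v := toC pi * z; have v0 : v != 0.
  by rewrite mulf_neq0// -(rmorph0 (real_complex R)) (inj_eq (@complexI R)) gt_eqF// pi_gt0.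
have nv : 0 < normc v.
  rewrite lt_neqAle normc_ge0 andbT eq_sym; apply: contra v0 => /eqP h.
  by apply/eqP; exact: Normc.eq0_normc.
have Ci0 : Ci != 0 by rewrite eq_complex/= oner_eq0 andbF.
pose g N := (2 * normc v)^-1 * (normc (exp_sum N.+1 (Ci * v) - cexp (Ci * v)) +
   normc (exp_sum N.+1 (- (Ci * v)) - cexp (- (Ci * v)))).
have g0 : g N @[N --> \oo] --> 0.
  rewrite -[0](mulr0 (2 * normc v)^-1) -[X in _ * X]addr0; apply: cvgM; first exact: cvg_cst.
  apply: cvgD.
    by have := @exp_sum_cexp_cvg (Ci * v); rewrite -cvg_shiftS.
  by have := @exp_sum_cexp_cvg (- (Ci * v)); rewrite -cvg_shiftS.
apply: (squeeze_cvgr _ (cvg_cst (0 : R)) g0); near=> N; rewrite normc_ge0/=.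
have -> : sinc_sum N v - csin v / v = (2 * Ci * v)^-1 *
  ((exp_sum N.+1 (Ci * v) - cexp (Ci * v)) - (exp_sum N.+1 (- (Ci * v)) - cexp (- (Ci * v)))).
  rewrite opprB addrACA [_ + cexp _]addrC addrACA; rewrite [cexp _ - cexp _ + _]addrC.
  rewrite sinc_sum_exp /csin -/Ci.
  by field; rewrite Ci0 v0.
rewrite Normc.normcM /g ler_pM ?normc_ge0//.
  rewrite Normc.normcV !Normc.normcM.
  have -> : normc 2 = 2 by rewrite -(rmorph_nat (real_complex R)) normc_real ger0_norm.
  by rewrite [normc Ci]/Normc.normc/= expr0n expr1n/= add0r sqrtr1 mulr1.
by apply: (le_trans (le_normcD _ _)); rewrite normcN.
Unshelve. all: by end_near. Qed.

Lemma sinc_sum_tail N n z r : normc z <= r -> (N <= n)%N ->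
  normc (sinc_sum n z - sinc_sum N z) <= exp_sum n r - exp_sum N r.
Proof.
move=> zr /subnKC <-; have r0 : 0 <= r by apply: le_trans zr; exact: normc_ge0.
elim: (n - N)%N => [|k IH]; first by rewrite addn0 !subrr Normc.normc0.
rewrite addnS /sinc_sum /exp_sum !big_ord_recr/= -/(sinc_sum (N + k) z) -/(exp_sum (N + k) r) -/(sinc_sum N z) -/(exp_sum N r).
rewrite addrAC [leRHS]addrAC; apply: (le_trans (le_normcD _ _)); apply: lerD => //.
rewrite Normc.normcM normc_real normcX mulrC; apply: ler_pM; rewrite ?exprn_ge0 ?normc_ge0//.
  by rewrite lerXn2r ?nnegrE ?normc_ge0.
rewrite /sinc_coef normrM [X in _ * X]ger0_norm ?invr_ge0// -[leRHS]mul1r ler_pM ?invr_ge0//; first exact: cos_itv.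
have fg l : 0 < l`!%:R :> R by rewrite ltr0n fact_gt0.
by rewrite lef_pV2 ?posrE// ler_nat factS leq_pmull.
Qed.

Lemma sinc_sum_uniform N z r : normc (toC pi * z) <= r ->
  normc (sinc_sum N (toC pi * z) - sinc_pi z) <= expR r - exp_sum N r.
Proof.
move=> zr; have r0 : 0 <= r by apply: le_trans zr; exact: normc_ge0.
apply/ler_addgt0Pr => e e0.
have := @sinc_sum_cvg z; move/cvgrPdist_le => /(_ _ e0) [n0 _ hn].
have := hn (maxn n0 N) (leq_maxl _ _); rewrite sub0r normrN ger0_norm ?normc_ge0// => h.
apply: (le_trans (normc_sub_le _ (sinc_sum (maxn n0 N) (toC pi * z)) _)); apply: lerD => //.
rewrite normc_distC; apply: (le_trans (sinc_sum_tail zr (leq_maxr _ _))).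
by rewrite lerD2r exp_sum_le_expR.
Qed.

(** The sign [(-1)^k] is what turns the binomial expansion of [(a + b)^m] into that of
    [(a - b)^m]. *)
Lemma phcos_sum j k : phcos R j k = (-1) ^+ k * cos (phs R (j + k)).
Proof.
elim/ltn_ind: k => -[|[|k]] IH.
- by rewrite addn0 /phcos /phs mul0r subr0 expr0 mul1r.
- rewrite addn1 expr1 mulN1r /phcos {2}/phs mul1r cosBpihalf.
  have -> : phs R j.+1 = phs R j + pi / 2 by rewrite /phs -natr1 mulrDl mul1r.
  by rewrite cosDpihalf opprK.
rewrite /phcos cos_phs2 -/(phcos R j k) IH; last exact: ltnW.
have := @cos_phs2 R 0 (j + k); rewrite !sub0r !cosN !addnS => ->.
by rewrite !exprS mulrA mulrNN mul1r mul1r mulrN.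
Qed.

Lemma sinc_sum_expand N a b : sinc_sum N (toC pi * (a - b)) =
  \sum_(m < N) \sum_(j < m.+1) toC (pi ^+ m * phcos R j (m - j) / m.+1%:R) *
    (a ^+ j / j`!%:R * (b ^+ (m - j) / (m - j)`!%:R)).
Proof.
apply: eq_bigr => m _; rewrite exprMn.
have f0 k : k`!%:R != 0 :> R[i] by rewrite pnatr_eq0 -lt0n fact_gt0.
have -> : toC (sinc_coef m) * (toC pi ^+ m * (a - b) ^+ m) =
    toC (pi ^+ m * cos (phs R m) / m.+1%:R) * ((a + - b) ^+ m / m`!%:R).
  rewrite /sinc_coef factS natrM !rmorphM !fmorphV rmorphM !rmorph_nat rmorphXn/=.
  move: (toC (cos _)) (toC pi ^+ m) => s t.
  have m1 : m.+1%:R != 0 :> R[i] by rewrite pnatr_eq0.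
  move: m1 (f0 m); move: (m.+1%:R : R[i]) (m`!%:R : R[i]) => x1 x2 h1 h2.
  by field; rewrite h1 h2.
rewrite exp_binom mulr_sumr; apply: eq_bigr => j _; have jm := ltn_ord j; rewrite ltnS in jm.
rewrite phcos_sum subnKC// [(- b) ^+ _]exprNn.
by rewrite !rmorphM !rmorphXn rmorphN1; ring.
Qed.

End ComplexSeries.

(** * The rescaled kernel *)

Section KernelTaylor.
Variable R : realType.
Local Notation toC := (real_complex R).
Local Notation normc := (@Normc.normc R).
Implicit Types (P : nat -> {poly R}) (x y : R) (a b : R[i]).

Lemma nderivn_horner_complex (Q : {poly R}) j x :
  (map_poly toC Q)^`N(j).[toC x] = toC Q^`(j).[x] / j`!%:R.
Proof.
rewrite nderivn_map horner_map nderivn_def hornerMn -mulr_natr rmorphM rmorph_nat.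
by rewrite mulfK// pnatr_eq0 -lt0n fact_gt0.
Qed.

Lemma repr_kernelC_taylor P n x y a b : (forall i, size (P i) = i.+1) ->
  repr_kernelC P n (toC x + a / toC y) (toC x + b / toC y) =
  \sum_(j < n) \sum_(k < n) toC (dKer P n j k x / y ^+ (j + k)) *
    (a ^+ j / j`!%:R * (b ^+ k / k`!%:R)).
Proof.
move=> sP.
have tay (i : 'I_n) a' : (map_poly toC (P i)).[toC x + a' / toC y] =
    \sum_(j < n) toC ((P i)^`(j).[x] / y ^+ j) * (a' ^+ j / j`!%:R).
  rewrite (@nderiv_taylor_wide _ n); [|exact: mulrC|by rewrite size_map_poly sP].
  apply: eq_bigr => j _; rewrite nderivn_horner_complex exprMn exprVn.
  by rewrite rmorphM fmorphV rmorphXn/=; ring.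
rewrite /repr_kernelC /repr_kernel.
transitivity (\sum_(i < n) \sum_(j < n) \sum_(k < n) toC ((P i)^`(j).[x] * (P i)^`(k).[x] / y ^+ (j + k)) *
    (a ^+ j / j`!%:R * (b ^+ k / k`!%:R))).
  apply: eq_bigr => i _; rewrite !tay mulr_suml; apply: eq_bigr => j _.
  rewrite mulr_sumr; apply: eq_bigr => k _.
  by rewrite exprD invfM !rmorphM/=; ring.
rewrite exchange_big/=; apply: eq_bigr => j _; rewrite exchange_big/=; apply: eq_bigr => k _.
by rewrite -mulr_suml /dKer [X in _ = toC X * _]mulr_suml rmorph_sum.
Qed.

(** Near-covering by unit discs; the complex-valued norm behind the topology is translated into the
    real [normc]. *)
Lemma compact_normc_bounded (A : set (R[i])^o) : compact A ->
  exists2 r : R, 0 <= r & forall a : R[i], A a -> normc a <= r.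
Proof.
move=> /compact_near_coveringP /(_ nat \oo (fun n z => normc z <= n%:R)) h.
have {h} : \forall n \near \oo, forall z : R[i], A z -> normc z <= n%:R.
  apply: h => z _.
  exists (ball (z : (R[i])^o) (1 : R[i]), [set n | normc z + 1 <= n%:R]).
    split => /=; first exact: nbhsx_ballx.
    exact: nbhs_infty_ger.
  move=> [z' n] /= [zz' zn]; apply: le_trans zn.
  have : normc (z' - z) <= 1.
    rewrite normc_distC.
    move: zz'; rewrite -ball_normE /ball_/= normc_def -(rmorph1 (real_complex R)) ltcR.
    by move=> h; apply: ltW; case: (z - z') h.
  move=> h; rewrite -[z'](subrK z) addrC; apply: (le_trans (le_normcD _ _)).
  by rewrite lerD2l.
move=> [n _ hn]; exists n%:R => // a Aa.
by apply: (hn n) => //=.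
Qed.

End KernelTaylor.

(** The integral of a nonnegative function is a supremum over the simple functions below it, hence
    monotone for arbitrary functions. The complex kernel expression is compared in this way with a
    measurable real majorant. *)
Lemma ge0_le_integral_nonmeas d (T : measurableType d) (R : realType)
  (mu : {measure set T -> \bar R}) (D : set T) (f g : T -> \bar R) :
  (forall x, D x -> (0 <= f x)%E) -> (forall x, D x -> (f x <= g x)%E) ->
  (\int[mu]_(x in D) f x <= \int[mu]_(x in D) g x)%E.
Proof.
move=> f0 fg; have g0 x : D x -> (0 <= g x)%E by move=> Dx; exact: le_trans (f0 x Dx) (fg x Dx).
rewrite !ge0_integralE//; apply: ge_ereal_sup => _ [h/= hf <-].
apply: ereal_sup_ubound; exists h => //= x; apply: (le_trans (hf x)).
by rewrite /patch; case: ifP => //; rewrite inE => /fg.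
Qed.

Lemma pow_diff_le (R : realDomainType) (s t Q : R) q : `|s| <= Q -> `|t| <= Q ->
  `|s ^+ q.+1 - t ^+ q.+1| <= q.+1%:R * Q ^+ q * `|s - t|.
Proof.
move=> sQ tQ; have Q0 : 0 <= Q by exact: le_trans sQ.
rewrite subrXX normrM mulrC ler_wpM2r//; apply: (le_trans (ler_norm_sum _ _ _)).
apply: (@le_trans _ _ (\sum_(i < q.+1) Q ^+ q)); last by rewrite sumr_const card_ord mulr_natl.
apply: ler_sum => i _; have iq := ltn_ord i; rewrite ltnS in iq.
by rewrite normrM !normrX -[in leRHS](subnK iq) exprD ler_pM ?exprn_ge0// lerXn2r ?nnegrE.
Qed.

Lemma near_rint_sum (R : realType) (D : set (measurableTypeR R)) (f : nat -> nat -> R -> R) N :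
  measurable D -> (lebesgue_measure D < +oo)%E ->
  (forall i e, 0 < e -> \forall n \near \oo, bmf D (f n i) /\
     \int[lebesgue_measure]_(x in D) f n i x <= e) ->
  forall e, 0 < e -> \forall n \near \oo, bmf D (fun x => \sum_(i < N) f n i x) /\
     \int[lebesgue_measure]_(x in D) (\sum_(i < N) f n i x) <= e.
Proof.
move=> mD fD hf; elim: N => [|N IH] e e0.
  near=> n; have -> : (fun x => \sum_(i < 0) f n i x) = fun=> 0.
    by apply/funext => x; rewrite big_ord0.
  split; first exact: bmf_cst.
  by rewrite rint_cst// mul0r ltW.
have e2 : 0 < e / 2 by rewrite divr_gt0.
near=> n.
have [b1 i1] : bmf D (fun x => \sum_(i < N) f n i x) /\
  \int[lebesgue_measure]_(x in D) (\sum_(i < N) f n i x) <= e / 2 by near: n; exact: IH.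
have [b2 i2] : bmf D (f n N) /\ \int[lebesgue_measure]_(x in D) f n N x <= e / 2.
  by near: n; exact: hf.
have -> : (fun x => \sum_(i < N.+1) f n i x) = fun x => \sum_(i < N) f n i x + f n N x.
  by apply/funext => x; rewrite big_ord_recr.
split; first exact: bmfD.
by rewrite rintD//; lra.
Unshelve. all: by end_near. Qed.

(** * Convergence of the Taylor coefficients and passage to L^p *)

Section Universality.
Variable R : realType.
Variable mu : {finite_measure set (measurableTypeR R) -> \bar R}.
Variable P : nat -> {poly R}.
Hypothesis hP : orthonormal_polys mu P.
Hypothesis hreg : regular_measure mu.
Variables (w : R -> R) (c d m M : R).
Hypothesis w_density : ac_density mu w.
Hypotheses (lt_N1c : -1 < c) (lt_d1 : d < 1).
Hypothesis mu_ac : abs_continuous_on mu `[c, d].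
Hypothesis m0 : 0 < m.
Hypothesis wb : forall x, c <= x <= d -> m <= w x <= M.
Variables (u v : R).
Hypotheses (cu : c < u) (uv : u <= v) (vd : v < d).
Local Notation leb := (@lebesgue_measure R).
Local Notation K := (diagK P).
Local Notation toC := (real_complex R).
Local Notation normc := (@Normc.normc R).

Let mI : measurable (itvcc u v). Proof. exact: measurable_itv. Qed.
Let fI : (leb (itvcc u v) < +oo)%E. Proof. exact: lebesgue_itvcc_fin. Qed.
Let wM x : c <= x <= d -> w x <= M. Proof. by case/wb/andP. Qed.
Let wm x : c <= x <= d -> m <= w x. Proof. by case/wb/andP. Qed.
Let inI x : u <= x <= v -> c <= x <= d.
Proof. by move=> /andP[h1 h2]; rewrite (le_trans (ltW cu) h1) (le_trans h2 (ltW vd)). Qed.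

Lemma dKer00 n x : dKer P n 0 0 x = K n x.
Proof. by apply: eq_bigr => i _; rewrite !derivn0 expr2. Qed.

(* Taylor coefficient, without the factorials, of the rescaled kernel. *)
Definition eK n j k x : R := dKer P n j k x / (K n x * (w x * K n x) ^+ (j + k)).

(** The limit of [eK]: as [K n x / n] is close to [om / w], the powers of [om] in [limKer] cancel
    against those of [w K / n]. *)
Definition limE j k : R := pi ^+ (j + k) * phcos R j k / (j + k).+1%:R.

Lemma eK_denominator : exists2 k0, 0 < k0 & \forall n \near \oo, forall x, u <= x <= v ->
  [/\ 0 < K n x, k0 * n%:R <= K n x & forall q,
    0 < (k0 * n%:R) * (m * (k0 * n%:R)) ^+ q <= K n x * (w x * K n x) ^+ q].
Proof.
have [k0 k00 hk] := diagK_lower hP w_density lt_N1c lt_d1 mu_ac m0 wb cu vd.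
exists k0 => //; near=> n => x hx.
have n0 : 0 < (n%:R : R) by rewrite ltr0n; near: n; exact: nbhs_infty_gt.
have hK : k0 * n%:R <= K n x by move: x hx; near: n; exact: hk.
have kn : 0 < k0 * n%:R by rewrite mulr_gt0.
have K0 : 0 < K n x by exact: lt_le_trans hK.
split=> // q; have w1 := wm (inI hx); have mk : 0 < m * (k0 * n%:R) by rewrite mulr_gt0.
rewrite mulr_gt0 ?exprn_gt0//=; apply: ler_pM; rewrite ?exprn_ge0 ?(ltW kn) ?(ltW mk)//.
have mkw : m * (k0 * n%:R) <= w x * K n x by apply: ler_pM => //; exact: ltW.
by rewrite lerXn2r ?nnegrE ?(le_trans (ltW mk) mkw) ?(ltW mk).
Unshelve. all: by end_near. Qed.

(** The upper bounds on derivative sums divided by the lower bound on the diagonal kernel: all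
    powers of [n] cancel and the bound is geometric in [j + k]. *)
Lemma eK_bound : exists C E : R, [/\ 0 <= C, 0 <= E &
  \forall n \near \oo, forall x j k, u <= x <= v -> `|eK n j k x| <= C * E ^+ (j + k)].
Proof.
have [k0 k00 hk] := eK_denominator.
have [C [D [C0 D0 hD]]] := dK_diag_bound hP w_density lt_N1c lt_d1 mu_ac m0 wb cu vd.
have mk0 : 0 < m * k0 by rewrite mulr_gt0.
exists (C / k0), (D / (m * k0)); split; [by rewrite divr_ge0// ltW|by rewrite divr_ge0// ltW|].
near=> n => x j k hx.
have n0 : 0 < (n%:R : R) by rewrite ltr0n; near: n; exact: nbhs_infty_gt.
have [K0 hK hq] : [/\ 0 < K n x, k0 * n%:R <= K n x & forall q,
    0 < (k0 * n%:R) * (m * (k0 * n%:R)) ^+ q <= K n x * (w x * K n x) ^+ q].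
  by move: x hx; near: n; exact: hk.
have /andP[q0 q1] := hq (j + k)%N.
have B : `|dKer P n j k x| <= C * n%:R * (D * n%:R) ^+ (j + k).
  have CN : 0 <= C * n%:R by rewrite mulr_ge0// ltW.
  have DN i : 0 <= (D * n%:R) ^+ i by rewrite exprn_ge0// mulr_ge0// ltW.
  rewrite normr_le_sqr; last exact: mulr_ge0.
  apply: (le_trans (sum_mul_CS (fun i : 'I_n => (P i)^`(j).[x]) (fun i : 'I_n => (P i)^`(k).[x]))).
  have -> : (C * n%:R * (D * n%:R) ^+ (j + k)) ^+ 2 =
     (C * n%:R * ((D * n%:R) ^+ j) ^+ 2) * (C * n%:R * ((D * n%:R) ^+ k) ^+ 2).
    by rewrite [(D * n%:R) ^+ (j + k)]exprD; move: ((D * n%:R) ^+ j) ((D * n%:R) ^+ k) => s t; ring.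
  by apply: ler_pM; rewrite ?hD//; apply: sumr_ge0 => i _; exact: sqr_ge0.
rewrite /eK normrM normfV [X in _ * X^-1]ger0_norm; last exact: le_trans (ltW q0) q1.
rewrite ler_pdivrMr; last exact: lt_le_trans q0 q1.
apply: (le_trans B).
apply: (@le_trans _ _ (C / k0 * (D / (m * k0)) ^+ (j + k) * ((k0 * n%:R) * (m * (k0 * n%:R)) ^+ (j + k)))).
  have -> : m * (k0 * n%:R) = (m * k0) * n%:R by ring.
  rewrite !exprMn exprVn.
  have p1 : (m ^+ (j + k) * k0 ^+ (j + k)) != 0 by rewrite mulf_neq0// expf_neq0// gt_eqF.
  rewrite exprMn; move: (m ^+ (j + k)) (k0 ^+ (j + k)) (D ^+ (j + k)) (n%:R ^+ (j + k)) p1 => s1 s2 s3 s4 p1.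
  rewrite le_eqVlt; apply/orP; left; apply/eqP; move: p1; rewrite mulf_eq0 negb_or => /andP[p1 p2].
  by field; rewrite ?p1 ?p2 ?(gt_eqF k00).
apply: ler_wpM2l => //; apply: mulr_ge0; first by rewrite divr_ge0// ltW.
by rewrite exprn_ge0// divr_ge0// ltW.
Unshelve. all: by end_near. Qed.

Lemma limKer00 x : limKer 0 0 x = 1 :> R.
Proof. by rewrite /limKer expr0 mul1r /phcos subrr cos0 divr1. Qed.

(** Numerator and denominator are both handled by [dKer_L1], the latter through [j = k = 0];
    boundedness of [K n x / n], from above and below, lets the quotient and the powers inherit the
    [L^1] estimate. *)
Lemma eK_L1 j k e : 0 < e -> \forall n \near \oo, bmf (itvcc u v) (fun x => `|eK n j k x - limE j k|) /\
  \int[leb]_(x in itvcc u v) `|eK n j k x - limE j k| <= e.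
Proof.
move=> e0; have [k0 k00 hk] := eK_denominator.
have [C [D [C0 D0 hD]]] := dK_diag_bound hP w_density lt_N1c lt_d1 mu_ac m0 wb cu vd.
have bg0 : bmf (itvcc c d) (gfun w) := bmf_gfun w_density lt_N1c lt_d1 m0 wb.
have [mg [B hB]] := bg0.
have icd x : u <= x <= v -> itvcc c d x by move=> /inI; rewrite /itvcc/= in_itv.
have Iuv x : itvcc u v x -> u <= x <= v by rewrite /itvcc/= in_itv.
have uvcd : itvcc u v `<=` itvcc c d by move=> x /Iuv/icd.
have M0 : 0 < M.
  have hu : c <= u <= d by apply: inI; rewrite lexx.
  by apply: (lt_le_trans m0); apply: le_trans (wM hu); exact: wm.
set q := (j + k)%N; pose l := limE j k.
(* [Q n] bounds both [K n] and [n * gfun], so the difference of their powers is at most a constant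
   times their difference. *)
pose Q := C + `|B|; have Q0 : 0 <= Q by rewrite addr_ge0// ltW.
have mk0 : 0 < m * k0 by rewrite mulr_gt0.
pose Z := (k0 * (m * k0) ^+ q)^-1.
have Z0 : 0 < Z by rewrite invr_gt0 mulr_gt0// exprn_gt0.
pose W := `|l| * M ^+ q * (q.+1%:R * Q ^+ q).
have W0 : 0 <= W by rewrite mulr_ge0// mulr_ge0 ?exprn_ge0// ltW.
pose eta := e / (Z * (1 + W)).
have ZW : 0 < Z * (1 + W) by rewrite mulr_gt0// ltr_pwDl.
have eta0 : 0 < eta by rewrite divr_gt0.
near=> n.
have n0 : 0 < (n%:R : R) by rewrite ltr0n; near: n; exact: nbhs_infty_gt.
have hk' x : u <= x <= v -> [/\ 0 < K n x, k0 * n%:R <= K n x & forall q,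
    0 < (k0 * n%:R) * (m * (k0 * n%:R)) ^+ q <= K n x * (w x * K n x) ^+ q].
  by move: x; near: n; exact: hk.
have I1 : \int[leb]_(x in itvcc u v) `|dKer P n j k x - n%:R ^+ (j + k).+1 * (limKer j k x * gfun w x)| <= eta * n%:R ^+ (j + k).+1.
  by near: n; exact: (dKer_L1 hP hreg w_density lt_N1c lt_d1 mu_ac m0 wb cu uv vd j k eta0).
have I2 : \int[leb]_(x in itvcc u v) `|dKer P n 0 0 x - n%:R ^+ (0 + 0).+1 * (limKer 0 0 x * gfun w x)| <= eta * n%:R ^+ (0 + 0).+1.
  by near: n; exact: (dKer_L1 hP hreg w_density lt_N1c lt_d1 mu_ac m0 wb cu uv vd 0 0 eta0).
pose d1 x := dKer P n j k x - n%:R ^+ q.+1 * (limKer j k x * gfun w x).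
pose d2 x := dKer P n 0 0 x - n%:R ^+ (0 + 0).+1 * (limKer 0 0 x * gfun w x).
rewrite -/q in I1; rewrite expr1 in I2.
have nq : 0 < (n%:R : R) ^+ q by rewrite exprn_gt0.
have bg : bmf (itvcc u v) (gfun w) by apply: bmf_sub bg0; [|exact: measurable_itv].
have bw : bmf (itvcc u v) w.
  by apply: bmf_sub (bmf_w w_density wM); [|exact: measurable_itv].
have bl i i' : bmf (itvcc u v) (limKer i i').
  by apply: bmf_limKer; [exact: lt_trans cu|exact: lt_trans lt_d1].
have bK : bmf (itvcc u v) (K n).
  by apply: (@bmf_ext _ _ (dKer P n 0 0)) => //; first [exact: bmf_dKer|by move=> x _; rewrite dKer00].
have bd1 : bmf (itvcc u v) d1 by apply: bmfB; [exact: bmf_dKer|apply: bmfZ; exact: bmfM].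
have bd2 : bmf (itvcc u v) d2 by apply: bmfB; [exact: bmf_dKer|apply: bmfZ; exact: bmfM].
have beK : bmf (itvcc u v) (eK n j k).
  apply: bmfM; first exact: bmf_dKer.
  have cc : 0 < (k0 * n%:R) * (m * (k0 * n%:R)) ^+ q.
    by rewrite mulr_gt0 ?exprn_gt0 ?mulr_gt0 ?mulr_gt0.
  apply: (bmfV cc); first by apply: bmfM => //; apply: bmfX; exact: bmfM.
  move=> x /Iuv/hk'[_ _ /(_ q)/andP[q0 q1]].
  by apply: (le_trans q1); exact: ler_norm.
have bE : bmf (itvcc u v) (fun x => `|eK n j k x - limE j k|).
  by apply: bmf_norm; apply: bmfB => //; exact: bmf_cst.
split => //.
pose bound x := Z / n%:R ^+ q.+1 * (`|d1 x| + W * n%:R ^+ q * `|d2 x|).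
have bb1 : bmf (itvcc u v) (fun x => `|d1 x|) by exact: bmf_norm.
have bb2 : bmf (itvcc u v) (fun x => W * n%:R ^+ q * `|d2 x|) by apply: bmfZ; exact: bmf_norm.
have bb : bmf (itvcc u v) (fun x => `|d1 x| + W * n%:R ^+ q * `|d2 x|) by exact: bmfD.
apply: (@le_trans _ _ (\int[leb]_(x in itvcc u v) bound x)).
  apply: rint_le => //; first exact: bmfZ.
  move=> x /Iuv hx; have [K0 hK hq] := hk' x hx.
  have /andP[q0 q1] := hq q.
  have wx0 : 0 < w x by exact: lt_le_trans (wm (inI hx)).
  (* Over the common denominator, [d1] carries the error of the numerator and the difference of
     powers that of the diagonal kernel. *)
  have num : eK n j k x - l =
      (d1 x + l * w x ^+ q * ((n%:R * gfun w x) ^+ q.+1 - K n x ^+ q.+1)) / (K n x * (w x * K n x) ^+ q).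
    rewrite /eK -/q -{1}[l](@mulfK _ (K n x * (w x * K n x) ^+ q)); last first.
      by rewrite gt_eqF// (lt_le_trans q0).
    rewrite -mulrBl; congr (_ / _).
    have -> : dKer P n j k x = d1 x + n%:R ^+ q.+1 * (limKer j k x * gfun w x) by rewrite /d1 subrK.
    have -> : n%:R ^+ q.+1 * (limKer j k x * gfun w x) = l * w x ^+ q * (n%:R * gfun w x) ^+ q.+1.
      rewrite /limKer -/q /l /limE -/q /gfun !exprMn [om x ^+ q.+1]exprS [(w x)^-1 ^+ q.+1]exprVn [w x ^+ q.+1]exprS.
      have wq : w x ^+ q != 0 by rewrite expf_neq0// gt_eqF.
      move: (n%:R ^+ q.+1) (om x ^+ q) (w x ^+ q) (pi ^+ q) wq => s1 s2 s3 s4 wq.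
      have qn : q.+1%:R != 0 :> R by rewrite pnatr_eq0.
      move: (q.+1%:R : R) qn => s5 qn.
      by field; rewrite wq qn gt_eqF.
    by rewrite [(w x * K n x) ^+ q]exprMn [K n x ^+ q.+1]exprS; ring.
  rewrite -/l num normrM normfV [X in _ * X^-1]ger0_norm; last exact: le_trans (ltW q0) q1.
  rewrite ler_pdivrMr; last exact: lt_le_trans q0 q1.
  have T : `|d1 x + l * w x ^+ q * ((n%:R * gfun w x) ^+ q.+1 - K n x ^+ q.+1)| <=
      `|d1 x| + W * n%:R ^+ q * `|d2 x|.
    apply: (le_trans (ler_normD _ _)); rewrite lerD2l normrM [X in X * _ <= _]normrM.
    have h1 : `|n%:R * gfun w x| <= Q * n%:R.
      rewrite normrM normr_nat mulrC ler_wpM2r// /Q -[leLHS]add0r lerD ?(ltW C0)//.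
      by apply: (le_trans (hB x (icd x hx))); exact: ler_norm.
    have h2 : `|K n x| <= Q * n%:R.
      rewrite gtr0_norm// mulrDl -[leLHS]addr0 lerD ?mulr_ge0//.
      have := hD n 0%N x hx; rewrite expr0 expr1n mulr1 => h; apply: le_trans h.
      by apply: ler_sum => i _; rewrite derivn0.
    have h3 := pow_diff_le q h1 h2.
    have e2 : `|n%:R * gfun w x - K n x| = `|d2 x|.
      by rewrite distrC /d2 limKer00 mul1r expr1 dKer00.
    rewrite e2 in h3.
    apply: (@le_trans _ _ (`|l| * M ^+ q * (q.+1%:R * (Q * n%:R) ^+ q * `|d2 x|))).
      apply: ler_pM; [by rewrite mulr_ge0|exact: normr_ge0| |exact: h3].
      rewrite ler_wpM2l// normrX gtr0_norm// lerXn2r ?nnegrE ?(ltW wx0) ?(ltW M0)//.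
      exact: wM (inI hx).
    by rewrite /W exprMn le_eqVlt; apply/orP; left; apply/eqP; ring.
  apply: (le_trans T); rewrite /bound [leRHS]mulrAC -[leLHS]mul1r ler_wpM2r//.
    by rewrite addr_ge0// mulr_ge0// mulr_ge0// ltW.
  apply: (@le_trans _ _ (Z / n%:R ^+ q.+1 * ((k0 * n%:R) * (m * (k0 * n%:R)) ^+ q))).
    have -> : m * (k0 * n%:R) = (m * k0) * n%:R by ring.
    rewrite /Z [(m * k0 * n%:R) ^+ q]exprMn [n%:R ^+ q.+1]exprS.
    have mkq : (m * k0) ^+ q != 0 by rewrite expf_neq0// gt_eqF.
    have nq' : (n%:R : R) ^+ q != 0 by rewrite gt_eqF.
    move: ((m * k0) ^+ q) (n%:R ^+ q) mkq nq' => s1 s2 h1 h2.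
    rewrite le_eqVlt; apply/orP; left; apply/eqP.
    by field; rewrite h1 h2 !gt_eqF.
  by rewrite ler_wpM2l// divr_ge0 ?exprn_ge0// ltW.
rewrite /bound rintZ// rintD// rintZ//; last exact: bmf_norm.
have Zn : 0 <= Z / n%:R ^+ q.+1 by rewrite divr_ge0 ?exprn_ge0// ltW.
have Wn : 0 <= W * n%:R ^+ q by rewrite mulr_ge0// ltW.
apply: (le_trans (ler_wpM2l Zn (lerD I1 (ler_wpM2l Wn I2)))).
have gen (z w' s t y : R) : s != 0 -> t != 0 ->
    z / (t * s) * (y * (t * s) + w' * s * (y * t)) = y * (z * (1 + w')).
  by move=> s0 t0; field; rewrite s0 t0.
by rewrite exprS gen ?gt_eqF// /eta divfK// gt_eqF.
Unshelve. all: by end_near. Qed.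


Lemma repr_kernel_diagK n x : repr_kernel P n x x = K n x.
Proof. by apply: eq_bigr => i _; rewrite expr2. Qed.

Lemma scaled_kernel_taylor n x (a b : R[i]) :
  repr_kernelC P n (toC x + a / toC (repr_kernel_tilde w P n x))
    (toC x + b / toC (repr_kernel_tilde w P n x)) / toC (repr_kernel P n x x) =
  \sum_(j < n) \sum_(k < n) toC (eK n j k x) * (a ^+ j / j`!%:R * (b ^+ k / k`!%:R)).
Proof.
case: hP => sP _ _; rewrite repr_kernelC_taylor// /repr_kernel_tilde repr_kernel_diagK mulr_suml.
apply: eq_bigr => j _; rewrite mulr_suml; apply: eq_bigr => k _.
by rewrite /eK invfM !rmorphM !fmorphV/=; ring.
Qed.

Definition taylor_err N n x : R :=
  \sum_(q < N) \sum_(j < q.+1) `|eK n j (q - j) x - limE j (q - j)|.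

Lemma normc_term (r : R) (a b : R[i]) s j k : normc a <= r -> normc b <= r ->
  normc (toC s * (a ^+ j / j`!%:R * (b ^+ k / k`!%:R))) <=
  `|s| * (r ^+ j / j`!%:R * (r ^+ k / k`!%:R)).
Proof.
move=> ar br; have r0 : 0 <= r by apply: le_trans ar; exact: normc_ge0.
have nn l : normc (l`!%:R^-1) = l`!%:R^-1.
  by rewrite -(rmorph_nat (real_complex R)) -fmorphV normc_real ger0_norm ?invr_ge0.
rewrite !Normc.normcM !normcX !nn normc_real ler_wpM2l// ler_pM ?mulr_ge0 ?exprn_ge0 ?invr_ge0 ?normc_ge0//.
  by rewrite ler_wpM2r ?invr_ge0// lerXn2r ?nnegrE ?normc_ge0.
by rewrite ler_wpM2r ?invr_ge0// lerXn2r ?nnegrE ?normc_ge0.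
Qed.

(** Three errors: the kernel terms with [j + k >= N], the tail of the sinc series, and the finitely
    many remaining coefficients. Only the last depends on [x] in the bound, through [taylor_err]. *)
Lemma scaled_kernel_sinc (r C E : R) N n x (a b : R[i]) :
  normc a <= r -> normc b <= r -> 0 <= C -> 0 <= E -> (N <= n)%N ->
  (forall j k, `|eK n j k x| <= C * E ^+ (j + k)) ->
  normc (\sum_(j < n) \sum_(k < n) toC (eK n j k x) * (a ^+ j / j`!%:R * (b ^+ k / k`!%:R)) -
      sinc_pi (a - b)) <=
  C * (expR (E * r + E * r) - exp_sum N (E * r + E * r)) +
    (expR (pi * (r + r)) - exp_sum N (pi * (r + r))) + exp_sum N (r + r) * taylor_err N n x.
Proof.
move=> ar br C0 E0 Nn he; have r0 : 0 <= r by apply: le_trans ar; exact: normc_ge0.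
pose f j k : R[i] := toC (eK n j k x) * (a ^+ j / j`!%:R * (b ^+ k / k`!%:R)).
rewrite (sum_square_split f Nn) -/f.
set T := \sum_(q < N) _; set U := \sum_(j < n) _.
have sU : normc U <= C * (expR (E * r + E * r) - exp_sum N (E * r + E * r)).
  apply: (@le_trans _ _ (C * (exp_sum n (E * r) * exp_sum n (E * r) - exp_sum N (E * r + E * r)))); last first.
    rewrite ler_wpM2l// lerD2r expRD; have Er : 0 <= E * r by rewrite mulr_ge0.
    have e1 := exp_sum_le_expR n Er.
    have e2 : 0 <= exp_sum n (E * r) by apply: sumr_ge0 => i _; rewrite divr_ge0// exprn_ge0.
    by apply: ler_pM.
  rewrite (exp_sumM _ _ Nn) addrAC subrr add0r mulr_sumr.
  apply: (le_trans (normc_sum _ _ _)); apply: ler_sum => j _; rewrite mulr_sumr.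
  apply: (le_trans (normc_sum _ _ _)); apply: ler_sum => k _.
  case: ifP => _; first by rewrite Normc.normc0 mulr0.
  apply: (le_trans (normc_term _ _ _ ar br)).
  have -> : C * ((E * r) ^+ j / j`!%:R * ((E * r) ^+ k / k`!%:R)) =
     (C * E ^+ (j + k)) * (r ^+ j / j`!%:R * (r ^+ k / k`!%:R)).
    by rewrite exprD !exprMn; ring.
  by apply: ler_wpM2r; [rewrite !mulr_ge0 ?exprn_ge0 ?invr_ge0|exact: he].
have sS : normc (sinc_sum N (toC pi * (a - b)) - sinc_pi (a - b)) <= expR (pi * (r + r)) - exp_sum N (pi * (r + r)).
  apply: sinc_sum_uniform; rewrite Normc.normcM normc_real ger0_norm ?pi_ge0//.
  rewrite ler_wpM2l ?pi_ge0//; apply: (le_trans (le_normcD _ _)).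
  by rewrite normcN lerD.
have sT : normc (T - sinc_sum N (toC pi * (a - b))) <= exp_sum N (r + r) * taylor_err N n x.
  rewrite sinc_sum_expand /T -sumrB mulr_sumr; apply: (le_trans (normc_sum _ _ _)).
  apply: ler_sum => q _; rewrite -sumrB mulr_sumr.
  apply: (le_trans (normc_sum _ _ _)); apply: ler_sum => j _.
  have jq := ltn_ord j; rewrite ltnS in jq.
  rewrite /f -mulrBl -rmorphB mulrC.
  have -> : pi ^+ q * phcos R j (q - j) / q.+1%:R = limE j (q - j) by rewrite /limE subnKC.
  rewrite [X in normc X]mulrC; apply: (le_trans (normc_term _ _ _ ar br)).
  rewrite [leRHS]mulrC; apply: ler_wpM2l => //.
  have rr k : 0 <= r ^+ k / k`!%:R by rewrite divr_ge0 ?exprn_ge0.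
  apply: (@le_trans _ _ ((r + r) ^+ q / q`!%:R)).
    rewrite exp_binom (bigD1 j)//= lerDl; apply: sumr_ge0 => i _; exact: mulr_ge0.
  rewrite /exp_sum (bigD1 q)//= lerDl; apply: sumr_ge0 => i _.
  by rewrite divr_ge0// exprn_ge0// addr_ge0.
have -> : T + U - sinc_pi (a - b) = U + (sinc_sum N (toC pi * (a - b)) - sinc_pi (a - b)) +
    (T - sinc_sum N (toC pi * (a - b))) by ring.
apply: (le_trans (le_normcD _ _)); apply: lerD => //.
by apply: (le_trans (le_normcD _ _)); exact: lerD.
Qed.

Lemma exp_sum_eventually (x e : R) : 0 < e -> exists N0, forall N, (N0 <= N)%N -> expR x - exp_sum N x <= e.
Proof.
move=> e0; have /cvgrPdist_le/(_ _ e0) [N0 _ hN] := @cvg_exp_sum R x.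
by exists N0 => N h; apply: (le_trans (ler_norm _)); exact: hN.
Qed.

Lemma taylor_err_small N e : 0 < e -> \forall n \near \oo, bmf (itvcc u v) (taylor_err N n) /\
  \int[leb]_(x in itvcc u v) taylor_err N n x <= e.
Proof.
apply: (@near_rint_sum R (itvcc u v) (fun n q x => \sum_(j < q.+1) `|eK n j (q - j) x - limE j (q - j)|) N mI fI) => q.
apply: (@near_rint_sum R (itvcc u v) (fun n j x => `|eK n j (q - j) x - limE j (q - j)|) q.+1 mI fI) => j.
by move=> e' e'0; exact: eK_L1.
Qed.

(** Beyond [tau], the error is at most [h = S * taylor_err], which is small in [L^1] and bounded by
    [Bd]. Where [h <= tau] the [p]-th power is at most [(2 tau)^p]; elsewhere it is at most
    [(tau + Bd)^p <= Dp h]. Thus [L^1] smallness suffices for every [p > 0]. *)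
Lemma scaled_kernel_Lp (p : R) (r eps : R) : 0 < p -> 0 <= r -> 0 < eps ->
  \forall n \near \oo, forall a b : R[i], normc a <= r -> normc b <= r ->
  (\int[leb]_(x in itvcc u v)
     ((normc (repr_kernelC P n (toC x + a / toC (repr_kernel_tilde w P n x))
         (toC x + b / toC (repr_kernel_tilde w P n x)) / toC (repr_kernel P n x x)
         - sinc_pi (a - b))) `^ p)%:E < eps%:E)%E.
Proof.
move=> p0 r0 eps0; have [C [E [C0 E0 hCE]]] := eK_bound.
pose len := v - u; have len0 : 0 <= len by rewrite subr_ge0.
(* Solves [(2 tau)^p = eps / (2 (len + 1))], so that the constant part of the majorant integrates to
   at most [eps / 2]; the [+ 1] covers an interval of length 0. *)
pose tau := (eps / (2 * (len + 1))) `^ p^-1 / 2.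
have l1 : 0 < 2 * (len + 1) by rewrite mulr_gt0// ltr_wpDl.
have el : 0 < eps / (2 * (len + 1)) by rewrite divr_gt0.
have tau0 : 0 < tau by rewrite divr_gt0// powR_gt0.
have tauE : (2 * tau) `^ p = eps / (2 * (len + 1)).
  rewrite /tau mulrC divfK// -powRrM mulVf ?gt_eqF// powRr1//; exact: ltW.
have C1 : 0 < C + 1 by exact: ltr_wpDl.
have t2 : 0 < tau / (2 * (C + 1)) by rewrite divr_gt0// mulr_gt0.
have [N1 hN1] := exp_sum_eventually (E * r + E * r) t2.
have t3 : 0 < tau / 2 by rewrite divr_gt0.
have [N2 hN2] := exp_sum_eventually (pi * (r + r)) t3.
pose N := maxn N1 N2.
have tail : C * (expR (E * r + E * r) - exp_sum N (E * r + E * r)) +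
    (expR (pi * (r + r)) - exp_sum N (pi * (r + r))) <= tau.
  rewrite [leRHS]splitr; apply: lerD; last by apply: hN2; exact: leq_maxr.
  apply: (@le_trans _ _ (C * (tau / (2 * (C + 1))))).
    by rewrite ler_wpM2l// hN1// leq_maxl.
  rewrite mulrA ler_pdivrMr ?mulr_gt0//.
  have -> : tau / 2 * (2 * (C + 1)) = C * tau + tau by field.
  by rewrite lerDl ltW.
pose S := exp_sum N (r + r).
have S0 : 0 <= S by apply: sumr_ge0 => i _; rewrite divr_ge0// exprn_ge0// addr_ge0.
pose Bd := S * \sum_(q < N) \sum_(j < q.+1) (C * E ^+ (j + (q - j)) + `|limE j (q - j)|).
have Bd0 : 0 <= Bd.
  rewrite mulr_ge0//; apply: sumr_ge0 => q _; apply: sumr_ge0 => j _.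
  by rewrite addr_ge0// mulr_ge0// exprn_ge0.
pose Dp := (tau + Bd) `^ p / tau.
have Dp0 : 0 <= Dp by rewrite divr_ge0 ?powR_ge0// ltW.
pose e1 := eps / (4 * (Dp * S + 1)).
have DS : 0 <= Dp * S by exact: mulr_ge0.
have DS1 : 0 < 4 * (Dp * S + 1) by rewrite mulr_gt0// ltr_wpDl.
have e10 : 0 < e1 by rewrite divr_gt0.
near=> n => a b ar br.
have Nn : (N <= n)%N by near: n; exact: nbhs_infty_ge.
have hb x j k : u <= x <= v -> `|eK n j k x| <= C * E ^+ (j + k).
  by move: x j k; near: n; exact: hCE.
have [bT iT] : bmf (itvcc u v) (taylor_err N n) /\ \int[leb]_(x in itvcc u v) taylor_err N n x <= e1.
  by near: n; exact: taylor_err_small.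
pose G x := (2 * tau) `^ p + Dp * S * taylor_err N n x.
have bG : bmf (itvcc u v) G by apply: bmfD; [exact: bmf_cst|exact: bmfZ].
apply: (@le_lt_trans _ _ (\int[leb]_(x in itvcc u v) (G x)%:E)%E).
  apply: ge0_le_integral_nonmeas => x; first by move=> _; rewrite lee_fin powR_ge0.
  move=> xI; have hx : u <= x <= v by move: xI; rewrite /itvcc/= in_itv.
  rewrite lee_fin scaled_kernel_taylor.
  have H := scaled_kernel_sinc ar br C0 E0 Nn (fun j k => hb x j k hx).
  set Y := normc _ in H *; rewrite -/S in H.
  have Y0 : 0 <= Y by exact: normc_ge0.
  have T0 : 0 <= taylor_err N n x by apply: sumr_ge0 => q _; apply: sumr_ge0.
  set h := S * taylor_err N n x in H.
  have h0 : 0 <= h by exact: mulr_ge0.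
  have Yh : Y <= tau + h by apply: (le_trans H); rewrite lerD2r.
  rewrite /G -mulrA -/h; have [ht|ht] := leP h tau.
    apply: (@le_trans _ _ ((2 * tau) `^ p)); last by rewrite lerDl mulr_ge0.
    by apply: ge0_ler_powR; rewrite ?nnegrE ?(ltW p0)//; lra.
  have hB : h <= Bd.
    rewrite ler_wpM2l//; apply: ler_sum => q _; apply: ler_sum => j _.
    by apply: (le_trans (ler_normB _ _)); rewrite lerD2r hb.
  apply: (@le_trans _ _ ((tau + Bd) `^ p)).
    by apply: ge0_ler_powR; rewrite ?nnegrE ?(ltW p0)//; lra.
  apply: (@le_trans _ _ (Dp * h)); last by rewrite lerDr powR_ge0.
  rewrite /Dp mulrAC ler_pdivlMr// ler_wpM2l ?powR_ge0//; exact: ltW.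
rewrite rint_EFin// lte_fin /G rintD//; [|exact: bmf_cst|exact: bmfZ].
rewrite rintZ// rint_cst// fine_lebesgue_itvcc// tauE -/len.
have q1 : eps / (2 * (len + 1)) * len <= eps / 2.
  rewrite mulrAC ler_pdivrMr//.
  have -> : eps / 2 * (2 * (len + 1)) = eps * len + eps by field.
  by rewrite lerDl ltW.
have q2 : Dp * S * \int[leb]_(x in itvcc u v) taylor_err N n x <= eps / 4.
  apply: (le_trans (ler_wpM2l DS iT)).
  rewrite /e1 mulrA ler_pdivrMr//.
  have -> : eps / 4 * (4 * (Dp * S + 1)) = Dp * S * eps + eps by field.
  by rewrite lerDl ltW.
apply: (le_lt_trans (lerD q1 q2)); lra.
Unshelve. all: by end_near. Qed.

End Universality.

Theorem theorem1p5 (R : realType)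
  (mu : {finite_measure set (measurableTypeR R) -> \bar R})
  (w : R -> R) (P : nat -> {poly R})
  (mu_carried : carried_by_open_unit mu)
  (mu_supp : infinite_set (measure_support mu))
  (P_orth : orthonormal_polys mu P)
  (w_density : ac_density mu w)
  (mu_regular : regular_measure mu)
  (p : R) (p_gt0 : 0 < p)
  (c d : R) (lt_N1c : -1 < c) (lt_cd : c < d) (lt_d1 : d < 1)
  (mu_ac : abs_continuous_on mu `[c, d])
  (w_bounds : exists m M : R,
     0 < m /\ forall x, x \in `[c, d] -> m <= w x <= M)
  (c' d' : R) (le_c'd' : c' <= d')
  (sub_interior : `[c', d'] `<=` interior (`[c, d] : set R))
  (A B : set (R[i])^o) (A_compact : compact A) (B_compact : compact B)
  (eps : R) (eps_gt0 : 0 < eps) :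
  \forall n \near \oo, forall a b : R[i], A a -> B b ->
    (\int[lebesgue_measure]_(x in `[c', d'])
       ((Normc.normc
          (repr_kernelC P n
             (real_complex R x
              + a / real_complex R (repr_kernel_tilde w P n x))
             (real_complex R x
              + b / real_complex R (repr_kernel_tilde w P n x))
           / real_complex R (repr_kernel P n x x)
           - sinc_pi (a - b))) `^ p)%:E
     < eps%:E)%E.
Proof.
have [m [M [m0 wb]]] := w_bounds.
have wb' x : c <= x <= d -> m <= w x <= M by move=> hx; apply: wb; rewrite in_itv.
(* A neighbourhood inside [[c, d]] leaves room on both sides of each point of [[c', d']]; at the
   endpoints this gives [c < c'] and [d' < d]. *)
have near_int x : `[c', d']%classic x -> exists2 e, 0 < e & c <= x - e /\ x + e <= d.
  move=> /sub_interior; rewrite /interior/= -filter_from_ballE => -[e /= e0 he].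
  exists (e / 2); first by rewrite divr_gt0.
  have h1 : c <= x - e / 2 <= d.
    have := he (x - e / 2); rewrite /ball/= in_itv; apply.
    by rewrite opprB addrCA subrr addr0 gtr0_norm ?divr_gt0//; lra.
  have h2 : c <= x + e / 2 <= d.
    have := he (x + e / 2); rewrite /ball/= in_itv; apply.
    by rewrite opprD addrA subrr sub0r normrN gtr0_norm ?divr_gt0//; lra.
  by case/andP: h1 => -> _; case/andP: h2.
have cc : c < c'.
  have [|e e0 [h _]] := near_int c'; first by rewrite /= in_itv/= lexx.
  by lra.
have dd : d' < d.
  have [|e e0 [_ h]] := near_int d'; first by rewrite /= in_itv/= lexx andbT.
  by lra.
have [r1 r10 h1] := compact_normc_bounded A_compact.
have [r2 r20 h2] := compact_normc_bounded B_compact.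
(* One radius for both compact sets reduces uniformity in [a] and [b] to uniformity on a disc. *)
have rr : 0 <= Num.max r1 r2 by rewrite le_max r10.
near=> n => a b Aa Bb.
move: a b {Aa Bb} (h1 a Aa) (h2 b Bb) => a b ha hb.
have ha' : Normc.normc a <= Num.max r1 r2 by rewrite le_max ha.
have hb' : Normc.normc b <= Num.max r1 r2 by rewrite le_max hb orbT.
move: a b ha' hb' {ha hb}; near: n.
exact: (scaled_kernel_Lp P_orth mu_regular w_density lt_N1c lt_d1 mu_ac m0 wb' cc le_c'd' dd p_gt0 rr eps_gt0).
Unshelve. all: by end_near. Qed.
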